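(* Let $d\ge 1$ be a real number and let $F(s)=\sum_{n=1}^{\infty}\frac{a_n}{n^s}$ be an element of $\mathfrak{A}^{\#}_d$ (the set of elements of degree $d$ in the class $\mathfrak{A}^{\#}$). Then $$\sum_{n<X}|a_n|=\Omega\left(X^{\frac{1}{2}+\frac{1}{2d}}\right)\qquad (X\to\infty).$$ In particular, the abscissa of absolute convergence $\sigma_a$ of the Dirichlet series $F(s)$ satisfies $\sigma_a\ge \frac12+\frac{1}{2d}$.
   Context: Write $s=\sigma+it$ with $\sigma,t\in\mathbb{R}$. The class $\mathfrak{A}^{\#}$ is the set of meromorphic functions $F(s)\neq 0$ (not identically zero) on $\mathbb{C}$ satisfying the following three conditions. (P1) $F(s)$ is given by a Dirichlet series $\sum_{n=1}^{\infty}\frac{a_n}{n^s}$ with (finite) abscissa of absolute convergence $\sigma_a\ge 1/2$. (P2) There is a (nonzero) polynomial $P(s)$ such that $P(s)F(s)$ extends to an entire function, and such that given any vertical strip $\sigma_1\le\sigma\le\sigma_2$ there is some $M\in\mathbb{R}$ such that $P(s)F(s)\ll(1+|t|)^M$ in that strip. (P3) There exist a real number $Q>0$, a complex number $\omega$ with $|\omega|=1$, and a function $G(s)$ of the form $$G(s)=\prod_{j=1}^{r}\Gamma(\lambda_js+\mu_j)\prod_{j'=1}^{r'}\Gamma(\lambda'_{j'}s+\mu'_{j'})^{-1},$$ where $\lambda_j,\lambda'_{j'}>0$ are real, $\mu_j,\mu'_{j'}\in\mathbb{C}$, and $\Gamma$ is the usual gamma function, such that $$\Phi(s):=Q^sG(s)F(s)=\omega\,\overline{\Phi(1-\bar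 s)}.$$ The degree of $F$ is $d_F=2\sum_{j=1}^{r}\lambda_j-2\sum_{j'=1}^{r'}\lambda'_{j'}$; it is known not to depend on the choice of $G(s)$ in (P3). The set of $F\in\mathfrak{A}^{\#}$ with $d_F=d$ is denoted $\mathfrak{A}^{\#}_d$. For positive $g$, $f(X)=\Omega(g(X))$ means that $f(X)$ is not $o(g(X))$ as $X\to\infty$, i.e. $\limsup_{X\to\infty}|f(X)|/g(X)>0$. *)

(* Defs.v *)
From Stdlib Require Export Reals Factorial.
From Coquelicot Require Export Coquelicot.
From Stdlib Require Export List.

Open Scope R_scope.

Definition Cexp (z : C) : C :=
  (exp (Re z) * cos (Im z), exp (Re z) * sin (Im z)).

(** [x ^ s] for real [x > 0]; like [Rpower], it is a junk value when [x <= 0]. *)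
Definition Cpower (x : R) (s : C) : C := Cexp (s * RtoC (ln x))%C.

Definition Cprod (l : list C) : C := fold_right Cmult (RtoC 1) l.

(** Limit of a sequence of complex numbers, a junk value if it diverges. *)
Definition Clim_seq (u : nat -> C) : C :=
  (real (Lim_seq (fun n => Re (u n))), real (Lim_seq (fun n => Im (u n)))).

(** Gauss's definition: [Gamma s] is the limit of
    [n! n^s / (s (s+1) ... (s+n))].  The limit exists in [C] for every [s]
    other than the poles 0, -1, -2, ..., where the value is junk. *)
Definition Gamma (s : C) : C :=
  Clim_seq (fun n =>
    (RtoC (INR (fact n)) * Cpower (INR n) s
     / Cprod (map (fun k => s + RtoC (INR k)) (seq 0 (S n))))%C).

Definition holomorphic_at (f : C -> C) (z : C) : Prop :=
  ex_derive (K := C_AbsRing) (V := C_NormedModule) f z.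

Definition entire (f : C -> C) : Prop := forall z : C, holomorphic_at f z.

(** A meromorphic function is represented by a total function [C -> C] whose
    values on a closed discrete set (in particular at the poles) are
    irrelevant. *)
Definition meromorphic (f : C -> C) : Prop :=
  forall z0 : C, exists (n : nat) (g : C -> C),
    locally (T := C_UniformSpace) z0 (holomorphic_at g) /\
    locally' (T := C_UniformSpace) z0 (fun z => f z = (g z / (z - z0) ^ n)%C).

(** Equality of meromorphic functions: equality outside a closed discrete
    set. *)
Definition mero_eq (f g : C -> C) : Prop :=
  forall z0 : C, locally' (T := C_UniformSpace) z0 (fun z => f z = g z).

Definition nonzero_polynomial (P : C -> C) : Prop :=
  (exists (n : nat) (c : nat -> C), forall z : C,
      P z = sum_n (G := C_AbelianMonoid) (fun k => (c k * z ^ k)%C) n) /\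
  exists z : C, P z <> RtoC 0.

(** The series is [a 1 / 1^s + a 2 / 2^s + ...]; the term of index [n] below is
    [a_(n+1) / (n+1)^s], and [a 0] is never used. *)
Definition dirichlet_term (a : nat -> C) (s : C) (n : nat) : C :=
  (a (S n) / Cpower (INR (S n)) s)%C.

Definition abscissa_abs_conv (a : nat -> C) : Rbar :=
  Glb_Rbar (fun sigma =>
    ex_series (fun n => Cmod (dirichlet_term a (RtoC sigma) n))).

Definition given_by_dirichlet_series (F : C -> C) (a : nat -> C) : Prop :=
  is_finite (abscissa_abs_conv a) /\
  Rbar_le (Finite (1 / 2)) (abscissa_abs_conv a) /\
  forall s : C, Rbar_lt (abscissa_abs_conv a) (Finite (Re s)) ->
    is_series (K := C_AbsRing) (V := C_NormedModule)
      (dirichlet_term a s) (F s).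

Definition polynomial_growth (F : C -> C) : Prop :=
  exists P E : C -> C,
    nonzero_polynomial P /\ entire E /\
    mero_eq E (fun s => (P s * F s)%C) /\
    forall sigma1 sigma2 : R, exists M K : R, forall s : C,
      sigma1 <= Re s <= sigma2 ->
      Cmod (E s) <= K * Rpower (1 + Rabs (Im s)) M.

(** The pairs [(lambda, mu)] in [l] and in [l'] are the parameters of the gamma
    factors in the numerator and in the denominator, respectively. *)
Definition gamma_factor (l l' : list (R * C)) (s : C) : C :=
  (Cprod (map (fun p => Gamma (RtoC (fst p) * s + snd p)) l)
   * Cprod (map (fun p => / Gamma (RtoC (fst p) * s + snd p)) l'))%C.

Definition Rlist_sum (l : list R) : R := fold_right Rplus 0 l.

Definition gamma_degree (l l' : list (R * C)) : R :=
  2 * Rlist_sum (map fst l) - 2 * Rlist_sum (map fst l').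

Definition functional_equation
    (F : C -> C) (Q : R) (omega : C) (l l' : list (R * C)) : Prop :=
  let Phi := fun s => (Cpower Q s * gamma_factor l l' s * F s)%C in
  0 < Q /\ Cmod omega = 1 /\
  Forall (fun p => 0 < fst p) l /\ Forall (fun p => 0 < fst p) l' /\
  mero_eq Phi (fun s => (omega * Cconj (Phi (RtoC 1 - Cconj s)))%C).

Definition A_sharp (F : C -> C) : Prop :=
  meromorphic F /\ ~ mero_eq F (fun _ => RtoC 0) /\
  (exists a, given_by_dirichlet_series F a) /\
  polynomial_growth F /\
  exists Q omega l l', functional_equation F Q omega l l'.

(** The degree does not depend on the gamma factors chosen in the functional
    equation, so it is enough that some choice has degree [d]. *)
Definition has_degree (F : C -> C) (d : R) : Prop :=
  exists Q omega l l',
    functional_equation F Q omega l l' /\ gamma_degree l l' = d.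

Definition A_sharp_deg (d : R) (F : C -> C) : Prop :=
  A_sharp F /\ has_degree F d.

(** Sum of [|a n|] over the integers [n] with [1 <= n < X]; every such [n] is at
    most [up X]. *)
Definition abs_coef_sum (a : nat -> C) (X : R) : R :=
  sum_n_m (fun n => if Rlt_dec (INR n) X then Cmod (a n) else 0)
    1 (Z.to_nat (up X)).

(** [is_domin F g f] is Coquelicot's [f = o(g)] along the filter [F]. *)
Definition Omega (f g : R -> R) : Prop :=
  ~ is_domin (Rbar_locally p_infty) g f.

(* Main.v *)
Require Import Defs.
From Stdlib Require Import Lia Lra Psatz Classical.

(** Why the theorem holds.

    Let [m] be the least index with [a m <> 0].  On a vertical line [Re s = c]
    far to the right, [F] equals [a_m m^(-s)] up to a small relative error.  By
    the functional equation, on the reflected line [Re s = 1 - c] the function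
    [F] is, up to a small relative error, a constant times [m^(it)] times a ratio
    of gamma factors; Stirling's formula ([Stirling], [reflection_ratio_line])
    says that this ratio has modulus of order [t^(d (c - 1/2))] and phase
    [- d t ln t] plus a linear term.

    For large [T] multiply [F] by the entire function
    [exp (al (s - iT)^2 / T + be (s - iT))].  On vertical lines it is a Gaussian of
    width about [sqrt T] around height [T]; the frequency [be = d ln T + beta0] is
    chosen so that on [Re s = 1 - c] the phase of the product is stationary at [T].
    There the integral has no cancellation and is at least
    [kappa T^(d/2)] times the mass of the Gaussian ([window_main_term]).  By
    Cauchy's theorem ([Cauchy_rectangle]), the integral on [Re s = c] is almost the
    same; the poles of [F] are harmless because they are zeros of a polynomial,
    and the integration takes place high up in the half-plane.  On [Re s = c] the
    integral is the sum over [n] of [a_n] times the integral of an explicit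
    function; moving the line of integration of each term to [Re s = sqrt T] or
    [Re s = - sqrt T] bounds it by the mass of the Gaussian times
    [exp (- sqrt T |ln n - be|)] ([window_coef_le]).  Dividing by the mass gives
    ([window_lower_bound], [short_window_bound])

      [kappa T^(d/2) <= sum_n |a_n| exp (- sqrt T |ln n - d ln T - beta0|)].

    So the coefficients are large on average already in the short interval where
    [ln n] is within [1 / sqrt T] of [be].  For [T = K^2 + k K] with [0 <= k < K]
    these intervals are essentially disjoint.  Adding the [K] inequalities counts
    each [n] a bounded number of times and only sees [n] up to a constant times
    [K^(2d)], hence [kappa K^(d+1) <= C sum_(n < C K^(2d)) |a_n| + o(1)]
    ([short_windows_contradiction]).  With [X = C K^(2d)] the left-hand side is of
    order [X^(1/2 + 1/(2d))], which is the Omega-result.  If the series converged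
    absolutely at some [sigma < 1/2 + 1/(2d)], the sum would be [O(X^sigma)], so
    the bound on the abscissa follows. *)

(* [ring] recognizes its carrier up to syntax, so the canonical structures on R
   and C are first folded to their carriers *)
Ltac Rring := match goal with |- @eq _ ?a ?b => change (@eq R a b) end; ring.
Ltac Cring := match goal with |- @eq _ ?a ?b => change (@eq C a b) end; ring.

Local Notation continuous_Rplus := (continuous_plus (V := R_NormedModule)).
Local Notation continuous_Rminus := (continuous_minus (V := R_NormedModule)).
Local Notation continuous_Ropp := (continuous_opp (V := R_NormedModule)).
Local Notation continuous_Rmult := (continuous_mult (K := R_AbsRing)).
Local Notation ex_derive_Rcontinuous := (ex_derive_continuous (V := R_NormedModule)).
Local Notation is_derive_Rplus := (is_derive_plus (V := R_NormedModule)).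
Local Notation is_derive_Rminus := (is_derive_minus (V := R_NormedModule)).
Local Notation RInt_Rplus := (RInt_plus (V := R_CompleteNormedModule)).
Local Notation RInt_Rscal := (RInt_scal (V := R_CompleteNormedModule)).
Local Notation ex_RInt_Rscal := (ex_RInt_scal (V := R_NormedModule)).

Lemma Rmax_le_inv a b t : Rmax a b <= t -> a <= t /\ b <= t.
Proof. generalize (Rmax_l a b) (Rmax_r a b). lra. Qed.

(** * Complex-valued integrals *)

Definition CInt (f : R -> C) (a b : R) : C :=
  (RInt (fun t => Re (f t)) a b, RInt (fun t => Im (f t)) a b).

Definition Ccont (f : R -> C) (t : R) : Prop :=
  continuous (fun t => Re (f t)) t /\ continuous (fun t => Im (f t)) t.

Lemma Ccont_ex_RInt (f : R -> C) a b :
  a <= b -> (forall t, a <= t <= b -> Ccont f t) ->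
  ex_RInt (fun t => Re (f t)) a b /\ ex_RInt (fun t => Im (f t)) a b.
Proof.
  intros Hab Hf.
  split; apply (ex_RInt_continuous (V := R_CompleteNormedModule));
    rewrite Rmin_left, Rmax_right by lra; intros t Ht; apply (Hf t Ht).
Qed.

Lemma Ccont_ext (f g : R -> C) t :
  (forall t, f t = g t) -> Ccont f t -> Ccont g t.
Proof.
  intros H [H1 H2]; split.
  - apply continuous_ext with (2 := H1). intros u. now rewrite H.
  - apply continuous_ext with (2 := H2). intros u. now rewrite H.
Qed.

Lemma Ccont_const (c : C) t : Ccont (fun _ => c) t.
Proof. split; apply continuous_const. Qed.

Lemma Ccont_plus (f g : R -> C) t :
  Ccont f t -> Ccont g t -> Ccont (fun t => (f t + g t)%C) t.
Proof.
  intros [Hf1 Hf2] [Hg1 Hg2]; split; simpl; unfold Re, Im; simpl;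
  apply continuous_Rplus; assumption.
Qed.

Lemma Ccont_mult (f g : R -> C) t :
  Ccont f t -> Ccont g t -> Ccont (fun t => (f t * g t)%C) t.
Proof.
  intros [Hf1 Hf2] [Hg1 Hg2]; split; simpl; unfold Re, Im in *; simpl.
  - apply continuous_Rminus;
    apply continuous_Rmult; assumption.
  - apply continuous_Rplus;
    apply continuous_Rmult; assumption.
Qed.

Lemma Ccont_minus (f g : R -> C) t :
  Ccont f t -> Ccont g t -> Ccont (fun t => (f t - g t)%C) t.
Proof.
  intros Hf Hg. apply Ccont_ext with (fun t => (f t + (RtoC (-1)) * g t)%C).
  - intros; ring.
  - apply Ccont_plus; [assumption|]. apply Ccont_mult; [apply Ccont_const|assumption].
Qed.

Lemma Ccont_conj (f : R -> C) t : Ccont f t -> Ccont (fun t => Cconj (f t)) t.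
Proof.
  intros [H1 H2]; split; unfold Re, Im in *; simpl; [assumption|].
  now apply continuous_Ropp.
Qed.

Lemma Ccont_Cexp (f : R -> C) t : Ccont f t -> Ccont (fun t => Cexp (f t)) t.
Proof.
  intros [H1 H2]; split; unfold Cexp; unfold Re, Im in *; simpl;
  apply continuous_Rmult.
  1,3: apply continuous_comp with (g := exp); [assumption|apply continuous_exp].
  - apply continuous_comp with (g := cos); [assumption|apply continuous_cos].
  - apply continuous_comp with (g := sin); [assumption|apply continuous_sin].
Qed.

Lemma Cmod_sqr (z : C) : Cmod z * Cmod z = Re z * Re z + Im z * Im z.
Proof. generalize (Cmod2_alt z); simpl; intros; lra. Qed.

Lemma Cmod_le_ReIm (z : C) : Cmod z <= Rabs (Re z) + Rabs (Im z).
Proof.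
  generalize (Cmod_sqr z) (Cmod_ge_0 z) (Rabs_pos (Re z)) (Rabs_pos (Im z)).
  intros H H0 H1 H2.
  assert (Rabs (Re z) * Rabs (Re z) = Re z * Re z) by (rewrite <- Rabs_mult; apply Rabs_right; nra).
  assert (Rabs (Im z) * Rabs (Im z) = Im z * Im z) by (rewrite <- Rabs_mult; apply Rabs_right; nra).
  nra.
Qed.

Lemma im_le_Cmod (z : C) : Rabs (Im z) <= Cmod z.
Proof.
  generalize (Rmax_Cmod z) (Rmax_r (Rabs (fst z)) (Rabs (snd z))).
  unfold Im; lra.
Qed.

Lemma Re_minus (a b : C) : Re (a - b)%C = Re a - Re b.
Proof. reflexivity. Qed.

Lemma Im_minus (a b : C) : Im (a - b)%C = Im a - Im b.
Proof. reflexivity. Qed.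

Lemma Ccont_Cmod (f : R -> C) t : Ccont f t -> continuous (fun t => Cmod (f t)) t.
Proof.
  intros [H1 H2]. unfold Cmod.
  apply continuous_comp with (g := sqrt); [|apply continuous_sqrt].
  simpl.
  apply continuous_Rplus; simpl.
  - apply continuous_Rmult; [assumption|].
    apply continuous_Rmult; [assumption|apply continuous_const].
  - apply continuous_Rmult; [assumption|].
    apply continuous_Rmult; [assumption|apply continuous_const].
Qed.

Lemma CInt_Chasles (f : R -> C) a b c :
  a <= b -> b <= c -> (forall t, a <= t <= c -> Ccont f t) ->
  (CInt f a b + CInt f b c)%C = CInt f a c.
Proof.
  intros Hab Hbc H.
  destruct (Ccont_ex_RInt f a b Hab) as [H1 H2]; [intros; apply H; lra|].
  destruct (Ccont_ex_RInt f b c Hbc) as [H3 H4]; [intros; apply H; lra|].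
  unfold CInt, Cplus; simpl.
  f_equal; apply (RInt_Chasles (V := R_CompleteNormedModule)); assumption.
Qed.

Lemma CInt_plus (f g : R -> C) a b :
  a <= b -> (forall t, a <= t <= b -> Ccont f t) -> (forall t, a <= t <= b -> Ccont g t) ->
  CInt (fun t => (f t + g t)%C) a b = (CInt f a b + CInt g a b)%C.
Proof.
  intros Hab Hf Hg.
  destruct (Ccont_ex_RInt f a b Hab Hf) as [H1 H2].
  destruct (Ccont_ex_RInt g a b Hab Hg) as [H3 H4].
  unfold CInt, Cplus; simpl.
  f_equal; apply RInt_Rplus; assumption.
Qed.

Lemma CInt_scal (c : C) (f : R -> C) a b :
  a <= b -> (forall t, a <= t <= b -> Ccont f t) ->
  CInt (fun t => (c * f t)%C) a b = (c * CInt f a b)%C.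
Proof.
  intros Hab Hf.
  destruct (Ccont_ex_RInt f a b Hab Hf) as [H1 H2].
  unfold CInt, Cmult; simpl. f_equal.
  - rewrite (RInt_ext _ (fun t => minus (scal (fst c) (Re (f t))) (scal (snd c) (Im (f t)))))
      by (intros; reflexivity).
    rewrite (RInt_minus (V := R_CompleteNormedModule)).
    + rewrite !RInt_Rscal by assumption. reflexivity.
    + apply ex_RInt_Rscal; assumption.
    + apply ex_RInt_Rscal; assumption.
  - rewrite (RInt_ext _ (fun t => plus (scal (fst c) (Im (f t))) (scal (snd c) (Re (f t)))))
      by (intros; reflexivity).
    rewrite RInt_Rplus.
    + rewrite !RInt_Rscal by assumption. reflexivity.
    + apply ex_RInt_Rscal; assumption.
    + apply ex_RInt_Rscal; assumption.
Qed.

Lemma CInt_minus (f g : R -> C) a b :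
  a <= b -> (forall t, a <= t <= b -> Ccont f t) -> (forall t, a <= t <= b -> Ccont g t) ->
  CInt (fun t => (f t - g t)%C) a b = (CInt f a b - CInt g a b)%C.
Proof.
  intros Hab Hf Hg.
  destruct (Ccont_ex_RInt f a b Hab Hf) as [H1 H2].
  destruct (Ccont_ex_RInt g a b Hab Hg) as [H3 H4].
  unfold CInt, Cminus, Cplus, Copp; simpl.
  f_equal; apply (RInt_minus (V := R_CompleteNormedModule)); assumption.
Qed.

Lemma CInt_RtoC (g : R -> R) a b : CInt (fun t => RtoC (g t)) a b = RtoC (RInt g a b).
Proof.
  unfold CInt, RtoC; simpl. f_equal.
  rewrite RInt_const. unfold scal; simpl; unfold mult; simpl; ring.
Qed.

(** A rotation turns the integral into a positive real number, which reduces the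
    bound to the monotonicity of real integrals. *)
Lemma Cmod_CInt_le (f : R -> C) (g : R -> R) a b :
  a <= b -> (forall t, a <= t <= b -> Ccont f t) -> ex_RInt g a b ->
  (forall t, a < t < b -> Cmod (f t) <= g t) ->
  Cmod (CInt f a b) <= RInt g a b.
Proof.
  intros Hab Hf Hg Hfg.
  set (J := CInt f a b).
  assert (Hg0 : 0 <= RInt g a b).
  { apply RInt_ge_0; [assumption|assumption|]. intros t Ht.
    apply Rle_trans with (2 := Hfg t Ht). apply Cmod_ge_0. }
  destruct (Req_dec (Cmod J) 0) as [H0|H0]; [lra|].
  assert (HJ : 0 < Cmod J) by (generalize (Cmod_ge_0 J); lra).
  assert (E : CInt (fun t => (Cconj J * f t)%C) a b = (Cconj J * J)%C)
    by (apply CInt_scal; assumption).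
  assert (Hc : forall t, a <= t <= b -> Ccont (fun t => (Cconj J * f t)%C) t).
  { intros t Ht. apply Ccont_mult; [apply Ccont_const|auto]. }
  destruct (Ccont_ex_RInt _ a b Hab Hc) as [H1 H2].
  assert (E1 : RInt (fun t => Re (Cconj J * f t)%C) a b = Cmod J * Cmod J).
  { change (Re (CInt (fun t => (Cconj J * f t)%C) a b) = Cmod J * Cmod J).
    rewrite E, Cmod_sqr. unfold Re, Im; simpl. ring. }
  assert (E2 : RInt (fun t => Re (Cconj J * f t)%C) a b <= RInt (fun t => scal (Cmod J) (g t)) a b).
  { apply RInt_le; [assumption|assumption| |].
    - apply ex_RInt_Rscal; assumption.
    - intros t Ht. unfold scal; simpl; unfold mult; simpl.
      apply Rle_trans with (Cmod (Cconj J * f t)%C).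
      + apply Rle_trans with (2 := re_le_Cmod _). apply Rle_abs.
      + rewrite Cmod_mult, Cmod_conj. apply Rmult_le_compat_l; [lra|auto]. }
  assert (E3 : RInt (fun t => scal (Cmod J) (g t)) a b = Cmod J * RInt g a b)
    by (apply RInt_Rscal; assumption).
  rewrite E1, E3 in E2. apply Rmult_le_reg_l with (Cmod J); lra.
Qed.

Lemma Cmod_CInt_le_const (f : R -> C) (M : R) a b :
  a <= b -> (forall t, a <= t <= b -> Ccont f t) ->
  (forall t, a < t < b -> Cmod (f t) <= M) ->
  Cmod (CInt f a b) <= (b - a) * M.
Proof.
  intros Hab Hf HM.
  apply Rle_trans with (RInt (fun _ => M) a b).
  - apply Cmod_CInt_le; try assumption. apply ex_RInt_const.
  - rewrite RInt_const. unfold scal; simpl; unfold mult; simpl. lra.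
Qed.

(** * Complex differentiability *)

Local Notation contC f z := (continuous (T := C_UniformSpace) (U := C_UniformSpace) f z).

(** Carathéodory's form of complex differentiability: the difference quotient
    extends continuously.  All the differentiation rules become continuity
    rules. *)
Definition hol (f : C -> C) (z : C) : Prop :=
  exists phi : C -> C, contC phi z /\
    locally (T := C_UniformSpace) z (fun w => f w = (f z + phi w * (w - z))%C).

Lemma contC_intro (f : C -> C) z :
  continuous (T := C_UniformSpace) (fun z => Re (f z)) z ->
  continuous (T := C_UniformSpace) (fun z => Im (f z)) z ->
  contC f z.
Proof.
  intros H1 H2.
  apply continuous_ext with (fun z => (Re (f z), Im (f z))).
  - intros w; now destruct (f w).
  - apply (continuous_comp_2 (fun z => Re (f z)) (fun z => Im (f z)) (fun a b => (a, b))).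
    + assumption.
    + assumption.
    + apply continuous_ext with (fun x : R * R => x); [now intros []|apply continuous_id].
Qed.

Lemma contC_Re (f : C -> C) z : contC f z ->
  continuous (T := C_UniformSpace) (fun z => Re (f z)) z.
Proof.
  intros H. apply (continuous_comp f Re); [assumption|].
  apply (continuous_fst (U := R_UniformSpace) (V := R_UniformSpace)).
Qed.

Lemma contC_Im (f : C -> C) z : contC f z ->
  continuous (T := C_UniformSpace) (fun z => Im (f z)) z.
Proof.
  intros H. apply (continuous_comp f Im); [assumption|].
  apply (continuous_snd (U := R_UniformSpace) (V := R_UniformSpace)).
Qed.

Lemma contC_const (c z : C) : contC (fun _ => c) z.
Proof. apply continuous_const. Qed.

Lemma contC_id (z : C) : contC (fun z => z) z.
Proof. apply continuous_id. Qed.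

Lemma contC_plus (f g : C -> C) (z : C) : contC f z -> contC g z -> contC (fun z => (f z + g z)%C) z.
Proof.
  intros Hf Hg. apply contC_intro.
  - apply continuous_Rplus; apply contC_Re; assumption.
  - apply continuous_Rplus; apply contC_Im; assumption.
Qed.

Lemma contC_mult (f g : C -> C) (z : C) : contC f z -> contC g z -> contC (fun z => (f z * g z)%C) z.
Proof.
  intros Hf Hg. generalize (contC_Re _ _ Hf) (contC_Im _ _ Hf) (contC_Re _ _ Hg) (contC_Im _ _ Hg).
  intros. apply contC_intro.
  - apply continuous_Rminus;
    apply continuous_Rmult; assumption.
  - apply continuous_Rplus;
    apply continuous_Rmult; assumption.
Qed.

Lemma contC_opp (f : C -> C) (z : C) : contC f z -> contC (fun z => (- f z)%C) z.
Proof.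
  intros Hf. apply continuous_ext with (fun z => (RtoC (-1) * f z)%C); [intros; Cring|].
  apply contC_mult; [apply contC_const|assumption].
Qed.

Lemma contC_inv (f : C -> C) (z : C) : contC f z -> f z <> RtoC 0 -> contC (fun z => (/ f z)%C) z.
Proof.
  intros Hf H0. generalize (contC_Re _ _ Hf) (contC_Im _ _ Hf). intros H1 H2.
  assert (Hd : fst (f z) * (fst (f z) * 1) + snd (f z) * (snd (f z) * 1) <> 0).
  { intro E. apply H0. apply injective_projections; simpl; nra. }
  assert (Hc : continuous (T := C_UniformSpace) (U := R_UniformSpace)
     (fun z => / (fst (f z) * (fst (f z) * 1) + snd (f z) * (snd (f z) * 1))) z).
  { apply (continuous_comp (V := R_UniformSpace) (fun z => fst (f z) * (fst (f z) * 1) + snd (f z) * (snd (f z) * 1)) Rinv).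
    - apply continuous_Rplus; simpl.
      + apply continuous_Rmult; [assumption|].
        apply continuous_Rmult; [assumption|apply continuous_const].
      + apply continuous_Rmult; [assumption|].
        apply continuous_Rmult; [assumption|apply continuous_const].
    - apply continuous_Rinv. exact Hd. }
  apply contC_intro.
  - apply continuous_Rmult; assumption.
  - apply continuous_Rmult; [|assumption].
    apply continuous_Ropp; assumption.
Qed.

Lemma hol_contC (f : C -> C) (z : C) : hol f z -> contC f z.
Proof.
  intros [phi [Hp E]].
  apply continuous_ext_loc with (fun w => (f z + phi w * (w + - z))%C).
  - apply filter_imp with (2 := E). intros w Hw. symmetry. apply Hw.
  - apply contC_plus; [apply contC_const|]. apply contC_mult; [assumption|].
    apply contC_plus; [apply contC_id|apply contC_const].
Qed.

Lemma hol_const (c z : C) : hol (fun _ => c) z.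
Proof.
  exists (fun _ => RtoC 0). split; [apply contC_const|].
  apply filter_forall; intros; Cring.
Qed.

Lemma hol_id (z : C) : hol (fun z => z) z.
Proof.
  exists (fun _ => RtoC 1). split; [apply contC_const|].
  assert (H : forall w : C, w = (z + RtoC 1 * (w - z))%C) by (intros; ring).
  apply filter_forall, H.
Qed.

Lemma hol_ext (f g : C -> C) (z : C) : (forall z, f z = g z) -> hol f z -> hol g z.
Proof.
  intros H [phi [Hp E]]. exists phi. split; [assumption|].
  apply filter_imp with (2 := E). intros w Hw. now rewrite <- !H.
Qed.

Lemma hol_plus (f g : C -> C) (z : C) : hol f z -> hol g z -> hol (fun z => (f z + g z)%C) z.
Proof.
  intros [phi [Hp E]] [psi [Hq E']].
  exists (fun w => (phi w + psi w)%C). split; [now apply contC_plus|].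
  generalize (filter_and _ _ E E'). apply filter_imp.
  intros w [H H']. rewrite H, H'. Cring.
Qed.

Lemma hol_mult (f g : C -> C) (z : C) : hol f z -> hol g z -> hol (fun z => (f z * g z)%C) z.
Proof.
  intros Hf Hg. generalize (hol_contC _ _ Hg). intros Hgc.
  destruct Hf as [phi [Hp E]]. destruct Hg as [psi [Hq E']].
  exists (fun w => (phi w * g w + f z * psi w)%C). split.
  - apply contC_plus; apply contC_mult; try assumption. apply contC_const.
  - generalize (filter_and _ _ E E'). apply filter_imp.
    intros w [H H']. rewrite H. rewrite H' at 1 2. Cring.
Qed.

Lemma contC_locally_neq0 (g : C -> C) (z : C) : contC g z -> g z <> RtoC 0 ->
  locally (T := C_UniformSpace) z (fun w => g w <> RtoC 0).
Proof.
  intros Hg H0.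
  assert (H : open (T := C_UniformSpace) (fun w => w <> RtoC 0)).
  { intros w Hw.
    assert (Hw' : 0 < Cmod w) by (now apply Cmod_gt_0).
    apply locally_C. exists (mkposreal _ Hw'). intros y Hy E. subst y.
    unfold ball in Hy; simpl in Hy. unfold AbsRing_ball in Hy; simpl in Hy.
    change (Cmod (RtoC 0 - w)%C < Cmod w) in Hy.
    replace (RtoC 0 - w)%C with (- w)%C in Hy by Cring. rewrite Cmod_opp in Hy. lra. }
  apply (Hg (fun w => w <> RtoC 0)). apply H. assumption.
Qed.

Lemma hol_div (f g : C -> C) (z : C) : hol f z -> hol g z -> g z <> RtoC 0 -> hol (fun z => (f z / g z)%C) z.
Proof.
  intros Hf Hg H0. apply hol_mult; [assumption|].
  generalize (hol_contC _ _ Hg). intros Hgc.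
  destruct Hg as [psi [Hq E']].
  exists (fun w => (- psi w * / (g w * g z))%C). split.
  - apply contC_mult; [now apply contC_opp|]. apply contC_inv; [|apply Cmult_neq_0; auto].
    apply contC_mult; [assumption|apply contC_const].
  - generalize (filter_and _ _ E' (contC_locally_neq0 _ _ Hgc H0)). apply filter_imp.
    intros w [E Hw].
    assert (psi w * (w - z) = g w - g z)%C by (rewrite E; Cring).
    replace (- psi w * / (g w * g z) * (w - z))%C with (- (psi w * (w - z)) * / (g w * g z))%C by Cring.
    rewrite H. field. split; auto.
Qed.

Lemma hol_comp (f g : C -> C) (z : C) : hol f (g z) -> hol g z -> hol (fun z => f (g z)) z.
Proof.
  intros [phi [Hp E]] Hg. generalize (hol_contC _ _ Hg). intros Hgc.
  destruct Hg as [psi [Hq E']].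
  exists (fun w => (phi (g w) * psi w)%C). split.
  - apply contC_mult; [|assumption]. now apply (continuous_comp g phi).
  - apply Hgc in E. unfold filtermap in E.
    refine (filter_imp _ _ _ (filter_and _ _ E E')).
    intros w [H H']. rewrite H. rewrite H' at 2. Cring.
Qed.

(** The topology on C is that of the product of two lines, whose balls are
    squares; estimates are made with [Cmod]. *)
Lemma locally_Cmod (z : C) (P : C -> Prop) :
  locally (T := C_UniformSpace) z P <->
  exists delta : R, 0 < delta /\ forall w, Cmod (w - z)%C < delta -> P w.
Proof.
  rewrite locally_C. split.
  - intros [d Hd]. exists d. split; [apply cond_pos|]. intros w Hw. apply Hd. exact Hw.
  - intros [d [H0 Hd]]. exists (mkposreal d H0). intros w Hw. apply Hd. exact Hw.
Qed.

Lemma contC_iff (f : C -> C) z :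
  contC f z <-> forall eps, 0 < eps -> exists delta, 0 < delta /\
    forall w, Cmod (w - z)%C < delta -> Cmod (f w - f z)%C < eps.
Proof.
  split.
  - intros H eps Heps.
    assert (L : locally (T := C_UniformSpace) (f z) (fun y => Cmod (y - f z)%C < eps)).
    { apply locally_Cmod. exists eps. auto. }
    apply H in L. apply locally_Cmod in L. exact L.
  - intros H P HP. apply locally_Cmod in HP. destruct HP as [eps [He HP]].
    apply locally_Cmod. destruct (H eps He) as [d [Hd Hw]]. exists d. split; auto.
Qed.

Lemma holomorphic_at_hol (f : C -> C) (z : C) : holomorphic_at f z -> hol f z.
Proof.
  intros [l Hl].
  exists (fun w => if Ceq_dec w z then l else ((f w - f z) / (w - z))%C). split.
  - apply contC_iff. intros eps Heps.
    destruct Hl as [_ Hl]. specialize (Hl z (fun P H => H)).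
    assert (He2 : 0 < eps / 2) by lra.
    specialize (Hl (mkposreal _ He2)).
    destruct Hl as [d Hd]. exists d. split; [apply cond_pos|].
    intros w Hw. destruct (Ceq_dec z z) as [_|C]; [|congruence].
    destruct (Ceq_dec w z) as [E|N].
    + replace (l - l)%C with (RtoC 0) by Cring. rewrite Cmod_0. assumption.
    + specialize (Hd w Hw).
      change (Cmod ((f w - f z) - (w - z) * l)%C <= eps / 2 * Cmod (w - z)%C) in Hd.
      assert (Hwz : (w - z)%C <> RtoC 0) by (now apply Cminus_eq_contra).
      assert (0 < Cmod (w - z)%C) by (now apply Cmod_gt_0).
      replace ((f w - f z) / (w - z) - l)%C with (((f w - f z) - (w - z) * l) / (w - z))%C by (field; assumption).
      rewrite Cmod_div by assumption.
      apply Rmult_lt_reg_r with (Cmod (w - z)%C); [assumption|].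
      unfold Rdiv. rewrite Rmult_assoc, Rinv_l, Rmult_1_r by lra. nra.
  - apply filter_forall. intros w. destruct (Ceq_dec w z) as [E|N].
    + subst; Cring.
    + field. now apply Cminus_eq_contra.
Qed.

Lemma contC_Ccont_h (f : C -> C) (x y : R) : contC f (x, y) -> Ccont (fun t => f (t, y)) x.
Proof.
  intros H.
  assert (Hc : continuous (U := C_UniformSpace) (fun t : R => (t, y)) x).
  { apply (continuous_comp_2 (fun t => t) (fun _ => y) (fun a b => (a, b))).
    - apply continuous_id.
    - apply continuous_const.
    - apply continuous_ext with (fun x : R * R => x); [now intros []|apply continuous_id]. }
  split.
  - apply (continuous_comp (V := C_UniformSpace) (fun t => (t, y)) (fun z => Re (f z))); [assumption|now apply contC_Re].
  - apply (continuous_comp (V := C_UniformSpace) (fun t => (t, y)) (fun z => Im (f z))); [assumption|now apply contC_Im].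
Qed.

Lemma contC_Ccont_v (f : C -> C) (x y : R) : contC f (x, y) -> Ccont (fun t => f (x, t)) y.
Proof.
  intros H.
  assert (Hc : continuous (U := C_UniformSpace) (fun t : R => (x, t)) y).
  { apply (continuous_comp_2 (fun _ => x) (fun t => t) (fun a b => (a, b))).
    - apply continuous_const.
    - apply continuous_id.
    - apply continuous_ext with (fun x : R * R => x); [now intros []|apply continuous_id]. }
  split.
  - apply (continuous_comp (V := C_UniformSpace) (fun t => (x, t)) (fun z => Re (f z))); [assumption|now apply contC_Re].
  - apply (continuous_comp (V := C_UniformSpace) (fun t => (x, t)) (fun z => Im (f z))); [assumption|now apply contC_Im].
Qed.

(** * The exponential *)

Lemma mean_value (f df : R -> R) a b : a <= b ->
  (forall x, a <= x <= b -> is_derive f x (df x)) ->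
  exists c, a <= c <= b /\ f b - f a = df c * (b - a).
Proof.
  intros Hab Hf.
  destruct (MVT_gen f a b df) as [c [Hc E]]; rewrite ?Rmin_left, ?Rmax_right in * by assumption.
  - intros x Hx. apply Hf. lra.
  - intros x Hx. apply continuity_pt_filterlim, ex_derive_Rcontinuous. eexists. now apply Hf.
  - now exists c.
Qed.

(** Projecting the increment onto its own direction reduces this mean value
    inequality to the real mean value theorem. *)
Lemma Cmean_value (f l : R -> C) (g g' : R -> R) a b :
  a <= b ->
  (forall u, a <= u <= b -> is_derive (fun u => Re (f u)) u (Re (l u))) ->
  (forall u, a <= u <= b -> is_derive (fun u => Im (f u)) u (Im (l u))) ->
  (forall u, a <= u <= b -> is_derive g u (g' u)) ->
  (forall u, a <= u <= b -> Cmod (l u) <= g' u) ->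
  Cmod (f b - f a)%C <= g b - g a.
Proof.
  intros Hab H1 H2 Hg Hl.
  set (w := (f b - f a)%C).
  set (p := fun u => Re w * Re (f u) + Im w * Im (f u) - Cmod w * g u).
  set (dp := fun u => Re w * Re (l u) + Im w * Im (l u) - Cmod w * g' u).
  assert (Hp : forall u, a <= u <= b -> is_derive p u (dp u)).
  { intros u Hu. unfold p, dp.
    apply is_derive_Rminus.
    - apply is_derive_Rplus.
      + apply is_derive_scal; auto.
      + apply is_derive_scal; auto.
    - apply is_derive_scal; auto. }
  destruct (mean_value p dp a b Hab Hp) as [c [Hc E]].
  assert (Hd : dp c <= 0).
  { unfold dp. specialize (Hl c Hc).
    assert (Re w * Re (l c) + Im w * Im (l c) <= Cmod w * Cmod (l c)).
    { replace (Re w * Re (l c) + Im w * Im (l c)) with (Re (Cconj w * l c)%C)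
        by (unfold Re, Im; simpl; ring).
      rewrite <- (Cmod_conj w), <- Cmod_mult.
      apply Rle_trans with (2 := re_le_Cmod _). apply Rle_abs. }
    generalize (Cmod_ge_0 w). nra. }
  assert (Hm : p b - p a = Cmod w * Cmod w - Cmod w * (g b - g a)).
  { rewrite Cmod_sqr. unfold p, w. rewrite !Re_minus, !Im_minus. ring. }
  assert (Cmod w * Cmod w <= Cmod w * (g b - g a)) by nra.
  destruct (Req_dec (Cmod w) 0) as [H0|H0].
  + rewrite H0. assert (Hgab : g a <= g b); [|lra].
    destruct (mean_value g g' a b Hab Hg) as [c' [Hc' E']].
      generalize (Hl c' Hc') (Cmod_ge_0 (l c')). nra.
  + apply Rmult_le_reg_l with (Cmod w); [|assumption].
    generalize (Cmod_ge_0 w); lra.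
Qed.

Lemma Cexp_add a b : Cexp (a + b)%C = (Cexp a * Cexp b)%C.
Proof.
  unfold Cexp, Cmult, Cplus, Re, Im; simpl.
  rewrite exp_plus, cos_plus, sin_plus. f_equal; ring.
Qed.

Lemma Cexp_0 : Cexp (RtoC 0) = RtoC 1.
Proof.
  unfold Cexp, RtoC, Re, Im; simpl. rewrite exp_0, cos_0, sin_0. f_equal; ring.
Qed.

Lemma Cmod_Cexp z : Cmod (Cexp z) = exp (Re z).
Proof.
  unfold Cexp, Cmod; simpl.
  replace (_ + _) with (exp (Re z) * exp (Re z)).
  - apply sqrt_square. left; apply exp_pos.
  - generalize (sin2_cos2 (Im z)). unfold Rsqr. intros H.
    transitivity (exp (Re z) * exp (Re z) * (sin (Im z) * sin (Im z) + cos (Im z) * cos (Im z)));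
    [rewrite H|]; ring.
Qed.

Lemma Cexp_neq_0 z : Cexp z <> RtoC 0.
Proof. apply Cmod_gt_0. rewrite Cmod_Cexp. apply exp_pos. Qed.

Lemma Cexp_opp z : Cexp (- z)%C = (/ Cexp z)%C.
Proof.
  assert (H : (Cexp z * Cexp (- z) = RtoC 1)%C).
  { rewrite <- Cexp_add. replace (z + - z)%C with (RtoC 0) by ring. apply Cexp_0. }
  assert (N := Cexp_neq_0 z).
  replace (Cexp (- z)) with (/ Cexp z * (Cexp z * Cexp (- z)))%C by (field; assumption).
  rewrite H. ring.
Qed.

Lemma Cexp_conj z : Cconj (Cexp z) = Cexp (Cconj z).
Proof.
  unfold Cexp, Cconj, Re, Im; simpl. rewrite cos_neg, sin_neg. f_equal; ring.
Qed.

Lemma Cexp_RtoC x : Cexp (RtoC x) = RtoC (exp x).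
Proof. unfold Cexp, RtoC, Re, Im; simpl. rewrite cos_0, sin_0. f_equal; ring. Qed.

Lemma exp_le_exp x y : x <= y -> exp x <= exp y.
Proof. intros [H|H]; [left; now apply exp_increasing|right; now f_equal]. Qed.

(** The derivative of [u -> exp (u h)] on [[0, 1]] is at most [|h| exp M]. *)
Lemma Cexp_sub_1_le (h : C) (M : R) :
  Re h <= M -> 0 <= M -> Cmod (Cexp h - RtoC 1)%C <= Cmod h * exp M.
Proof.
  intros HM HM0.
  assert (H : Cmod (Cexp (RtoC 1 * h) - Cexp (RtoC 0 * h))%C <= Cmod h * exp M * 1 - Cmod h * exp M * 0).
  { apply (Cmean_value (fun u => Cexp (RtoC u * h)) (fun u => (h * Cexp (RtoC u * h))%C)
      (fun u => Cmod h * exp M * u) (fun _ => Cmod h * exp M)); try lra.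
    - intros u _. unfold Cexp, Re, Im; simpl. auto_derive; [easy|unfold Rminus; ring].
    - intros u _. unfold Cexp, Re, Im; simpl. auto_derive; [easy|unfold Rminus; ring].
    - intros u _. auto_derive; [easy|ring].
    - intros u Hu. rewrite Cmod_mult, Cmod_Cexp. apply Rmult_le_compat_l; [apply Cmod_ge_0|].
      apply exp_le_exp. rewrite re_scal_l. nra. }
  rewrite Cmult_1_l, Cmult_0_l, Cexp_0 in H. lra.
Qed.

Lemma Cexp_sub_1_sub_le (h : C) :
  Cmod (Cexp h - RtoC 1 - h)%C <= Cmod h * Cmod h * exp (Cmod h).
Proof.
  set (K := Cmod h * Cmod h * exp (Cmod h)).
  assert (H : Cmod ((Cexp (RtoC 1 * h) - RtoC 1 * h) - (Cexp (RtoC 0 * h) - RtoC 0 * h))%C <= K * 1 - K * 0).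
  { apply (Cmean_value (fun u => Cexp (RtoC u * h) - RtoC u * h)%C
      (fun u => (h * (Cexp (RtoC u * h) - RtoC 1))%C)
      (fun u => K * u) (fun _ => K)); try lra.
    - intros u _. unfold Cexp, Re, Im; simpl. auto_derive; [easy|unfold Rminus; ring].
    - intros u _. unfold Cexp, Re, Im; simpl. auto_derive; [easy|unfold Rminus; ring].
    - intros u _. auto_derive; [easy|ring].
    - intros u Hu. rewrite Cmod_mult. unfold K. rewrite Rmult_assoc.
      apply Rmult_le_compat_l; [apply Cmod_ge_0|].
      apply Rle_trans with (Cmod (RtoC u * h)%C * exp (Cmod h)).
      + apply Cexp_sub_1_le; [|apply Cmod_ge_0].
        rewrite re_scal_l. generalize (Cmod_ge_0 h) (re_le_Cmod h) (Rle_abs (Re h)). nra.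
      + apply Rmult_le_compat_r; [left; apply exp_pos|].
        rewrite Cmod_mult, Cmod_R, Rabs_pos_eq by lra. generalize (Cmod_ge_0 h). nra. }
  rewrite !Cmult_1_l, !Cmult_0_l, Cexp_0 in H.
  replace (Cexp h - RtoC 1 - h)%C with (Cexp h - h - (RtoC 1 - RtoC 0))%C by ring. lra.
Qed.

Lemma hol_Cexp (z : C) : hol Cexp z.
Proof.
  exists (fun w => if Ceq_dec w z then Cexp z else ((Cexp w - Cexp z) / (w - z))%C). split.
  - apply contC_iff. intros eps Heps.
    assert (Hz := exp_pos (Re z)).
    exists (Rmin 1 (eps / (4 * exp (Re z)))).
    assert (Hq : 0 < eps / (4 * exp (Re z))) by (apply Rdiv_lt_0_compat; lra).
    split; [apply Rmin_pos; lra|].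
    intros w Hw.
    assert (H1 : Cmod (w - z)%C < 1) by (apply Rlt_le_trans with (1 := Hw), Rmin_l).
    assert (H2 : Cmod (w - z)%C < eps / (4 * exp (Re z))) by (apply Rlt_le_trans with (1 := Hw), Rmin_r).
    destruct (Ceq_dec z z) as [_|C]; [|congruence].
    destruct (Ceq_dec w z) as [E|N].
    + replace (Cexp z - Cexp z)%C with (RtoC 0) by ring. rewrite Cmod_0. assumption.
    + assert (Hwz : (w - z)%C <> RtoC 0) by (now apply Cminus_eq_contra).
      assert (Hp : 0 < Cmod (w - z)%C) by (now apply Cmod_gt_0).
      replace (Cexp w) with (Cexp z * Cexp (w - z))%C
        by (rewrite <- Cexp_add; f_equal; ring).
      replace ((Cexp z * Cexp (w - z) - Cexp z) / (w - z) - Cexp z)%C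
        with (Cexp z * ((Cexp (w - z) - RtoC 1 - (w - z)) / (w - z)))%C by (field; assumption).
      rewrite Cmod_mult, Cmod_Cexp, Cmod_div by assumption.
      apply Rle_lt_trans with (exp (Re z) * (Cmod (w - z)%C * exp 1)).
      * apply Rmult_le_compat_l; [lra|].
        apply Rmult_le_reg_r with (Cmod (w - z)%C); [assumption|].
        unfold Rdiv. rewrite Rmult_assoc, Rinv_l, Rmult_1_r by lra.
        apply Rle_trans with (1 := Cexp_sub_1_sub_le _).
        assert (exp (Cmod (w - z)%C) <= exp 1) by (apply exp_le_exp; lra).
        assert (0 < Cmod (w - z)%C * Cmod (w - z)%C) by nra. nra.
      * assert (E3 := exp_le_3). assert (0 < exp 1) by apply exp_pos.
        apply Rlt_le_trans with (exp (Re z) * (eps / (4 * exp (Re z)) * 4)).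
        -- apply Rmult_lt_compat_l; [assumption|]. nra.
        -- right. field. lra.
  - apply filter_forall. intros w. destruct (Ceq_dec w z) as [E|N].
    + subst; Cring.
    + field. now apply Cminus_eq_contra.
Qed.

(** * Cauchy's theorem on rectangles *)

(** The counterclockwise integral over the boundary of [[a, b] x [p, q]]. *)
Definition boundary_int (f : C -> C) (a b p q : R) : C :=
  (CInt (fun x => f (x, p)) a b + Ci * CInt (fun y => f (b, y)) p q
   - CInt (fun x => f (x, q)) a b - Ci * CInt (fun y => f (a, y)) p q)%C.

Definition in_rect (a b p q : R) (z : C) : Prop := a <= Re z <= b /\ p <= Im z <= q.

Lemma boundary_int_split (f : C -> C) a m b p n q :
  a <= m <= b -> p <= n <= q -> (forall z, in_rect a b p q z -> contC f z) ->
  boundary_int f a b p q =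
    (boundary_int f a m p n + boundary_int f m b p n
     + boundary_int f a m n q + boundary_int f m b n q)%C.
Proof.
  intros Hm Hn Hf.
  assert (Hh : forall y x, p <= y <= q -> a <= x <= b -> Ccont (fun x => f (x, y)) x).
  { intros y x Hy Hx. apply contC_Ccont_h, Hf. split; assumption. }
  assert (Hv : forall x y, a <= x <= b -> p <= y <= q -> Ccont (fun y => f (x, y)) y).
  { intros x y Hx Hy. apply contC_Ccont_v, Hf. split; assumption. }
  unfold boundary_int.
  rewrite <- (CInt_Chasles (fun x => f (x, p)) a m b) by (try tauto; intros; apply Hh; lra).
  rewrite <- (CInt_Chasles (fun x => f (x, q)) a m b) by (try tauto; intros; apply Hh; lra).
  rewrite <- (CInt_Chasles (fun y => f (a, y)) p n q) by (try tauto; intros; apply Hv; lra).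
  rewrite <- (CInt_Chasles (fun y => f (b, y)) p n q) by (try tauto; intros; apply Hv; lra).
  ring.
Qed.

Lemma CInt_affine_h (A B : C) (y a b : R) :
  CInt (fun x => A + B * (x, y))%C a b
  = ((A + B * (Ci * y)) * RtoC (b - a) + B * RtoC ((b * b - a * a) / 2))%C.
Proof.
  unfold CInt.
  assert (H : forall u v, RInt (fun x => u + v * x) a b = u * (b - a) + v * ((b * b - a * a) / 2)).
  { intros u v. apply is_RInt_unique.
    replace (u * (b - a) + v * ((b * b - a * a) / 2))
      with (minus (u * b + v * (b * b / 2)) (u * a + v * (a * a / 2)))
      by (unfold minus, plus, opp; simpl; field).
    apply (is_RInt_derive (fun x => u * x + v * (x * x / 2))).
    - intros x _. auto_derive; [easy|field].
    - intros x _. apply continuous_Rplus; [apply continuous_const|].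
      apply continuous_Rmult; [apply continuous_const|apply continuous_id]. }
  destruct A as [a1 a2], B as [b1 b2].
  apply injective_projections; simpl.
  - rewrite (RInt_ext _ (fun x => (a1 - b2 * y) + b1 * x)) by (intros; Rring).
    rewrite H. field.
  - rewrite (RInt_ext _ (fun x => (a2 + b1 * y) + b2 * x)) by (intros; Rring).
    rewrite H. field.
Qed.


Lemma CInt_affine_v (A B : C) (x p q : R) :
  CInt (fun y => A + B * (x, y))%C p q
  = ((A + B * x) * RtoC (q - p) + B * Ci * RtoC ((q * q - p * p) / 2))%C.
Proof.
  assert (E := CInt_affine_h A (B * Ci)%C (- x) p q).
  transitivity (CInt (fun y => A + B * Ci * (y, (- x)%R))%C p q).
  - unfold CInt. f_equal; apply RInt_ext; intros y _; unfold Re, Im; simpl; Rring.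
  - rewrite E. apply injective_projections; simpl; field.
Qed.

Lemma boundary_int_affine (A B : C) (a b p q : R) :
  boundary_int (fun z => A + B * z)%C a b p q = RtoC 0.
Proof.
  unfold boundary_int. rewrite !CInt_affine_h, !CInt_affine_v.
  apply injective_projections; simpl; field.
Qed.

Lemma boundary_int_minus (f g : C -> C) (a b p q : R) :
  a <= b -> p <= q ->
  (forall z, in_rect a b p q z -> contC f z) ->
  (forall z, in_rect a b p q z -> contC g z) ->
  boundary_int (fun z => f z - g z)%C a b p q = (boundary_int f a b p q - boundary_int g a b p q)%C.
Proof.
  intros Hab Hpq Hf Hg. unfold boundary_int.
  rewrite 2!(CInt_minus (fun x => f (x, _)) (fun x => g (x, _))), 2!(CInt_minus (fun y => f (_, y)) (fun y => g (_, y)));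
  try assumption; try ring;
  intros t Ht; first [apply contC_Ccont_h|apply contC_Ccont_v]; first [apply Hf|apply Hg];
  split; simpl; lra.
Qed.

Lemma boundary_int_le (f : C -> C) (M a b p q : R) :
  a <= b -> p <= q ->
  (forall z, in_rect a b p q z -> contC f z) ->
  (forall z, in_rect a b p q z -> Cmod (f z) <= M) ->
  Cmod (boundary_int f a b p q) <= 2 * ((b - a) + (q - p)) * M.
Proof.
  intros Hab Hpq Hf HM.
  assert (Hh : forall y, p <= y <= q -> Cmod (CInt (fun x => f (x, y)) a b) <= (b - a) * M).
  { intros y Hy. apply Cmod_CInt_le_const; [assumption| |].
    - intros t Ht. apply contC_Ccont_h, Hf. split; simpl; lra.
    - intros t Ht. apply HM. split; simpl; lra. }
  assert (Hv : forall x, a <= x <= b -> Cmod (CInt (fun y => f (x, y)) p q) <= (q - p) * M).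
  { intros x Hx. apply Cmod_CInt_le_const; [assumption| |].
    - intros t Ht. apply contC_Ccont_v, Hf. split; simpl; lra.
    - intros t Ht. apply HM. split; simpl; lra. }
  unfold boundary_int, Cminus.
  assert (H1 := Hh p ltac:(lra)). assert (H2 := Hh q ltac:(lra)).
  assert (H3 := Hv a ltac:(lra)). assert (H4 := Hv b ltac:(lra)).
  eapply Rle_trans; [apply Cmod_triangle|].
  eapply Rle_trans; [apply Rplus_le_compat_r, Cmod_triangle|].
  eapply Rle_trans; [apply Rplus_le_compat_r, Rplus_le_compat_r, Cmod_triangle|].
  rewrite !Cmod_opp, !Cmod_mult, Cmod_Ci. lra.
Qed.

Section Bisection.

Variables (f : C -> C) (a p w h : R).
Hypothesis Hw : 0 <= w.
Hypothesis Hh : 0 <= h.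
Hypothesis Hf : forall z, in_rect a (a + w) p (p + h) z -> hol f z.

Let size (n : nat) (x y : R) : R :=
  Cmod (boundary_int f x (x + w / 2 ^ n) y (y + h / 2 ^ n)).

(** Lower left corners of nested rectangles, each a quarter of the previous one
    that carries at least a quarter of the boundary integral.  The last branch
    needs no test, because the four integrals add up to the whole. *)
Fixpoint corner (n : nat) : R * R :=
  match n with
  | O => (a, p)
  | S n =>
      let (x, y) := corner n in
      let x' := x + w / 2 ^ S n in
      let y' := y + h / 2 ^ S n in
      if Rle_dec (size n x y) (4 * size (S n) x y) then (x, y)
      else if Rle_dec (size n x y) (4 * size (S n) x' y) then (x', y)
      else if Rle_dec (size n x y) (4 * size (S n) x y') then (x, y')
      else (x', y')
  end.

Lemma corner_step n :
  fst (corner n) <= fst (corner (S n)) /\ snd (corner n) <= snd (corner (S n)) /\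
  fst (corner (S n)) + w / 2 ^ S n <= fst (corner n) + w / 2 ^ n /\
  snd (corner (S n)) + h / 2 ^ S n <= snd (corner n) + h / 2 ^ n.
Proof.
  assert (E1 : w / 2 ^ n = 2 * (w / 2 ^ S n)) by (simpl; field; apply pow_nonzero; lra).
  assert (E2 : h / 2 ^ n = 2 * (h / 2 ^ S n)) by (simpl; field; apply pow_nonzero; lra).
  assert (P : 0 < 2 ^ S n) by (apply pow_lt; lra).
  assert (0 <= w / 2 ^ S n) by (apply Rle_mult_inv_pos; lra).
  assert (0 <= h / 2 ^ S n) by (apply Rle_mult_inv_pos; lra).
  rewrite E1, E2. cbn [corner].
  destruct (corner n) as [x y].
  repeat destruct Rle_dec; cbn [fst snd]; lra.
Qed.

Lemma corner_in n :
  a <= fst (corner n) /\ fst (corner n) + w / 2 ^ n <= a + w /\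
  p <= snd (corner n) /\ snd (corner n) + h / 2 ^ n <= p + h.
Proof.
  induction n as [|n IH]; [simpl; lra|].
  generalize (corner_step n). lra.
Qed.

Lemma corner_size n : size 0 a p <= 4 ^ n * size n (fst (corner n)) (snd (corner n)).
Proof.
  induction n as [|n IH]; [simpl; lra|].
  apply Rle_trans with (1 := IH).
  replace (4 ^ S n) with (4 ^ n * 4) by (simpl; ring).
  rewrite Rmult_assoc. apply Rmult_le_compat_l; [apply pow_le; lra|].
  generalize (corner_in n). intros Hin.
  cbn [corner].
  destruct (corner n) as [x y]. cbn [fst snd] in *.
  destruct Rle_dec as [H1|H1]; [exact H1|].
  destruct Rle_dec as [H2|H2]; [exact H2|].
  destruct Rle_dec as [H3|H3]; [exact H3|].
  cbn [fst snd].
  set (x' := x + w / 2 ^ S n) in *. set (y' := y + h / 2 ^ S n) in *.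
  assert (P : 0 < 2 ^ S n) by (apply pow_lt; lra).
  assert (0 <= w / 2 ^ S n) by (apply Rle_mult_inv_pos; lra).
  assert (0 <= h / 2 ^ S n) by (apply Rle_mult_inv_pos; lra).
  assert (E1 : x + w / 2 ^ n = x' + w / 2 ^ S n) by (unfold x'; simpl; field; apply pow_nonzero; lra).
  assert (E2 : y + h / 2 ^ n = y' + h / 2 ^ S n) by (unfold y'; simpl; field; apply pow_nonzero; lra).
  assert (E : size n x y <= size (S n) x y + size (S n) x' y + size (S n) x y' + size (S n) x' y').
  { unfold size. rewrite (boundary_int_split f x x' _ y y').
    - rewrite E1, E2. fold x' y'.
      eapply Rle_trans; [apply Cmod_triangle|]. apply Rplus_le_compat_r.
      eapply Rle_trans; [apply Cmod_triangle|]. apply Rplus_le_compat_r.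
      apply Cmod_triangle.
    - rewrite E1; unfold x'; lra.
    - rewrite E2; unfold y'; lra.
    - intros z [Hz1 Hz2]. apply hol_contC, Hf. split; lra. }
  lra.
Qed.

Lemma corner_lim : exists z0, in_rect a (a + w) p (p + h) z0 /\
  forall n, in_rect (fst (corner n)) (fst (corner n) + w / 2 ^ n)
                    (snd (corner n)) (snd (corner n) + h / 2 ^ n) z0.
Proof.
  assert (Hle : forall n m, (n <= m)%nat ->
    fst (corner m) <= fst (corner n) + w / 2 ^ n /\ snd (corner m) <= snd (corner n) + h / 2 ^ n).
  { intros n m Hnm.
    assert (H : fst (corner m) + w / 2 ^ m <= fst (corner n) + w / 2 ^ n /\
                snd (corner m) + h / 2 ^ m <= snd (corner n) + h / 2 ^ n).
    { induction Hnm as [|m Hnm IH]; [lra|]. generalize (corner_step m). lra. }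
    assert (P : 0 < 2 ^ m) by (apply pow_lt; lra).
    assert (0 <= w / 2 ^ m) by (apply Rle_mult_inv_pos; lra).
    assert (0 <= h / 2 ^ m) by (apply Rle_mult_inv_pos; lra). lra. }
  destruct (ex_finite_lim_seq_incr (fun n => fst (corner n)) (a + w)) as [X HX].
  { intros n. apply corner_step. }
  { intros n. generalize (Hle O n ltac:(lia)); simpl. lra. }
  destruct (ex_finite_lim_seq_incr (fun n => snd (corner n)) (p + h)) as [Y HY].
  { intros n. apply corner_step. }
  { intros n. generalize (Hle O n ltac:(lia)); simpl. lra. }
  assert (Hin : forall n, in_rect (fst (corner n)) (fst (corner n) + w / 2 ^ n)
                    (snd (corner n)) (snd (corner n) + h / 2 ^ n) (X, Y)).
  { intros n. split; simpl; split.
    - apply (is_lim_seq_incr_compare _ _ HX). intros k. apply corner_step.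
    - apply (is_lim_seq_le_loc (fun n => fst (corner n)) (fun _ => fst (corner n) + w / 2 ^ n) X (fst (corner n) + w / 2 ^ n)).
      + exists n. intros m Hm. now apply Hle.
      + exact HX.
      + apply is_lim_seq_const.
    - apply (is_lim_seq_incr_compare _ _ HY). intros k. apply corner_step.
    - apply (is_lim_seq_le_loc (fun n => snd (corner n)) (fun _ => snd (corner n) + h / 2 ^ n) Y (snd (corner n) + h / 2 ^ n)).
      + exists n. intros m Hm. now apply Hle.
      + exact HY.
      + apply is_lim_seq_const. }
  exists (X, Y). split; [|assumption].
  generalize (Hin O). unfold in_rect; simpl. lra.
Qed.

(** In the limit rectangle [f] differs from an affine function by [eta] times the
    diameter; the factors [4^n] lost and [4^(-n)] gained cancel. *)
Lemma boundary_int_small eta : 0 < eta ->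
  size 0 a p <= 2 * eta * ((w + h) * (w + h)).
Proof.
  intros Heta.
  destruct corner_lim as [z0 [Hz0 Hin]].
  destruct (Hf z0 Hz0) as [phi [Hphi HE]].
  assert (L := proj1 (contC_iff phi z0) Hphi eta Heta). destruct L as [d1 [Hd1 L1]].
  apply locally_Cmod in HE. destruct HE as [d2 [Hd2 L2]].
  set (d := Rmin d1 d2).
  assert (Hd : 0 < d) by (now apply Rmin_pos).
  destruct (Req_dec (w + h) 0) as [W0|W0].
  { assert (Ew : w = 0) by lra. assert (Eh : h = 0) by lra.
    assert (Ea : a + w / 2 ^ 0 = a) by (rewrite Ew; simpl; field).
    assert (Ep : p + h / 2 ^ 0 = p) by (rewrite Eh; simpl; field).
    unfold size. rewrite Ea, Ep.
    apply Rle_trans with (2 * ((a - a) + (p - p)) * Cmod (f (a, p))).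
    - apply boundary_int_le; try lra.
      + intros z [Hz1 Hz2]. apply hol_contC, Hf. split; lra.
      + intros [x y] [Hz1 Hz2]. simpl in *. replace x with a by lra. replace y with p by lra. lra.
    - rewrite Ew, Eh. right. ring. }
  assert (Hn : exists n, (w + h) / 2 ^ n < d).
  { assert (Hq : 0 < d / (w + h)) by (apply Rdiv_lt_0_compat; lra).
    destruct (pow_lt_1_zero (1 / 2) ltac:(rewrite Rabs_pos_eq; lra) _ Hq) as [n Hn].
    exists n. specialize (Hn n (Nat.le_refl n)).
    rewrite Rabs_pos_eq in Hn by (apply pow_le; lra).
    replace ((w + h) / 2 ^ n) with ((w + h) * (1 / 2) ^ n)
      by (unfold Rdiv at 1; rewrite Rmult_1_l, pow_inv; reflexivity).
    apply Rlt_le_trans with ((w + h) * (d / (w + h))).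
    - apply Rmult_lt_compat_l; lra.
    - right; field; assumption. }
  destruct Hn as [n Hn].
  assert (P : 0 < 2 ^ n) by (apply pow_lt; lra).
  set (W := w / 2 ^ n) in *. set (H := h / 2 ^ n) in *.
  assert (HW : 0 <= W) by (apply Rle_mult_inv_pos; lra).
  assert (HH : 0 <= H) by (apply Rle_mult_inv_pos; lra).
  assert (EWH : (w + h) / 2 ^ n = W + H) by (unfold W, H; field; lra).
  rewrite EWH in Hn.
  apply Rle_trans with (1 := corner_size n).
  specialize (Hin n). generalize (corner_in n). intros Hcin. fold W H in Hin, Hcin.
  destruct (corner n) as [x y]. cbn [fst snd] in *.
  set (g := fun z => ((f z0 - phi z0 * z0) + phi z0 * z)%C).
  assert (Hfc : forall z, in_rect x (x + W) y (y + H) z -> contC f z).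
  { intros z [Hz1 Hz2]. apply hol_contC, Hf. split; lra. }
  assert (Hgc : forall z, in_rect x (x + W) y (y + H) z -> contC g z).
  { intros z _. apply contC_plus; [apply contC_const|].
    apply contC_mult; [apply contC_const|apply contC_id]. }
  assert (E : boundary_int f x (x + W) y (y + H) = boundary_int (fun z => f z - g z)%C x (x + W) y (y + H)).
  { rewrite (boundary_int_minus f g) by (assumption || lra).
    replace (boundary_int g x (x + W) y (y + H)) with (RtoC 0)
      by (symmetry; apply boundary_int_affine). ring. }
  assert (Hb : size n x y <= 2 * ((x + W - x) + (y + H - y)) * (eta * (W + H))).
  { unfold size. fold W H. rewrite E.
    apply boundary_int_le; try lra.
    - intros z Hz. apply contC_plus; [auto|]. apply contC_opp. auto.
    - intros z Hz.
      assert (Hzz : Cmod (z - z0)%C <= W + H).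
      { apply Rle_trans with (1 := Cmod_le_ReIm _). rewrite Re_minus, Im_minus.
        destruct Hz as [Hz1 Hz2]. destruct Hin as [Hi1 Hi2].
        apply Rplus_le_compat; apply Rabs_le; lra. }
      assert (Hzd : Cmod (z - z0)%C < d) by lra.
      rewrite (L2 z) by (apply Rlt_le_trans with (1 := Hzd), Rmin_r).
      unfold g. replace (f z0 + phi z * (z - z0) - (f z0 - phi z0 * z0 + phi z0 * z))%C
        with ((phi z - phi z0) * (z - z0))%C by ring.
      rewrite Cmod_mult. apply Rmult_le_compat; try apply Cmod_ge_0; [|assumption].
      left. apply L1. apply Rlt_le_trans with (1 := Hzd), Rmin_l. }
  apply Rle_trans with (4 ^ n * (2 * (x + W - x + (y + H - y)) * (eta * (W + H)))).
  - apply Rmult_le_compat_l; [apply pow_le; lra|assumption].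
  - right. replace (w + h) with (2 ^ n * (W + H)) by (unfold W, H; field; lra).
    replace (4 ^ n) with (2 ^ n * 2 ^ n) by (rewrite <- Rpow_mult_distr; f_equal; lra).
    ring.
Qed.

End Bisection.

(** Goursat's argument: among the four quarters of a rectangle one carries at
    least a quarter of the boundary integral; the quarters shrink to a point,
    and near that point the function is affine up to a small relative error. *)
Theorem Cauchy_rectangle (f : C -> C) (a b p q : R) :
  a <= b -> p <= q -> (forall z, in_rect a b p q z -> hol f z) ->
  boundary_int f a b p q = RtoC 0.
Proof.
  intros Hab Hpq Hf. apply Cmod_eq_0.
  assert (Hs : forall eta, 0 < eta -> Cmod (boundary_int f a b p q) <= 2 * eta * ((b - a + (q - p)) * (b - a + (q - p)))).
  { intros eta He.
    generalize (boundary_int_small f a p (b - a) (q - p) ltac:(lra) ltac:(lra)).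
    simpl. replace (a + (b - a)) with b by ring. replace (p + (q - p)) with q by ring.
    replace (a + (b - a) / 1) with b by field. replace (p + (q - p) / 1) with q by field.
    intros H; apply H; assumption. }
  generalize (Cmod_ge_0 (boundary_int f a b p q)). intros H0.
  set (L := (b - a + (q - p)) * (b - a + (q - p))) in *.
  assert (HL : 0 <= L) by (apply Rle_0_sqr).
  destruct (Rle_lt_or_eq_dec _ _ H0) as [Hlt|E]; [|congruence].
  exfalso.
  assert (He : 0 < Cmod (boundary_int f a b p q) / (4 * (L + 1))) by (apply Rdiv_lt_0_compat; lra).
  specialize (Hs _ He).
  set (m := Cmod (boundary_int f a b p q)) in *.
  assert (E : m / (4 * (L + 1)) * (4 * (L + 1)) = m) by (field; lra).
  nra.
Qed.

(** * Elementary inequalities *)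

Lemma ln_le_sub_1 x : 0 < x -> ln x <= x - 1.
Proof.
  intros Hx. generalize (exp_ineq1_le (ln x)). rewrite exp_ln by assumption. lra.
Qed.

Lemma ln_1p_bound v : Rabs v <= 1 / 2 -> Rabs (ln (1 + v) - v) <= 2 * (v * v).
Proof.
  intros Hv. apply Rabs_le_between in Hv.
  assert (H1 := ln_le_sub_1 (1 + v) ltac:(lra)).
  assert (H2 := ln_le_sub_1 (/ (1 + v)) ltac:(apply Rinv_0_lt_compat; lra)).
  rewrite ln_Rinv in H2 by lra.
  assert (H3 : / (1 + v) - 1 = - v + v * v * / (1 + v)) by (field; lra).
  assert (H4 : / (1 + v) <= 2).
  { rewrite <- (Rinv_inv 2). apply Rinv_le_contravar; lra. }
  assert (0 <= v * v) by nra.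
  apply Rabs_le. nra.
Qed.

Lemma atan_bound v : Rabs (atan v - v) <= v * v.
Proof.
  destruct (MVT_gen atan 0 v (fun x => / (1 + x * x))) as [c [Hc E]].
  - intros x _. auto_derive; [easy|unfold Rsqr; simpl; field; nra].
  - intros x _. apply continuity_pt_filterlim.
    apply ex_derive_Rcontinuous. auto_derive; easy.
  - rewrite atan_0 in E.
    assert (Hcv : Rabs c <= Rabs v).
    { revert Hc. unfold Rmin, Rmax, Rabs. repeat destruct Rle_dec; repeat destruct Rcase_abs; lra. }
    replace (atan v - v) with (- (v * (c * c * / (1 + c * c)))).
    2: { replace (atan v) with (/ (1 + c * c) * (v - 0)) by lra. field. nra. }
    rewrite Rabs_Ropp, Rabs_mult.
    rewrite (Rabs_pos_eq (c * c * / (1 + c * c))).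
    2: { apply Rmult_le_pos; [nra|]. left. apply Rinv_0_lt_compat. nra. }
    replace (v * v) with (Rabs v * Rabs v) by (rewrite <- Rabs_mult; apply Rabs_pos_eq; nra).
    apply Rmult_le_compat_l; [apply Rabs_pos|].
    apply Rle_trans with (Rabs c); [|assumption].
    assert (Hcc : c * c = Rabs c * Rabs c) by (rewrite <- Rabs_mult; symmetry; apply Rabs_pos_eq; nra).
    rewrite Hcc. set (t := Rabs c). assert (0 <= t) by apply Rabs_pos.
    apply Rmult_le_reg_r with (1 + t * t); [nra|].
    rewrite Rmult_assoc, Rinv_l by nra. nra.
Qed.

Lemma atan_sub_bound (x y : R) : x <= y -> 0 <= atan y - atan x <= PI.
Proof.
  intros H. generalize (atan_bound x) (atan_bound y). intros _ _.
  assert (atan x <= atan y) by (destruct H; [left; now apply atan_increasing|subst; lra]).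
  generalize (Ratan.atan_bound x) (Ratan.atan_bound y). lra.
Qed.

(** * The logarithm on the upper half-plane *)

(** The argument is written with an arctangent of [x / y] so that it is smooth on
    the whole upper half-plane. *)
Definition clog (z : C) : C :=
  (ln (Re z * Re z + Im z * Im z) / 2, PI / 2 - atan (Re z / Im z)).

Lemma Cexp_clog (z : C) : 0 < Im z -> Cexp (clog z) = z.
Proof.
  destruct z as [x y]; unfold Im; simpl; intros Hy.
  assert (Hr : 0 < x * x + y * y) by nra.
  assert (E : exp (ln (x * x + y * y) / 2) = y * sqrt (1 + (x / y)²)).
  { assert (H : 0 < exp (ln (x * x + y * y) / 2)) by apply exp_pos.
    assert (H1 : exp (ln (x * x + y * y) / 2) * exp (ln (x * x + y * y) / 2) = x * x + y * y).
    { rewrite <- exp_plus. replace (_ / 2 + _ / 2) with (ln (x * x + y * y)) by field.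
      now apply exp_ln. }
    assert (H0 : 0 <= (x / y)²) by apply Rle_0_sqr.
    assert (H2 := sqrt_sqrt (1 + (x / y)²) ltac:(lra)).
    assert (H3 := sqrt_pos (1 + (x / y)²)).
    assert (H4 : y * sqrt (1 + (x / y)²) * (y * sqrt (1 + (x / y)²)) = x * x + y * y).
    { replace (y * sqrt (1 + (x / y)²) * (y * sqrt (1 + (x / y)²)))
        with (y * y * (sqrt (1 + (x / y)²) * sqrt (1 + (x / y)²))) by ring.
      rewrite H2. unfold Rsqr. field. lra. }
    assert (0 <= y * sqrt (1 + (x / y)²)) by nra. nra. }
  assert (Hs : 0 < sqrt (1 + (x / y)²)).
  { apply sqrt_lt_R0. generalize (Rle_0_sqr (x / y)). lra. }
  unfold Cexp, clog, Re, Im; simpl. rewrite E, cos_shift, sin_shift, sin_atan, cos_atan.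
  f_equal; field; lra.
Qed.

(** A primitive of [clog]. *)
Definition clog_int (z : C) : C := (z * clog z - z)%C.

(** The error of the trapezoidal rule for the integral of [clog] over
    [[z, z + 1]]. *)
Definition trap_err (z : C) : C :=
  (clog_int (z + RtoC 1) - clog_int z - (clog z + clog (z + RtoC 1)) * RtoC (1 / 2))%C.

(** The second derivative of [clog] at [z + u] has modulus [1 / |z + u|^2], which
    is [1 / Im z] times the derivative of [atan ((Re z + u) / Im z)]; with the bound
    in this form the errors for [z, z + 1, z + 2, ...] telescope. *)
Lemma trap_err_le (z : C) : 0 < Im z ->
  Cmod (trap_err z) <= / (2 * Im z) * (atan ((Re z + 1) / Im z) - atan (Re z / Im z)).
Proof.
  destruct z as [x y]; unfold Re, Im; simpl; intros Hy.
  set (L := fun u => ln ((x + u) * (x + u) + y * y) / 2).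
  set (th := fun u => PI / 2 - atan ((x + u) / y)).
  set (r := fun u => (x + u) * (x + u) + y * y).
  assert (Hr : forall u, 0 < r u)
    by (intros u; generalize (Rle_0_sqr (x + u)) (Rmult_lt_0_compat y y Hy Hy); unfold r, Rsqr; lra).
  set (at_ := fun u => / y * atan ((x + u) / y)).
  assert (Hat : forall u, is_derive at_ u (/ r u)).
  { intros u. unfold at_, r. auto_derive; [lra|]. unfold Rsqr. field.
    specialize (Hr u). unfold r in Hr. repeat split; try lra. }
  assert (HL : forall u, is_derive L u ((x + u) / r u)).
  { intros u. unfold L. auto_derive; [apply Hr|]. unfold r. field. specialize (Hr u). unfold r in Hr. lra. }
  assert (Hth : forall u, is_derive th u (- y / r u)).
  { intros u. unfold th, r. auto_derive; [lra|]. unfold Rsqr. field.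
    specialize (Hr u). unfold r in Hr. repeat split; try lra. }
  (* [psi / 2] is the derivative of [phi] below, whose increment is the error; the
     derivative of [psi] is [u / (z + u)^2] *)
  set (psi := fun u : R => (L u - L 0 - u * (x + u) / r u, th u - th 0 + u * y / r u) : C).
  set (dpsi := fun u : R => (u * ((x + u) * (x + u) - y * y) / (r u * r u),
                             - (2 * u * (x + u) * y) / (r u * r u)) : C).
  assert (Hpsi : forall u, 0 <= u <= 1 -> Cmod (psi u) <= / y * (atan ((x + 1) / y) - atan (x / y))).
  { intros u Hu.
    assert (H : Cmod (psi u - psi 0)%C <= at_ u - at_ 0).
    { apply (Cmean_value psi dpsi at_ (fun u => / r u)); try lra.
      - intros v _. unfold psi, dpsi, Re; cbn [fst].
        apply (is_derive_ext (fun u => L u - (L 0 + u * (x + u) / r u))); [intros; Rring|].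
        replace (v * ((x + v) * (x + v) - y * y) / (r v * r v))
          with ((x + v) / r v - ((x + 2 * v) / r v - v * (x + v) * (2 * (x + v)) / (r v * r v)))
          by (unfold r; field; apply Rgt_not_eq, (Hr v)).
        apply is_derive_Rminus; [apply HL|].
        unfold r. auto_derive; [apply Rgt_not_eq, (Hr v)|].
        field. apply Rgt_not_eq, (Hr v).
      - intros v _. unfold psi, dpsi, Im; cbn [snd].
        apply (is_derive_ext (fun u => th u - (th 0 - u * y / r u))); [intros; Rring|].
        replace (- (2 * v * (x + v) * y) / (r v * r v))
          with (- y / r v - (- y / r v + v * y * (2 * (x + v)) / (r v * r v)))
          by (unfold r; field; apply Rgt_not_eq, (Hr v)).
        apply is_derive_Rminus; [apply Hth|].
        unfold r. auto_derive; [apply Rgt_not_eq, (Hr v)|].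
        field. apply Rgt_not_eq, (Hr v).
      - intros v _. apply Hat.
      - intros v Hv.
        assert (E : Cmod (dpsi v) * Cmod (dpsi v) = (v * / r v) * (v * / r v)).
        { rewrite Cmod_sqr. unfold dpsi, Re, Im; cbn [fst snd]. unfold r. field. apply Rgt_not_eq, (Hr v). }
        assert (Hi : 0 < / r v) by (apply Rinv_0_lt_compat, Hr).
        assert (Cmod (dpsi v) <= v * / r v).
        { assert (0 <= v * / r v) by nra. generalize (Cmod_ge_0 (dpsi v)). nra. }
        nra. }
    assert (E0 : psi 0 = RtoC 0).
    { unfold psi. apply injective_projections; simpl; field; apply Rgt_not_eq, Hr. }
    rewrite E0 in H. replace (psi u - RtoC 0)%C with (psi u) in H by ring.
    apply Rle_trans with (1 := H). unfold at_. rewrite Rplus_0_r, <- Rmult_minus_distr_l.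
    apply Rmult_le_compat_l; [left; now apply Rinv_0_lt_compat|].
    apply Rplus_le_compat_r.
    assert (Hle : (x + u) / y <= (x + 1) / y)
      by (apply Rmult_le_compat_r; [left; now apply Rinv_0_lt_compat|lra]).
    destruct Hle as [Hlt|Heq]; [left; now apply atan_increasing|rewrite Heq; lra]. }
  set (M := / y * (atan ((x + 1) / y) - atan (x / y))) in *.
  set (phi := fun u : R => ((x + u) * L u - y * th u - (x + u) - u / 2 * (L 0 + L u),
                            (x + u) * th u + y * L u - y - u / 2 * (th 0 + th u)) : C).
  assert (H : Cmod (phi 1 - phi 0)%C <= M / 2 * 1 - M / 2 * 0).
  { apply (Cmean_value phi (fun u => psi u * RtoC (1 / 2))%C (fun u => M / 2 * u) (fun _ => M / 2)); try lra.
    - intros u _. unfold phi, psi, Re; cbn [fst Cmult RtoC].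
      evar_last.
      + apply is_derive_Rminus.
        * apply is_derive_Rminus.
          -- apply is_derive_Rminus.
             ++ apply (is_derive_mult (K := R_AbsRing) (fun u => x + u) L u 1 ((x + u) / r u)); [auto_derive; easy || ring|apply HL|exact Rmult_comm].
             ++ apply (is_derive_scal th u y). apply Hth.
          -- instantiate (1 := 1). auto_derive; easy || ring.
        * apply (is_derive_mult (K := R_AbsRing) (fun u => u / 2) (fun u => L 0 + L u) u (1 / 2)); [auto_derive; easy || field| |exact Rmult_comm].
          apply is_derive_Rplus; [apply is_derive_const|apply HL].
      + unfold minus, plus, opp, mult, zero; simpl. unfold r. field. apply Rgt_not_eq, (Hr u).
    - intros u _. unfold phi, psi, Im; cbn [snd Cmult RtoC].
      evar_last.
      + apply is_derive_Rminus.
        * apply is_derive_Rminus.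
          -- apply is_derive_Rplus.
             ++ apply (is_derive_mult (K := R_AbsRing) (fun u => x + u) th u 1 (- y / r u)); [auto_derive; easy || ring|apply Hth|exact Rmult_comm].
             ++ apply (is_derive_scal L u y). apply HL.
          -- apply is_derive_const.
        * apply (is_derive_mult (K := R_AbsRing) (fun u => u / 2) (fun u => th 0 + th u) u (1 / 2)); [auto_derive; easy || field| |exact Rmult_comm].
          apply is_derive_Rplus; [apply is_derive_const|apply Hth].
      + unfold minus, plus, opp, mult, zero; simpl. unfold r. field. apply Rgt_not_eq, (Hr u).
    - intros u _. auto_derive; [easy|ring].
    - intros u Hu. rewrite Cmod_mult, Cmod_R, Rabs_pos_eq by lra.
      generalize (Hpsi u Hu). lra. }
  replace (trap_err (x, y)) with (phi 1 - phi 0)%C.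
  - apply Rle_trans with (1 := H). unfold M. right. field. lra.
  - unfold trap_err, clog_int, clog, phi, L, th, Re, Im.
    apply injective_projections; simpl; rewrite ?Rplus_0_r; field; lra.
Qed.

Definition Clim (u : nat -> C) (l : C) : Prop :=
  is_lim_seq (fun n => Re (u n)) (Re l) /\ is_lim_seq (fun n => Im (u n)) (Im l).

Lemma Clim_plus u v l m : Clim u l -> Clim v m -> Clim (fun n => u n + v n)%C (l + m)%C.
Proof.
  intros [H1 H2] [H3 H4]. split.
  - apply (is_lim_seq_plus' _ _ _ _ H1 H3).
  - apply (is_lim_seq_plus' _ _ _ _ H2 H4).
Qed.

Lemma Clim_const c : Clim (fun _ => c) c.
Proof. split; apply is_lim_seq_const. Qed.

Lemma Clim_RtoC (u : nat -> R) (l : R) : is_lim_seq u l -> Clim (fun n => RtoC (u n)) (RtoC l).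
Proof. intros H; split; [exact H|apply is_lim_seq_const]. Qed.

Lemma Clim_ext_loc u v l : (exists N, forall n, (N <= n)%nat -> u n = v n) -> Clim u l -> Clim v l.
Proof.
  intros [N H] [H1 H2]. split.
  - apply is_lim_seq_ext_loc with (2 := H1). exists N. intros n Hn. now rewrite H.
  - apply is_lim_seq_ext_loc with (2 := H2). exists N. intros n Hn. now rewrite H.
Qed.

Lemma Clim_bound u l (e : nat -> R) :
  (exists N, forall n, (N <= n)%nat -> Cmod (u n - l)%C <= e n) -> is_lim_seq e 0 -> Clim u l.
Proof.
  intros [N H] He.
  assert (G : forall (p : C -> R), (forall a b, p (a - b)%C = p a - p b) ->
     (forall z, Rabs (p z) <= Cmod z) -> is_lim_seq (fun n => p (u n)) (p l)).
  { intros p Hp Hp2.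
    assert (L : is_lim_seq (fun n => p (u n) - p l) 0).
    { apply is_lim_seq_abs_0.
      apply is_lim_seq_le_le_loc with (fun _ => 0) e; [|apply is_lim_seq_const|assumption].
      exists N. intros n Hn. split; [apply Rabs_pos|]. rewrite <- Hp.
      apply Rle_trans with (2 := H n Hn). apply Hp2. }
    apply (is_lim_seq_ext (fun n => (p (u n) - p l) + p l)); [intros; Rring|].
    replace (Finite (p l)) with (Finite (0 + p l)) by (f_equal; ring).
    apply is_lim_seq_plus'; [assumption|apply is_lim_seq_const]. }
  split; apply G.
  - apply Re_minus.
  - apply re_le_Cmod.
  - apply Im_minus.
  - apply im_le_Cmod.
Qed.

Lemma Clim_Cexp u l : Clim u l -> Clim (fun n => Cexp (u n)) (Cexp l).
Proof.
  intros [H1 H2]. unfold Cexp, Re, Im in *; split; simpl.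
  - apply (is_lim_seq_mult' (fun n => exp (fst (u n))) (fun n => cos (snd (u n)))).
    + apply (is_lim_seq_continuous exp); [|assumption].
      apply derivable_continuous_pt, derivable_pt_exp.
    + apply (is_lim_seq_continuous cos); [|assumption].
      apply continuity_cos.
  - apply (is_lim_seq_mult' (fun n => exp (fst (u n))) (fun n => sin (snd (u n)))).
    + apply (is_lim_seq_continuous exp); [|assumption].
      apply derivable_continuous_pt, derivable_pt_exp.
    + apply (is_lim_seq_continuous sin); [|assumption].
      apply continuity_sin.
Qed.

Lemma Clim_seq_unique u l : Clim u l -> Clim_seq u = l.
Proof.
  intros [H1 H2]. unfold Clim_seq. rewrite (is_lim_seq_unique _ _ H1), (is_lim_seq_unique _ _ H2).
  now destruct l.
Qed.

(** * Stirling's formula *)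

Fixpoint Csum (f : nat -> C) (n : nat) : C :=
  match n with O => RtoC 0 | S n => (Csum f n + f n)%C end.

Lemma Cprod_app l1 l2 : Cprod (l1 ++ l2) = (Cprod l1 * Cprod l2)%C.
Proof.
  induction l1 as [|x l1 IH]; simpl; [ring|]. rewrite IH. ring.
Qed.

Lemma Im_plus_INR (s : C) n : Im (s + RtoC (INR n))%C = Im s.
Proof. unfold Im; simpl. ring. Qed.

Lemma Cprod_eq_Cexp (s : C) n : 0 < Im s ->
  Cprod (map (fun k => s + RtoC (INR k))%C (seq 0 n)) =
  Cexp (Csum (fun k => clog (s + RtoC (INR k))%C) n).
Proof.
  intros Hs. induction n as [|n IH].
  - simpl. now rewrite Cexp_0.
  - rewrite seq_S, map_app, Cprod_app, IH. cbn [Csum map Cprod fold_right].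
    rewrite Cexp_add, (Cexp_clog (s + _)) by (rewrite Im_plus_INR; assumption). simpl Nat.add. ring.
Qed.

Lemma Csum_clog (s : C) n :
  Csum (fun k => clog (s + RtoC (INR k))%C) (S n) =
  (clog_int (s + RtoC (INR n)) - clog_int s + (clog s + clog (s + RtoC (INR n))) * RtoC (1 / 2)
   - Csum (fun k => trap_err (s + RtoC (INR k))) n)%C.
Proof.
  induction n as [|n IH].
  - cbn [Csum INR]. replace (s + RtoC 0)%C with s by ring.
    generalize (clog s) (clog_int s). intros a b. apply injective_projections; simpl; field.
  - change (Csum (fun k : nat => clog (s + RtoC (INR k))) (S (S n)))
      with (Csum (fun k : nat => clog (s + RtoC (INR k))) (S n) + clog (s + RtoC (INR (S n))))%C.
    rewrite IH. cbn [Csum].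
    assert (E : (s + RtoC (INR n) + RtoC 1 = s + RtoC (INR (S n)))%C)
      by (rewrite S_INR, RtoC_plus; ring).
    assert (E' := eq_refl (trap_err (s + RtoC (INR n))%C)). unfold trap_err at 2 in E'.
    rewrite E in E'. rewrite E'. clear E E' IH.
    generalize (clog (s + RtoC (INR (S n)))) (clog (s + RtoC (INR n))) (clog s)
      (clog_int (s + RtoC (INR (S n)))) (clog_int (s + RtoC (INR n))) (clog_int s)
      (Csum (fun k => trap_err (s + RtoC (INR k))%C) n).
    intros. apply injective_projections; simpl; field.
Qed.

Definition fact_err (n : nat) : R := ln (INR (fact n)) - (INR n + 1 / 2) * ln (INR n) + INR n.

Lemma artanh_bound u : 0 <= u <= 1 / 3 -> 0 <= ln (1 + u) - ln (1 - u) - 2 * u <= 9 / 4 * (u * u * u).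
Proof.
  intros Hu.
  destruct (mean_value (fun u => ln (1 + u) - ln (1 - u) - 2 * u)
    (fun v => 2 * (v * v) / (1 - v * v)) 0 u ltac:(lra)) as [c [Hc E]].
  { intros x Hx. auto_derive; [lra|]. field. nra. }
  rewrite Rplus_0_r, !Rminus_0_r, ln_1 in E.
  replace (ln (1 + u) - ln (1 - u) - 2 * u) with (2 * (c * c) / (1 - c * c) * u) by lra.
  assert (H1 : 0 <= c * c <= 1 / 9) by nra.
  assert (H2 : 0 < / (1 - c * c)) by (apply Rinv_0_lt_compat; lra).
  assert (H3 : / (1 - c * c) <= 9 / 8).
  { replace (9 / 8) with (/ (8 / 9)) by field. apply Rinv_le_contravar; lra. }
  assert (c * c <= u * u) by nra.
  assert (H4 : 0 <= 2 * (c * c) / (1 - c * c) <= 9 / 4 * (u * u)).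
  { unfold Rdiv. split; nra. }
  split; nra.
Qed.

(** With [u = 1 / (2 n + 1)] the difference is [(ln ((1+u)/(1-u)) - 2 u) / (2 u)],
    of order [u^2]; bounding it by a telescoping term gives convergence. *)
Lemma fact_err_step n : (1 <= n)%nat ->
  0 <= fact_err n - fact_err (S n) <= / INR n - / INR (S n).
Proof.
  intros Hn. assert (H1 : 1 <= INR n) by (apply (le_INR 1); assumption).
  set (m := INR n) in *.
  assert (E : fact_err n - fact_err (S n) = (m + 1 / 2) * (ln (1 + / (2 * m + 1)) - ln (1 - / (2 * m + 1)) - 2 * / (2 * m + 1))).
  { unfold fact_err. rewrite fact_simpl, mult_INR, ln_mult by (apply lt_0_INR; try lia; apply lt_O_fact).
    rewrite !S_INR. fold m.
    replace (1 + / (2 * m + 1)) with (2 * (m + 1) / (2 * m + 1)) by (field; lra).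
    replace (1 - / (2 * m + 1)) with (2 * m / (2 * m + 1)) by (field; lra).
    rewrite !ln_div, !ln_mult by lra. field. lra. }
  rewrite E. set (u := / (2 * m + 1)).
  assert (Hu0 : 0 < u) by (apply Rinv_0_lt_compat; lra).
  assert (Hu : u <= 1 / 3).
  { replace (1 / 3) with (/ 3) by field. apply Rinv_le_contravar; lra. }
  generalize (artanh_bound u ltac:(lra)). intros [Hb1 Hb2].
  split; [nra|].
  apply Rle_trans with ((m + 1 / 2) * (9 / 4 * (u * u * u))); [nra|].
  rewrite S_INR. fold m.
  replace ((m + 1 / 2) * (9 / 4 * (u * u * u))) with (9 / 8 * (u * u)) by (unfold u; field; lra).
  replace (/ m - / (m + 1)) with (/ (m * (m + 1))) by (field; lra).
  replace (9 / 8 * (u * u)) with (/ (8 / 9 * ((2 * m + 1) * (2 * m + 1)))) by (unfold u; field; lra).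
  apply Rinv_le_contravar; nra.
Qed.

Lemma fact_err_lim : exists v : R, is_lim_seq fact_err v.
Proof.
  assert (H : ex_finite_lim_seq (fun n => fact_err (S n))).
  { apply (ex_finite_lim_seq_decr _ (fact_err 1 - 1)).
    - intros n. generalize (fact_err_step (S n) ltac:(lia)). lra.
    - intros n. assert (H : fact_err 1 - fact_err (S n) <= 1 - / INR (S n)).
      { induction n as [|n IH]; [simpl; lra|].
        generalize (fact_err_step (S n) ltac:(lia)). lra. }
      assert (0 < / INR (S n)) by (apply Rinv_0_lt_compat, lt_0_INR; lia). lra. }
  destruct H as [v Hv]. exists v. now apply is_lim_seq_incr_1.
Qed.

Lemma is_lim_seq_inv_INR (K : R) : is_lim_seq (fun n => K * / INR n) 0.
Proof.
  replace (Finite 0) with (Rbar_mult K 0) by (simpl; f_equal; ring).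
  apply is_lim_seq_scal_l.
  apply (is_lim_seq_inv INR p_infty); [apply is_lim_seq_INR|discriminate].
Qed.

(** The remainder is of second order in [1/n], so that it stays negligible after
    multiplication by [n + s + 1/2] in Gauss's product. *)
Lemma clog_shift (s : C) : 0 < Im s -> exists K N, forall n, (N <= n)%nat ->
  (0 < n)%nat /\
  Cmod (clog (s + RtoC (INR n)) - RtoC (ln (INR n)) - s * RtoC (/ INR n))%C <= K * (/ INR n * / INR n).
Proof.
  destruct s as [x y]; unfold Im; simpl; intros Hy.
  set (A := Rabs x + y + 1).
  assert (HA : 1 <= A) by (unfold A; generalize (Rabs_pos x); lra).
  assert (HxA : - A <= x <= A).
  { unfold A. generalize (Rle_abs x) (Rle_abs (- x)). rewrite Rabs_Ropp. lra. }
  destruct (INR_unbounded (8 * (A * A))) as [N HN].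
  exists (9 * (A * A * (A * A)) + A * A + (4 * (A * A) + 2 * (A * A))), N. intros n Hn.
  assert (Hm : 8 * (A * A) <= INR n) by (apply Rle_trans with (INR N); [lra|now apply le_INR]).
  set (m := INR n) in *. assert (Hm1 : 8 <= m) by nra.
  assert (HmA : 8 * A <= m) by nra.
  set (i := / m). assert (Hi : 0 < i) by (apply Rinv_0_lt_compat; lra).
  assert (Him : i * m = 1) by (unfold i; field; lra).
  assert (HiA : 8 * (A * A) * i <= 1) by nra.
  assert (Hi1 : i <= 1 / 8) by nra.
  split. { apply INR_lt. simpl. fold m. lra. }
  apply Rle_trans with (1 := Cmod_le_ReIm _).
  replace ((9 * (A * A * (A * A)) + A * A + (4 * (A * A) + 2 * (A * A))) * (i * i))
    with ((9 * (A * A * (A * A)) + A * A) * (i * i) + (4 * (A * A) + 2 * (A * A)) * (i * i)) by ring.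
  apply Rplus_le_compat.
  - unfold clog, Re, Im; simpl.
    set (w := 2 * x * i + (x * x + y * y) * (i * i)).
    assert (HxA2 : 0 <= x * x + y * y <= A * A).
    { split; [nra|]. unfold A. generalize (Rabs_pos x).
      assert (x * x = Rabs x * Rabs x) by (rewrite <- Rabs_mult; symmetry; apply Rabs_pos_eq; nra). nra. }
    assert (Hq : 0 <= (x * x + y * y) * (i * i) <= A * A * (i * i)) by (split; nra).
    assert (Hw : Rabs w <= 3 * (A * A) * i).
    { unfold w. apply Rabs_le. assert (A * A * (i * i) <= A * A * i) by nra.
      assert (A * i <= A * A * i) by nra. split; nra. }
    assert (Hw2 : Rabs w <= 1 / 2) by nra.
    assert (Hln : ln ((x + m) * (x + m) + (y + 0) * (y + 0)) = 2 * ln m + ln (1 + w)).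
    { replace ((x + m) * (x + m) + (y + 0) * (y + 0)) with (m * m * (1 + w)).
      - apply Rabs_le_between in Hw2.
        rewrite !ln_mult by nra. ring.
      - unfold w, i. field. lra. }
    rewrite Hln.
    generalize (ln_1p_bound w Hw2). set (l := ln (1 + w)). intros Hl.
    replace ((2 * ln m + l) / 2 + - ln m + - (x * i - y * 0))
      with ((l - w) / 2 + (x * x + y * y) * (i * i) / 2) by (unfold w; field).
    assert (Hww : w * w <= 9 * (A * A * (A * A)) * (i * i)).
    { replace (w * w) with (Rabs w * Rabs w) by (rewrite <- Rabs_mult; apply Rabs_pos_eq; nra).
      generalize (Rabs_pos w). nra. }
    apply Rabs_le_between in Hl. apply Rabs_le. split; lra.
  - unfold clog, Re, Im; simpl.
    assert (Hxm : 0 < x + m) by lra.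
    replace (y + 0) with y by ring.
    assert (Hat : PI / 2 - atan ((x + m) / y) = atan (y / (x + m))).
    { rewrite <- atan_inv; [f_equal; field; lra|]. apply Rdiv_lt_0_compat; lra. }
    rewrite Hat. set (q := y / (x + m)).
    assert (Hq0 : 0 < q) by (apply Rdiv_lt_0_compat; lra).
    assert (Hq : q <= 2 * (A * i)).
    { unfold q. apply Rmult_le_reg_r with (x + m); [assumption|].
      unfold Rdiv. rewrite Rmult_assoc, Rinv_l, Rmult_1_r by lra.
      assert (y <= A) by (unfold A; generalize (Rabs_pos x); lra).
      assert (A * i * m = A) by (rewrite Rmult_assoc, Him; ring).
      assert (0 < A * i) by nra.
      assert (A * i * x >= - (A * i * A)) by nra.
      assert (A * i * A <= 1 / 8) by nra. nra. }
    generalize (atan_bound q). set (t := atan q). intros Ht.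
    replace (t + - 0 + - (x * 0 + y * i)) with ((t - q) - q * x * i).
    2: { unfold q, i. field. lra. }
    apply Rabs_le_between in Ht.
    assert (q * q <= 4 * (A * A) * (i * i)) by nra.
    assert (Hqx : Rabs (q * x * i) <= 2 * (A * A) * (i * i)).
    { rewrite !Rabs_mult, (Rabs_pos_eq q), (Rabs_pos_eq i) by lra.
      assert (Rabs x <= A) by (unfold A; lra).
      replace (2 * (A * A) * (i * i)) with (2 * (A * i) * A * i) by ring.
      apply Rmult_le_compat_r; [lra|]. apply Rmult_le_compat; try lra. apply Rabs_pos. }
    apply Rabs_le_between in Hqx. apply Rabs_le. split; lra.
Qed.

(** The part of the exponent of Gauss's product that depends on [n] beyond the
    trapezoidal errors; its limit is the constant in Stirling's formula. *)
Definition gauss_main (s : C) (n : nat) : C :=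
  (RtoC (ln (INR (fact n))) + s * RtoC (ln (INR n))
   - clog_int (s + RtoC (INR n)) - clog (s + RtoC (INR n)) * RtoC (1 / 2))%C.

Lemma gauss_main_lim (v : R) (s : C) : is_lim_seq fact_err v -> 0 < Im s ->
  Clim (gauss_main s) (RtoC v).
Proof.
  intros Hv Hs. destruct (clog_shift s Hs) as [K [N HK]].
  apply Clim_ext_loc with (fun n => (RtoC (fact_err n) + (gauss_main s n - RtoC (fact_err n)))%C).
  { exists O. intros; ring. }
  replace (RtoC v) with (RtoC v + RtoC 0)%C by ring.
  apply Clim_plus; [now apply Clim_RtoC|].
  set (B := Cmod (s + RtoC (1 / 2))%C).
  apply Clim_bound with (fun n => (K + B * Cmod s + B * K) * / INR n); [|apply is_lim_seq_inv_INR].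
  exists N. intros n Hn. destruct (HK n Hn) as [Hn0 Hd].
  set (m := INR n) in *.
  assert (Hm : 1 <= m) by (apply (le_INR 1); lia).
  set (i := / m) in *.
  assert (Hi : 0 < i) by (apply Rinv_0_lt_compat; lra).
  assert (Him : m * i = 1) by (unfold i; field; lra).
  assert (Hi1 : i <= 1) by nra.
  set (e := (clog (s + RtoC m) - RtoC (ln m) - s * RtoC i)%C) in *.
  assert (E : (gauss_main s n - RtoC (fact_err n) - RtoC 0)%C
    = (- (RtoC m * e) - (s + RtoC (1 / 2)) * (s * RtoC i) - (s + RtoC (1 / 2)) * e)%C).
  { unfold gauss_main, fact_err, clog_int. fold m.
    replace (clog (s + RtoC m)) with (e + RtoC (ln m) + s * RtoC i)%C by (unfold e; ring).
    clearbody e.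
    assert (Him' : (RtoC m * RtoC i = RtoC 1)%C) by (rewrite <- RtoC_mult, Him; reflexivity).
    transitivity (- (RtoC m * e) - (s + RtoC (1 / 2)) * (s * RtoC i) - (s + RtoC (1 / 2)) * e
                  + s * (RtoC 1 - RtoC m * RtoC i))%C; [|rewrite Him'; ring].
    rewrite RtoC_plus, RtoC_minus, RtoC_mult, RtoC_plus. ring. }
  rewrite E.
  assert (Hme : Cmod (RtoC m * e)%C <= K * i).
  { rewrite Cmod_mult, Cmod_R, Rabs_pos_eq by lra.
    apply Rle_trans with (m * (K * (i * i))); [apply Rmult_le_compat_l; lra|].
    right. transitivity (K * (m * i) * i); [ring|rewrite Him; ring]. }
  assert (HB : 0 <= B) by apply Cmod_ge_0.
  assert (He : Cmod e <= K * i).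
  { generalize Hme. rewrite Cmod_mult, Cmod_R, Rabs_pos_eq by lra. generalize (Cmod_ge_0 e). nra. }
  unfold Cminus. eapply Rle_trans; [apply Cmod_triangle|].
  eapply Rle_trans; [apply Rplus_le_compat_r, Cmod_triangle|].
  rewrite !Cmod_opp, !(Cmod_mult (s + _)), Cmod_mult. fold B. rewrite (Cmod_mult s), Cmod_R, (Cmod_R i), (Rabs_pos_eq i), (Rabs_pos_eq m) by lra.
  rewrite Cmod_mult, Cmod_R, Rabs_pos_eq in Hme by lra.
  assert (B * Cmod e <= B * (K * i)) by (apply Rmult_le_compat_l; assumption).
  lra.
Qed.

(** The partial sums have bounded variation by telescoping, hence converge; the
    total variation of [atan] is at most [PI <= 4]. *)
Lemma trap_sum_lim (s : C) : 0 < Im s -> exists e,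
  Clim (Csum (fun k => trap_err (s + RtoC (INR k))%C)) e /\ Cmod e <= 4 / Im s.
Proof.
  intros Hs. set (y := Im s) in *. set (x := Re s).
  set (S := Csum (fun k => trap_err (s + RtoC (INR k))%C)).
  set (T := fun n => / (2 * y) * atan ((x + INR n) / y)).
  assert (Hy : 0 < / (2 * y)) by (apply Rinv_0_lt_compat; lra).
  assert (HPI := PI_RGT_0).
  assert (Hstep : forall n, Cmod (trap_err (s + RtoC (INR n))%C) <= T (Datatypes.S n) - T n).
  { intros n. eapply Rle_trans; [apply trap_err_le; now rewrite Im_plus_INR|].
    rewrite Im_plus_INR. unfold T. rewrite S_INR. fold y. right.
    replace (Re (s + RtoC (INR n))%C) with (x + INR n) by reflexivity.
    rewrite Rmult_minus_distr_l. now rewrite Rplus_assoc. }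
  assert (HT0 : forall n, 0 <= T n - T O <= / (2 * y) * PI).
  { intros n. unfold T. rewrite <- Rmult_minus_distr_l.
    assert (H : 0 <= atan ((x + INR n) / y) - atan ((x + INR 0) / y) <= PI).
    { apply atan_sub_bound. apply Rmult_le_compat_r; [left; apply Rinv_0_lt_compat; lra|].
      simpl INR. generalize (pos_INR n). lra. }
    split; [apply Rmult_le_pos; lra|apply Rmult_le_compat_l; lra]. }
  assert (HTinc : forall n, T n <= T (Datatypes.S n)).
  { intros n. generalize (Hstep n) (Cmod_ge_0 (trap_err (s + RtoC (INR n))%C)). lra. }
  destruct (ex_finite_lim_seq_incr T (T O + / (2 * y) * PI) HTinc) as [t Ht].
  { intros n. generalize (HT0 n). lra. }
  assert (G : forall p : C -> R, p (RtoC 0) = 0 -> (forall a b, p (a + b)%C = p a + p b) ->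
     (forall z, Rabs (p z) <= Cmod z) ->
     exists l : R, is_lim_seq (fun n => p (S n)) l /\ Rabs l <= / (2 * y) * PI).
  { intros p Hp0 Hp1 Hp2.
    assert (Hb : forall n, Rabs (p (S n)) <= T n - T O).
    { induction n as [|n IH].
      - unfold S; simpl. rewrite Hp0, Rabs_R0. lra.
      - unfold S in *; cbn [Csum]. rewrite Hp1. eapply Rle_trans; [apply Rabs_triang|].
        generalize (Hstep n) (Hp2 (trap_err (s + RtoC (INR n))%C)). lra. }
    destruct (ex_finite_lim_seq_incr (fun n => p (S n) + T n) (/ (2 * y) * PI + (T O + / (2 * y) * PI))) as [l Hl].
    - intros n. unfold S; cbn [Csum]. rewrite Hp1.
      generalize (Hstep n) (Hp2 (trap_err (s + RtoC (INR n))%C)). intros H1 H2.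
      apply Rle_trans with (1 := H2) in H1. apply Rabs_le_between in H1. lra.
    - intros n. generalize (HT0 n) (Hb n) (Rle_abs (p (S n))). lra.
    - exists (l - t).
      assert (L : is_lim_seq (fun n => p (S n)) (l - t)).
      { apply (is_lim_seq_ext (fun n => (p (S n) + T n) - T n)); [intros; Rring|].
        now apply is_lim_seq_minus'. }
      split; [assumption|].
      apply (is_lim_seq_le (fun n => Rabs (p (S n))) (fun _ => / (2 * y) * PI) (Rabs (l - t)) (/ (2 * y) * PI)).
      + intros n. generalize (HT0 n) (Hb n). lra.
      + apply (is_lim_seq_abs _ (Finite (l - t)) L).
      + apply is_lim_seq_const. }
  destruct (G Re) as [a [Ha Ha']]; [reflexivity|reflexivity|apply re_le_Cmod|].
  destruct (G Im) as [b [Hb Hb']]; [reflexivity|reflexivity|apply im_le_Cmod|].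
  exists (a, b). split; [split; assumption|].
  eapply Rle_trans; [apply Cmod_le_ReIm|]. simpl.
  apply Rle_trans with (2 * (/ (2 * y) * PI)); [lra|].
  replace (2 * (/ (2 * y) * PI)) with (PI / y) by (field; lra).
  apply Rmult_le_compat_r; [left; apply Rinv_0_lt_compat; lra|apply PI_4].
Qed.

(** Gauss's product, written as the exponential of a sum of logarithms, is
    compared with an integral by the trapezoidal rule; the accumulated error is
    the sum of [1/|s+k|^2], that is [O(1/Im s)]. *)
Theorem Stirling : exists v : R, forall s : C, 0 < Im s -> exists e : C,
  Cmod e <= 4 / Im s /\
  Gamma s = Cexp (RtoC v + (clog_int s - clog s * RtoC (1 / 2)) + e)%C.
Proof.
  destruct fact_err_lim as [v Hv]. exists v. intros s Hs.
  destruct (trap_sum_lim s Hs) as [e [He1 He2]]. exists e. split; [assumption|].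
  apply Clim_seq_unique.
  apply Clim_ext_loc with (fun n => Cexp (gauss_main s n + (clog_int s - clog s * RtoC (1 / 2))
     + Csum (fun k => trap_err (s + RtoC (INR k))) n)%C).
  - exists 1%nat. intros n Hn.
    rewrite Cprod_eq_Cexp by assumption.
    assert (Hf : 0 < INR (fact n)) by (apply lt_0_INR, lt_O_fact).
    unfold Cpower. rewrite <- (exp_ln _ Hf) at 1. rewrite <- Cexp_RtoC, <- Cexp_add.
    unfold Cdiv. rewrite <- Cexp_opp, <- Cexp_add. f_equal. rewrite Csum_clog.
    unfold gauss_main.
    generalize (clog s) (clog_int s) (clog (s + RtoC (INR n))) (clog_int (s + RtoC (INR n))).
    intros. ring.
  - apply Clim_Cexp. apply Clim_plus; [|assumption].
    apply Clim_plus; [|apply Clim_const]. now apply gauss_main_lim.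
Qed.

(** * Gamma factors on vertical lines *)

Definition O_inv (f : R -> R) : Prop :=
  exists K t0, forall t, t0 <= t -> Rabs (f t) <= K / t.

Lemma O_inv_le (f g : R -> R) :
  (exists t0, forall t, t0 <= t -> Rabs (f t) <= g t) -> O_inv g -> O_inv f.
Proof.
  intros [t0 H] [K [t1 H1]]. exists K, (Rmax t0 t1). intros t Ht.
  destruct (Rmax_le_inv _ _ _ Ht) as [? ?].
  apply Rle_trans with (1 := H t ltac:(assumption)).
  apply Rle_trans with (2 := H1 t ltac:(assumption)). apply Rle_abs.
Qed.

Lemma O_inv_plus (f g : R -> R) : O_inv f -> O_inv g -> O_inv (fun t => f t + g t).
Proof.
  intros [K [t0 H]] [K1 [t1 H1]]. exists (K + K1), (Rmax t0 t1). intros t Ht.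
  destruct (Rmax_le_inv _ _ _ Ht) as [? ?].
  apply Rle_trans with (1 := Rabs_triang _ _). unfold Rdiv. rewrite Rmult_plus_distr_r.
  apply Rplus_le_compat; auto.
Qed.

Lemma O_inv_scal (c : R) (f : R -> R) : O_inv f -> O_inv (fun t => c * f t).
Proof.
  intros [K [t0 H]]. exists (Rabs c * K), t0. intros t Ht.
  rewrite Rabs_mult. unfold Rdiv. rewrite Rmult_assoc. apply Rmult_le_compat_l; [apply Rabs_pos|auto].
Qed.

Lemma O_inv_inv (c : R) : O_inv (fun t => c / t).
Proof.
  exists (Rabs c), 1. intros t Ht. unfold Rdiv. rewrite Rabs_mult, Rabs_inv, (Rabs_pos_eq t) by lra. lra.
Qed.

Lemma O_inv_ext (f g : R -> R) : (forall t, f t = g t) -> O_inv f -> O_inv g.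
Proof. intros H [K [t0 H0]]. exists K, t0. intros t Ht. rewrite <- H. auto. Qed.

Definition log_model (A B D : C) (e t : R) : C :=
  (A + B * RtoC (ln t) + D * RtoC t + Ci * RtoC (e * (t * ln t)))%C.

(** The relative error [O(1/t)] sits in the exponent, so that products and quotients
    of such functions are sums and differences of exponents. *)
Definition asymp (f : R -> C) (A B D : C) (e : R) : Prop :=
  exists K t0, forall t, t0 <= t -> exists r : C,
    Cmod r <= K / t /\ f t = Cexp (log_model A B D e t + r)%C.

Lemma asymp_mult f g A B D e A' B' D' e' :
  asymp f A B D e -> asymp g A' B' D' e' ->
  asymp (fun t => f t * g t)%C (A + A')%C (B + B')%C (D + D')%C (e + e').
Proof.
  intros [K [t0 H]] [K1 [t1 H1]]. exists (K + K1), (Rmax t0 t1). intros t Ht.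
  destruct (Rmax_le_inv _ _ _ Ht) as [H2 H3].
  destruct (H t H2) as [r [Hr E]]. destruct (H1 t H3) as [r1 [Hr1 E1]].
  exists (r + r1)%C. split.
  - apply Rle_trans with (1 := Cmod_triangle _ _). unfold Rdiv in *. lra.
  - rewrite E, E1, <- Cexp_add. f_equal. unfold log_model.
    rewrite !RtoC_mult, RtoC_plus. ring.
Qed.

Lemma asymp_inv f A B D e :
  asymp f A B D e -> asymp (fun t => / f t)%C (- A)%C (- B)%C (- D)%C (- e).
Proof.
  intros [K [t0 H]]. exists K, t0. intros t Ht.
  destruct (H t Ht) as [r [Hr E]]. exists (- r)%C. split.
  - now rewrite Cmod_opp.
  - rewrite E, <- Cexp_opp. f_equal. unfold log_model.
    rewrite !RtoC_mult, RtoC_opp. ring.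
Qed.

Lemma asymp_conj f A B D e :
  asymp f A B D e -> asymp (fun t => Cconj (f t)) (Cconj A) (Cconj B) (Cconj D) (- e).
Proof.
  intros [K [t0 H]]. exists K, t0. intros t Ht.
  destruct (H t Ht) as [r [Hr E]]. exists (Cconj r). split.
  - now rewrite Cmod_conj.
  - rewrite E, Cexp_conj. f_equal. unfold log_model.
    apply injective_projections; simpl; ring.
Qed.

Lemma asymp_exp (A D : C) : asymp (fun t => Cexp (A + D * RtoC t)%C) A (RtoC 0) D 0.
Proof.
  exists 0, 1. intros t Ht. exists (RtoC 0). split.
  - rewrite Cmod_0. unfold Rdiv. lra.
  - f_equal. unfold log_model. rewrite Rmult_0_l. ring.
Qed.

Lemma asymp_ext f g A B D e : (forall t, f t = g t) -> asymp f A B D e -> asymp g A B D e.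
Proof.
  intros H [K [t0 H0]]. exists K, t0. intros t Ht. rewrite <- H. auto.
Qed.

(** Only the first terms of [ln (1 + q)] and [atan p] survive, where [q] compares
    [lam t + Im mu] with [lam t] and [p] is the cotangent of the argument; both are
    [O(1/t)]. *)
Lemma Gamma_line (lam x : R) (mu : C) : 0 < lam -> exists A B D : C,
  asymp (fun t => Gamma (RtoC lam * (x, t) + mu)%C) A B D lam /\
  Re B = lam * x + Re mu - 1 / 2 /\ Re D = - (PI / 2) * lam.
Proof.
  intros Hlam. destruct Stirling as [v Hv].
  destruct mu as [mr m]. set (X := lam * x + mr).
  set (A := (v + (X - 1 / 2) * ln lam - PI / 2 * m, m * ln lam + (X - 1 / 2) * (PI / 2)) : C).
  set (B := (X - 1 / 2, m) : C).
  set (D := (- (PI / 2) * lam, lam * ln lam - lam) : C).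
  exists A, B, D. split; [|split; reflexivity].
  set (Y := fun t => lam * t + m).
  set (q := fun t => m / (lam * t)).
  set (zeta := fun t => ln (1 + q t)).
  set (p := fun t => X / Y t).
  set (eps := fun t => ln (1 + p t * p t) / 2).
  set (eta := fun t => atan (p t)).
  set (r1 := fun t => (X - 1 / 2) * zeta t + (X - 1 / 2) * eps t + (Y t * eta t - X)).
  set (r2 := fun t => (lam * t * (zeta t - q t) + m * zeta t) + (Y t * eps t - (X - 1 / 2) * eta t)).
  set (t0 := Rmax 1 (2 * Rabs m / lam)).
  assert (Ht0 : forall t, t0 <= t -> 1 <= t /\ Rabs (q t) <= 1 / 2 /\ lam * t / 2 <= Y t /\ 0 < lam * t).
  { intros t Ht.
    destruct (Rmax_le_inv _ _ _ Ht) as [H1 H2].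
    assert (H3 : 2 * Rabs m <= lam * t).
    { replace (2 * Rabs m) with (lam * (2 * Rabs m / lam)) by (field; lra). nra. }
    assert (H4 : 0 < lam * t) by nra.
    split; [assumption|]. split; [|split; [|assumption]].
    - unfold q. unfold Rdiv at 1. rewrite Rabs_mult, Rabs_inv, (Rabs_pos_eq (lam * t)) by lra.
      apply Rmult_le_reg_r with (lam * t); [assumption|]. rewrite Rmult_assoc, Rinv_l by lra. lra.
    - unfold Y. generalize (Rle_abs (- m)). rewrite Rabs_Ropp. lra. }
  assert (Hp : forall t, t0 <= t -> Rabs (p t) <= (2 * Rabs X / lam) / t).
  { intros t Ht. destruct (Ht0 t Ht) as [H1 [H2 [H3 H4]]].
    unfold p. unfold Rdiv at 1. rewrite Rabs_mult, Rabs_inv, (Rabs_pos_eq (Y t)) by lra.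
    replace (2 * Rabs X / lam / t) with (Rabs X * / (lam * t / 2)) by (field; lra).
    apply Rmult_le_compat_l; [apply Rabs_pos|]. apply Rinv_le_contravar; lra. }
  assert (Op : O_inv p).
  { exists (2 * Rabs X / lam), t0. exact Hp. }
  assert (Opp : O_inv (fun t => p t * p t)).
  { apply O_inv_le with (fun t => (2 * Rabs X / lam) * Rabs (p t)).
    - exists t0. intros t Ht. rewrite Rabs_mult. apply Rmult_le_compat_r; [apply Rabs_pos|].
      apply Rle_trans with (1 := Hp t Ht). destruct (Ht0 t Ht) as [H1 _].
      assert (0 <= 2 * Rabs X / lam) by (apply Rle_mult_inv_pos; [generalize (Rabs_pos X); lra|lra]).
      apply Rmult_le_reg_r with t; [lra|]. unfold Rdiv. rewrite Rmult_assoc, Rinv_l by lra. unfold Rdiv in *. nra.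
    - apply O_inv_scal. exists (2 * Rabs X / lam), t0. intros t Ht. rewrite Rabs_Rabsolu. now apply Hp. }
  assert (Oq : O_inv q).
  { apply O_inv_ext with (fun t => (m / lam) / t); [|apply O_inv_inv].
    intros t. unfold q, Rdiv. rewrite Rinv_mult. ring. }
  assert (Hz : forall t, t0 <= t -> Rabs (zeta t - q t) <= 2 * (q t * q t)).
  { intros t Ht. apply ln_1p_bound. apply (Ht0 t Ht). }
  assert (Oz : O_inv zeta).
  { apply O_inv_le with (fun t => 2 * Rabs (q t)).
    - exists t0. intros t Ht. generalize (Hz t Ht). destruct (Ht0 t Ht) as [_ [H2 _]]. intros H.
      replace (zeta t) with ((zeta t - q t) + q t) by ring.
      apply Rle_trans with (1 := Rabs_triang _ _).
      assert (q t * q t = Rabs (q t) * Rabs (q t)) by (rewrite <- Rabs_mult; symmetry; apply Rabs_pos_eq; nra).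
      generalize (Rabs_pos (q t)). nra.
    - apply O_inv_scal. destruct Oq as [K [t1 H]]. exists K, t1. intros. rewrite Rabs_Rabsolu. auto. }
  assert (Heps : forall t, 0 <= eps t <= p t * p t / 2).
  { intros t. assert (0 <= p t * p t) by nra. unfold eps. split.
    - apply Rmult_le_pos; [|lra]. rewrite <- ln_1. apply ln_le; lra.
    - generalize (ln_le_sub_1 (1 + p t * p t) ltac:(lra)). lra. }
  assert (Oeps : O_inv eps).
  { apply O_inv_le with (2 := Opp). exists 0. intros t _. generalize (Heps t).
    intros H. rewrite Rabs_pos_eq; [|lra]. assert (0 <= p t * p t) by nra. lra. }
  assert (Heta : forall t, Rabs (eta t - p t) <= p t * p t) by (intros; apply atan_bound).
  assert (Oeta : O_inv eta).
  { apply O_inv_ext with (fun t => (eta t - p t) + p t); [intros; ring|].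
    apply O_inv_plus; [|assumption]. apply O_inv_le with (2 := Opp). exists 0. auto. }
  assert (HYp : forall t, t0 <= t -> 0 < Y t /\ Y t * p t = X).
  { intros t Ht. destruct (Ht0 t Ht) as [H1 [H2 [H3 H4]]]. split; [lra|]. unfold p. field. lra. }
  assert (O1 : O_inv (fun t => Y t * eta t - X)).
  { apply O_inv_le with (fun t => X * p t); [|now apply O_inv_scal].
    exists t0. intros t Ht. destruct (HYp t Ht) as [H1 H2].
    replace (Y t * eta t - X) with (Y t * (eta t - p t)) by (rewrite <- H2; ring).
    rewrite Rabs_mult, Rabs_pos_eq by lra.
    replace (X * p t) with (Y t * (p t * p t)) by (rewrite <- H2; ring).
    apply Rmult_le_compat_l; [lra|apply Heta]. }
  assert (O2 : O_inv (fun t => Y t * eps t)).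
  { apply O_inv_le with (fun t => X * p t); [|now apply O_inv_scal].
    exists t0. intros t Ht. destruct (HYp t Ht) as [H1 H2].
    replace (X * p t) with (Y t * (p t * p t)) by (rewrite <- H2; ring).
    rewrite Rabs_mult, !Rabs_pos_eq by (apply Heps || lra).
    apply Rmult_le_compat_l; [lra|]. generalize (Heps t). assert (0 <= p t * p t) by nra. lra. }
  assert (O3 : O_inv (fun t => lam * t * (zeta t - q t))).
  { apply O_inv_le with (fun t => 2 * m * q t); [|now apply O_inv_scal].
    exists t0. intros t Ht. destruct (Ht0 t Ht) as [H1 [_ [_ H4]]].
    replace (2 * m * q t) with (lam * t * (2 * (q t * q t))) by (unfold q; field; lra).
    rewrite Rabs_mult, Rabs_pos_eq by lra. apply Rmult_le_compat_l; [lra|auto]. }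
  assert (Or1 : O_inv r1).
  { apply O_inv_plus; [|assumption]. apply O_inv_plus; now apply O_inv_scal. }
  assert (Or2 : O_inv r2).
  { apply O_inv_plus.
    - apply O_inv_plus; [assumption|now apply O_inv_scal].
    - apply O_inv_ext with (fun t => Y t * eps t + (- (X - 1 / 2)) * eta t); [intros; ring|].
      apply O_inv_plus; [assumption|now apply O_inv_scal]. }
  destruct Or1 as [K1 [t1 H1]]. destruct Or2 as [K2 [t2 H2]].
  exists (K1 + K2 + 8 / lam), (Rmax t0 (Rmax t1 t2)). intros t Ht.
  destruct (Rmax_le_inv _ _ _ Ht) as [HH0 [HH1 HH2]%Rmax_le_inv].
  specialize (H1 t HH1). specialize (H2 t HH2). destruct (Ht0 t HH0) as [Ht1 [Hq [HY Hlt]]].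
  assert (EZ : (RtoC lam * (x, t) + (mr, m))%C = (X, Y t)).
  { apply injective_projections; unfold X, Y; simpl; ring. }
  rewrite EZ.
  destruct (Hv (X, Y t) ltac:(simpl; lra)) as [e [He E]]. simpl Im in He.
  exists (e + (r1 t, r2 t))%C. split.
  - apply Rle_trans with (1 := Cmod_triangle _ _).
    assert (Hr := Cmod_le_ReIm (r1 t, r2 t)). simpl in Hr.
    assert (4 / Y t <= 8 / lam / t).
    { replace (8 / lam / t) with (4 * / (lam * t / 2)) by (field; lra).
      apply Rmult_le_compat_l; [lra|]. apply Rinv_le_contravar; lra. }
    unfold Rdiv in *. lra.
  - rewrite E. f_equal.
    assert (Hlog : clog (X, Y t) = (ln lam + ln t + zeta t + eps t, PI / 2 - eta t)).
    { unfold clog, Re, Im; simpl. f_equal.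
      apply Rabs_le_between in Hq.
      replace (X * X + Y t * Y t) with ((lam * t * (1 + q t)) * (lam * t * (1 + q t)) * (1 + p t * p t)).
      2: { unfold p, q. replace (lam * t * (1 + m / (lam * t))) with (Y t) by (unfold Y; field; lra). field. lra. }
      assert (0 < 1 + p t * p t) by nra.
      rewrite !ln_mult by nra. unfold zeta, eps. field. }
    unfold clog_int. rewrite Hlog. unfold log_model, A, B, D, r1, r2.
    assert (Hlq : lam * t * q t = m) by (unfold q; field; lra).
    apply injective_projections; simpl.
    + unfold Y. field.
    + unfold Y. replace (lam * t * (zeta t - q t)) with (lam * t * zeta t - m) by (rewrite <- Hlq at 1; ring). field.
Qed.

Lemma asymp_const_1 : asymp (fun _ => RtoC 1) (RtoC 0) (RtoC 0) (RtoC 0) 0.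
Proof.
  apply asymp_ext with (2 := asymp_exp (RtoC 0) (RtoC 0)). intros t.
  replace (RtoC 0 + RtoC 0 * RtoC t)%C with (RtoC 0) by ring. apply Cexp_0.
Qed.

Lemma Gamma_prod_line (l : list (R * C)) : Forall (fun p => 0 < fst p) l ->
  exists M : R, forall x : R, exists A B D : C,
  asymp (fun t => Cprod (map (fun p => Gamma (RtoC (fst p) * (x, t) + snd p)) l)%C)
    A B D (Rlist_sum (map fst l)) /\
  Re B = Rlist_sum (map fst l) * x + M /\ Re D = - (PI / 2) * Rlist_sum (map fst l).
Proof.
  induction 1 as [|[lam mu] l Hlam Hl [M IH]].
  - exists 0. intros x. exists (RtoC 0), (RtoC 0), (RtoC 0). simpl.
    split; [apply asymp_const_1|]. split; ring.
  - exists (Re mu - 1 / 2 + M). intros x. simpl in Hlam.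
    destruct (IH x) as [A [B [D [H1 [H2 H3]]]]].
    destruct (Gamma_line lam x mu Hlam) as [A' [B' [D' [H4 [H5 H6]]]]].
    exists (A' + A)%C, (B' + B)%C, (D' + D)%C. split; [|split].
    + apply (asymp_mult _ _ _ _ _ _ _ _ _ _ H4 H1).
    + rewrite re_plus, H2, H5. simpl. ring.
    + rewrite re_plus, H3, H6. simpl. ring.
Qed.

Lemma Gamma_inv_prod_line (l : list (R * C)) : Forall (fun p => 0 < fst p) l ->
  exists M : R, forall x : R, exists A B D : C,
  asymp (fun t => Cprod (map (fun p => / Gamma (RtoC (fst p) * (x, t) + snd p)) l)%C)
    A B D (- Rlist_sum (map fst l)) /\
  Re B = - Rlist_sum (map fst l) * x + M /\ Re D = PI / 2 * Rlist_sum (map fst l).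
Proof.
  induction 1 as [|[lam mu] l Hlam Hl [M IH]].
  - exists 0. intros x. exists (RtoC 0), (RtoC 0), (RtoC 0). simpl. rewrite Ropp_0.
    split; [apply asymp_const_1|]. split; ring.
  - exists (M - (Re mu - 1 / 2)). intros x. simpl in Hlam.
    destruct (IH x) as [A [B [D [H1 [H2 H3]]]]].
    destruct (Gamma_line lam x mu Hlam) as [A' [B' [D' [H4 [H5 H6]]]]].
    exists (- A' + A)%C, (- B' + B)%C, (- D' + D)%C. split; [|split].
    + cbn [map fst snd Rlist_sum fold_right]. rewrite Ropp_plus_distr.
      apply (asymp_mult _ _ _ _ _ _ _ _ _ _ (asymp_inv _ _ _ _ _ H4) H1).
    + rewrite re_plus, re_opp, H2, H5. simpl. ring.
    + rewrite re_plus, re_opp, H3, H6. simpl. ring.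
Qed.

(** The factor by which the functional equation multiplies [F]. *)
Definition completed_factor (Q : R) (l l' : list (R * C)) (s : C) : C :=
  (Cpower Q s * gamma_factor l l' s)%C.

Lemma completed_factor_line (Q : R) (l l' : list (R * C)) :
  Forall (fun p => 0 < fst p) l -> Forall (fun p => 0 < fst p) l' ->
  exists M : R, forall x : R, exists A B D : C,
  asymp (fun t => completed_factor Q l l' (x, t)) A B D (gamma_degree l l' / 2) /\
  Re B = gamma_degree l l' / 2 * x + M /\ Re D = - (PI / 2) * (gamma_degree l l' / 2).
Proof.
  intros Hl Hl'.
  destruct (Gamma_prod_line l Hl) as [M1 H1]. destruct (Gamma_inv_prod_line l' Hl') as [M2 H2].
  exists (M1 + M2). intros x.
  destruct (H1 x) as [A1 [B1 [D1 [H3 [H4 H5]]]]].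
  destruct (H2 x) as [A2 [B2 [D2 [H6 [H7 H8]]]]].
  assert (Hd : gamma_degree l l' / 2 = 0 + (Rlist_sum (map fst l) + - Rlist_sum (map fst l')))
    by (unfold gamma_degree; field).
  exists (RtoC x * RtoC (ln Q) + (A1 + A2))%C, (RtoC 0 + (B1 + B2))%C, (Ci * RtoC (ln Q) + (D1 + D2))%C.
  split; [|split].
  - rewrite Hd. unfold completed_factor, gamma_factor.
    apply (asymp_mult _ _ _ _ _ _ _ _ _ _); [|apply (asymp_mult _ _ _ _ _ _ _ _ _ _ H3 H6)].
    apply asymp_ext with (2 := asymp_exp _ _). intros t. unfold Cpower. f_equal.
    apply injective_projections; simpl; ring.
  - rewrite Hd, !re_plus, H4, H7, re_RtoC. ring.
  - rewrite Hd, !re_plus, H5, H8, re_scal_r. simpl. field.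
Qed.

(** On the reflected line the exponential decay of the gamma factors cancels,
    while their oscillations reinforce each other: the ratio has size
    [t^(d (c - 1/2))] and phase [- d t ln t] up to a linear term. *)
Lemma reflection_ratio_line (Q c : R) (l l' : list (R * C)) :
  Forall (fun p => 0 < fst p) l -> Forall (fun p => 0 < fst p) l' ->
  exists (A B : C) (b K t0 : R), Re B = gamma_degree l l' * (c - 1 / 2) /\
  forall t, t0 <= t -> completed_factor Q l l' ((1 - c)%R, t) <> RtoC 0 /\
  exists r : C, Cmod r <= K / t /\
  (Cconj (completed_factor Q l l' (c, t)) / completed_factor Q l l' ((1 - c)%R, t))%C
  = Cexp (A + B * RtoC (ln t) + Ci * RtoC (b * t - gamma_degree l l' * (t * ln t)) + r)%C.
Proof.
  intros Hl Hl'. set (d := gamma_degree l l').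
  destruct (completed_factor_line Q l l' Hl Hl') as [M H]. fold d in H.
  destruct (H c) as [A1 [B1 [D1 [H1 [H2 H3]]]]].
  destruct (H (1 - c)) as [A2 [B2 [D2 [H4 [H5 H6]]]]].
  generalize (asymp_mult _ _ _ _ _ _ _ _ _ _ (asymp_conj _ _ _ _ _ H1) (asymp_inv _ _ _ _ _ H4)).
  intros [K [t1 H7]]. destruct H4 as [K' [t2 H8]].
  exists (Cconj A1 + - A2)%C, (Cconj B1 + - B2)%C, (Im (Cconj D1 + - D2)%C), K, (Rmax t1 t2).
  split.
  - rewrite re_plus, re_opp, re_conj, H2, H5. field.
  - intros t Ht.
    destruct (Rmax_le_inv _ _ _ Ht) as [Ht1 Ht2].
    split.
    + destruct (H8 t Ht2) as [r [_ E]]. rewrite E. apply Cexp_neq_0.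
    + destruct (H7 t Ht1) as [r [Hr E]]. exists r. split; [assumption|].
      unfold Cdiv. rewrite E. f_equal. f_equal. unfold log_model.
      assert (ED : (Cconj D1 + - D2 = Ci * RtoC (Im (Cconj D1 + - D2)))%C).
      { apply injective_projections.
        - change (Re (Cconj D1 + - D2)%C = Re (Ci * RtoC (Im (Cconj D1 + - D2)%C))%C).
          rewrite re_plus, re_opp, re_conj, H3, H6. unfold Re; simpl. ring.
        - unfold Im; simpl. ring. }
      rewrite ED at 1. set (bb := Im (Cconj D1 + - D2)%C).
      apply injective_projections; simpl; field.
Qed.

(** * Gaussian windows *)

(** On a vertical line its modulus is a Gaussian around height [T]; [be] shifts
    the frequency to be detected, and [L = ln n] builds in the factor [n^(-s)]. *)
Definition window (al be L T : R) (s : C) : C :=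
  Cexp (RtoC (al / T) * ((s - (0, T)) * (s - (0, T))) + RtoC be * (s - (0, T)) + RtoC (- L) * s)%C.

Lemma Cmod_window al be L T x y :
  Cmod (window al be L T (x, y)) = exp (al / T * (x * x) - al / T * ((y - T) * (y - T)) + (be - L) * x).
Proof.
  unfold window. rewrite Cmod_Cexp. f_equal. unfold Re; simpl. ring.
Qed.

Lemma hol_window al be L T z : hol (window al be L T) z.
Proof.
  unfold window.
  apply (hol_comp Cexp); [apply hol_Cexp|].
  assert (Hs : hol (fun s => s - (0, T))%C z) by (apply hol_plus; [apply hol_id|apply hol_const]).
  apply hol_plus; [apply hol_plus|]; apply hol_mult; try apply hol_const; try apply hol_id; try assumption.
  now apply hol_mult.
Qed.

Definition gauss (al T y : R) : R := exp (- (al / T * ((y - T) * (y - T)))).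

Lemma gauss_pos al T y : 0 < gauss al T y.
Proof. apply exp_pos. Qed.

Lemma continuous_gauss al T y : continuous (gauss al T) y.
Proof.
  unfold gauss. apply ex_derive_Rcontinuous. auto_derive. easy.
Qed.

Definition gauss_mass (al rho T : R) : R := RInt (gauss al T) (T - rho * T) (T + rho * T).

Lemma ex_RInt_cont (g : R -> R) a b : (forall x, continuous g x) -> ex_RInt g a b.
Proof. intros H. apply (ex_RInt_continuous (V := R_CompleteNormedModule)). auto. Qed.

(** Integration by parts; the boundary term has the favourable sign. *)
Lemma gauss_second_moment al rho T : 0 < al -> 0 < rho -> 0 < T ->
  RInt (fun y => (y - T) * (y - T) / T * gauss al T y) (T - rho * T) (T + rho * T)
  <= gauss_mass al rho T / (2 * al).
Proof.
  intros Hal Hrho HT.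
  set (m2 := fun y => (y - T) * (y - T) / T * gauss al T y).
  assert (Hm2 : forall y, continuous m2 y).
  { intros y. unfold m2, gauss. apply ex_derive_Rcontinuous. auto_derive. lra. }
  assert (E : RInt (fun y => minus (m2 y) (scal (/ (2 * al)) (gauss al T y))) (T - rho * T) (T + rho * T)
     = minus (- ((T + rho * T - T) / (2 * al)) * gauss al T (T + rho * T))
             (- ((T - rho * T - T) / (2 * al)) * gauss al T (T - rho * T))).
  { apply is_RInt_unique.
    apply (is_RInt_derive (fun y => - ((y - T) / (2 * al)) * gauss al T y)).
    - intros y _. unfold m2, gauss, minus, plus, opp, scal; simpl; unfold mult; simpl.
      auto_derive; [easy|]. unfold Rminus. field. lra.
    - intros y _. apply continuous_Rminus; [apply Hm2|].
      apply (continuous_scal_r (V := R_NormedModule)). apply continuous_gauss. }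
  rewrite (RInt_minus (V := R_CompleteNormedModule)) in E.
  2: now apply ex_RInt_cont.
  2: apply ex_RInt_Rscal, ex_RInt_cont, continuous_gauss.
  assert (E2 : RInt (fun y => scal (/ (2 * al)) (gauss al T y)) (T - rho * T) (T + rho * T)
     = / (2 * al) * gauss_mass al rho T).
  { apply RInt_Rscal, ex_RInt_cont, continuous_gauss. }
  rewrite E2 in E.
  unfold minus, plus, opp in E; simpl in E.
  assert (P1 := gauss_pos al T (T + rho * T)). assert (P2 := gauss_pos al T (T - rho * T)).
  assert (P3 : 0 < rho * T / (2 * al)) by (apply Rdiv_lt_0_compat; nra).
  replace ((T + rho * T - T) / (2 * al)) with (rho * T / (2 * al)) in E by (field; lra).
  replace ((T - rho * T - T) / (2 * al)) with (- (rho * T / (2 * al))) in E by (field; lra).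
  replace (gauss_mass al rho T / (2 * al)) with (/ (2 * al) * gauss_mass al rho T) by (field; lra).
  nra.
Qed.

Lemma gauss_mass_lower al rho T : 0 < al -> 1 <= T -> 1 <= rho * T -> exp (- al) <= gauss_mass al rho T.
Proof.
  intros Hal HT Hrho. unfold gauss_mass.
  assert (Hex : forall a b, ex_RInt (gauss al T) a b) by (intros; apply ex_RInt_cont, continuous_gauss).
  rewrite <- (RInt_Chasles (gauss al T) (T - rho * T) (T - 1) (T + rho * T)) by apply Hex.
  rewrite <- (RInt_Chasles (gauss al T) (T - 1) (T + 1) (T + rho * T)) by apply Hex.
  unfold plus; simpl.
  assert (H1 : 0 <= RInt (gauss al T) (T - rho * T) (T - 1)).
  { apply RInt_ge_0; [lra|apply Hex|intros; left; apply gauss_pos]. }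
  assert (H2 : 0 <= RInt (gauss al T) (T + 1) (T + rho * T)).
  { apply RInt_ge_0; [lra|apply Hex|intros; left; apply gauss_pos]. }
  assert (H3 : RInt (fun _ => exp (- al)) (T - 1) (T + 1) <= RInt (gauss al T) (T - 1) (T + 1)).
  { apply RInt_le; [lra|apply ex_RInt_const|apply Hex|].
    intros y Hy. apply exp_le_exp. apply Ropp_le_contravar.
    assert ((y - T) * (y - T) <= 1) by nra.
    assert (al / T <= al) by (apply Rmult_le_reg_r with T; [lra|]; unfold Rdiv; rewrite Rmult_assoc, Rinv_l by lra; nra).
    assert (0 < al / T) by (apply Rdiv_lt_0_compat; lra). nra. }
  rewrite RInt_const in H3. unfold scal in H3; simpl in H3; unfold mult in H3; simpl in H3.
  generalize (exp_pos (- al)). lra.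
Qed.

(** Cauchy's theorem, the horizontal sides being estimated trivially. *)
Lemma CInt_vertical_compare (f : C -> C) (x1 x2 p q M1 M2 : R) :
  x1 <= x2 -> p <= q -> (forall z, in_rect x1 x2 p q z -> hol f z) ->
  (forall x, x1 <= x <= x2 -> Cmod (f (x, p)) <= M1) ->
  (forall x, x1 <= x <= x2 -> Cmod (f (x, q)) <= M2) ->
  Cmod (CInt (fun y => f (x1, y)) p q - CInt (fun y => f (x2, y)) p q)%C <= (x2 - x1) * (M1 + M2).
Proof.
  intros Hx Hpq Hf H1 H2.
  assert (HC := Cauchy_rectangle f x1 x2 p q Hx Hpq Hf). unfold boundary_int in HC.
  set (I1 := CInt (fun y => f (x1, y)) p q) in *. set (I2 := CInt (fun y => f (x2, y)) p q) in *.
  set (J1 := CInt (fun x => f (x, p)) x1 x2) in *. set (J2 := CInt (fun x => f (x, q)) x1 x2) in *.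
  assert (E : (Ci * (I1 - I2) = J1 - J2)%C).
  { replace (J1 - J2)%C with (Ci * (I1 - I2) + (J1 + Ci * I2 - J2 - Ci * I1))%C by ring.
    rewrite HC. ring. }
  assert (B1 : Cmod J1 <= (x2 - x1) * M1).
  { apply Cmod_CInt_le_const; [assumption| |].
    - intros t Ht. apply contC_Ccont_h, hol_contC, Hf. split; simpl; lra.
    - intros t Ht. apply H1. lra. }
  assert (B2 : Cmod J2 <= (x2 - x1) * M2).
  { apply Cmod_CInt_le_const; [assumption| |].
    - intros t Ht. apply contC_Ccont_h, hol_contC, Hf. split; simpl; lra.
    - intros t Ht. apply H2. lra. }
  replace (Cmod (I1 - I2)%C) with (Cmod (Ci * (I1 - I2))%C) by (rewrite Cmod_mult, Cmod_Ci; ring).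
  rewrite E. unfold Cminus. apply Rle_trans with (1 := Cmod_triangle _ _). rewrite Cmod_opp. lra.
Qed.

Lemma ln_increment v : Rabs v <= 1 / 2 ->
  Rabs (ln (1 + v)) <= 2 * Rabs v /\ Rabs ((1 + v) * ln (1 + v) - v) <= 4 * (v * v).
Proof.
  intros Hv. assert (H := ln_1p_bound v Hv). set (l := ln (1 + v)) in *.
  assert (Evv : v * v = Rabs v * Rabs v) by (rewrite <- Rabs_mult; symmetry; apply Rabs_pos_eq; nra).
  assert (P := Rabs_pos v).
  assert (H1 : Rabs l <= 2 * Rabs v).
  { replace l with ((l - v) + v) by ring. apply Rle_trans with (1 := Rabs_triang _ _). nra. }
  split; [assumption|].
  replace ((1 + v) * l - v) with ((l - v) + v * l) by ring.
  apply Rle_trans with (1 := Rabs_triang _ _). rewrite (Rabs_mult v l). nra.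
Qed.

Lemma exp_half_le_2 : exp (1 / 2) <= 2.
Proof.
  assert (H : exp (1 / 2) * exp (1 / 2) = exp 1) by (rewrite <- exp_plus; f_equal; field).
  generalize exp_le_3 (exp_pos (1 / 2)). nra.
Qed.

(** The window is centred at the point where the phase of the integrand is
    stationary; [al] is so large compared with [d] that the quadratic part of
    the phase stays small over the effective width [sqrt (T / al)]. *)
Lemma window_main_term (d b sig : R) (A B : C) : 0 < d ->
  exists rho T0, 0 < rho <= 1 / 2 /\ 1 <= T0 /\ forall T, T0 <= T -> forall g : R -> C,
  let be := d * ln T + d - b in
  (forall y, T - rho * T <= y <= T + rho * T -> Ccont g y) ->
  (forall y, T - rho * T <= y <= T + rho * T -> exists e : C, Cmod e <= 1 / 4 /\
     g y = (Cexp (A + B * RtoC (ln y) + Ci * RtoC (b * y - d * (y * ln y))) * (RtoC 1 + e))%C) ->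
  exp (Re A + Re B * ln T + be * sig) * (gauss_mass (50 * d) rho T / 2)
  <= Cmod (CInt (fun y => g y * window (50 * d) be 0 T (sig, y))%C (T - rho * T) (T + rho * T)).
Proof.
  intros Hd. set (al := 50 * d).
  assert (Hal : 0 < al) by (unfold al; lra).
  assert (HB := Cmod_ge_0 B).
  set (rho := / (8 * (Cmod B + 1))).
  assert (Hrho0 : 0 < rho) by (apply Rinv_0_lt_compat; lra).
  assert (HrhoB : 8 * (rho * (Cmod B + 1)) = 1) by (unfold rho; field; lra).
  assert (Hrho : rho <= 1 / 8) by nra.
  set (K1 := 2 * Cmod B + 2 * al * Rabs sig).
  set (K2 := K1 * K1 / (4 * d) + al * (sig * sig)).
  assert (HK2 : 0 <= K2).
  { unfold K2. apply Rplus_le_le_0_compat; [|nra]. apply Rle_mult_inv_pos; [nra|lra]. }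
  set (T0 := Rmax 1 (Rmax (20 * K2) (4 * (al * (sig * sig))))).
  exists rho, T0. split; [lra|]. split; [apply Rmax_l|].
  intros T HT g be Hgc Hg.
  destruct (Rmax_le_inv _ _ _ HT) as [HT1 [HT2 HT3]%Rmax_le_inv].
  set (p := T - rho * T) in *. set (q := T + rho * T) in *.
  assert (Hpq : p <= q) by (unfold p, q; nra).
  set (G := gauss_mass al rho T).
  set (CT := (A + B * RtoC (ln T) + Ci * RtoC (b * T - d * (T * ln T)) + RtoC (be * sig))%C).
  set (F := fun y => (g y * window al be 0 T (sig, y))%C).
  assert (HFc : forall y, p <= y <= q -> Ccont F y).
  { intros y Hy. apply Ccont_mult; [auto|]. apply contC_Ccont_v, hol_contC, hol_window. }
  assert (Hgau : forall y, Ccont (fun y => RtoC (gauss al T y)) y).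
  { intros y. split; simpl; [apply continuous_gauss|apply continuous_const]. }
  (* after division by its value at the centre, the integrand is the Gaussian up
     to an error controlled by the second moment *)
  assert (Hpt : forall y, p <= y <= q ->
    Cmod (Cexp (- CT) * F y - RtoC (gauss al T y))%C
    <= (25 / 2) * d * ((y - T) * (y - T) / T * gauss al T y) + 3 / 8 * gauss al T y).
  { intros y Hy. destruct (Hg y Hy) as [e [He E]].
    set (u := y - T). set (v := u / T).
    assert (Huv : u = v * T) by (unfold v; field; lra).
    assert (Hv : Rabs v <= rho).
    { apply Rabs_le. unfold p, q in Hy. assert (- (rho * T) <= v * T <= rho * T) by (rewrite <- Huv; unfold u; lra).
      split; nra. }
    destruct (ln_increment v ltac:(lra)) as [Hl1 Hl2].
    set (l := ln (1 + v)) in *.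
    assert (Hy0 : y = T * (1 + v)) by (unfold u in Huv; lra).
    assert (Hlny : ln y = ln T + l).
    { rewrite Hy0. apply Rabs_le_between in Hv. apply ln_mult; lra. }
    set (h := (B * RtoC l - Ci * RtoC (d * ((T + u) * l - u)) + RtoC (al / T * (sig * sig))
              + Ci * RtoC (2 * (al / T) * sig * u))%C).
    assert (EF : (Cexp (- CT) * F y = RtoC (gauss al T y) * (Cexp h * (RtoC 1 + e)))%C).
    { unfold F. rewrite E. unfold gauss, window. rewrite <- Cexp_RtoC.
      replace (Cexp (- CT) * (Cexp (A + B * ln y + Ci * (b * y - d * (y * ln y))%R) * (RtoC 1 + e) *
        Cexp ((al / T)%R * (((sig, y) - (0, T)) * ((sig, y) - (0, T))) + be * ((sig, y) - (0, T)) + (- 0)%R * (sig, y))))%C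
      with ((Cexp (- CT) * Cexp (A + B * ln y + Ci * (b * y - d * (y * ln y))%R) *
        Cexp ((al / T)%R * (((sig, y) - (0, T)) * ((sig, y) - (0, T))) + be * ((sig, y) - (0, T)) + (- 0)%R * (sig, y))) * (RtoC 1 + e))%C by ring.
      rewrite (Cmult_assoc _ (Cexp h)), <- !Cexp_add. f_equal. f_equal.
      unfold CT, h. rewrite Hlny. unfold be, u.
      apply injective_projections; simpl; ring. }
    rewrite EF.
    replace (RtoC (gauss al T y) * (Cexp h * (RtoC 1 + e)) - RtoC (gauss al T y))%C
      with (RtoC (gauss al T y) * ((Cexp h - RtoC 1) * (RtoC 1 + e) + e))%C by ring.
    assert (Pg := gauss_pos al T y).
    rewrite Cmod_mult, Cmod_R, Rabs_pos_eq by lra.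
    assert (HaT : 0 < al / T) by (apply Rdiv_lt_0_compat; lra).
    assert (Hss : al / T * (sig * sig) <= 1 / 4).
    { apply Rmult_le_reg_r with T; [lra|]. replace (al / T * (sig * sig) * T) with (al * (sig * sig)) by (field; lra). lra. }
    assert (Hss0 : 0 <= al / T * (sig * sig)) by nra.
    assert (HReh : Re h <= 1 / 2).
    { unfold h. replace (Re _) with (Re B * l + al / T * (sig * sig)) by (unfold Re; simpl; ring).
      assert (Re B * l <= Cmod B * (2 * rho)).
      { apply Rle_trans with (Rabs (Re B * l)); [apply Rle_abs|]. rewrite Rabs_mult.
        apply Rmult_le_compat; try apply Rabs_pos; [apply re_le_Cmod|lra]. }
      nra. }
    assert (Hh : Cmod h <= 5 * d * (u * u / T) + K2 / T).
    { unfold h.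
      apply Rle_trans with (Cmod B * (2 * Rabs v) + d * (4 * (T * (v * v))) + al / T * (sig * sig) + 2 * al * Rabs sig * Rabs v).
      - eapply Rle_trans; [apply Cmod_triangle|]. apply Rplus_le_compat.
        + eapply Rle_trans; [apply Cmod_triangle|]. apply Rplus_le_compat.
          * unfold Cminus. eapply Rle_trans; [apply Cmod_triangle|]. apply Rplus_le_compat.
            -- rewrite Cmod_mult, Cmod_R. apply Rmult_le_compat_l; assumption.
            -- rewrite Cmod_opp, Cmod_mult, Cmod_Ci, Cmod_R, Rmult_1_l, Rabs_mult, (Rabs_pos_eq d) by lra.
               apply Rmult_le_compat_l; [lra|].
               replace ((T + u) * l - u) with (T * ((1 + v) * l - v)) by (rewrite Huv; ring).
               rewrite Rabs_mult, (Rabs_pos_eq T) by lra.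
               replace (4 * (T * (v * v))) with (T * (4 * (v * v))) by ring.
               apply Rmult_le_compat_l; lra.
          * rewrite Cmod_R, Rabs_pos_eq by lra. lra.
        + rewrite Cmod_mult, Cmod_Ci, Cmod_R, Rmult_1_l.
          replace (2 * (al / T) * sig * u) with (2 * al * (sig * v)) by (rewrite Huv; field; lra).
          rewrite Rabs_mult, (Rabs_pos_eq (2 * al)), Rabs_mult by lra. lra.
      - assert (Evv : v * v = Rabs v * Rabs v) by (rewrite <- Rabs_mult; symmetry; apply Rabs_pos_eq; nra).
        set (w := Rabs v) in *.
        replace (5 * d * (u * u / T) + K2 / T) with (5 * d * (T * (v * v)) + K1 * K1 / (4 * d) / T + al / T * (sig * sig))
          by (unfold K2; rewrite Huv; field; lra).
        rewrite Evv.
        assert (HAG : K1 * w <= d * (T * (w * w)) + K1 * K1 / (4 * d) / T).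
        { replace (d * (T * (w * w)) + K1 * K1 / (4 * d) / T) with
            (K1 * w + (2 * d * T * w - K1) * (2 * d * T * w - K1) / (4 * d * T)) by (field; lra).
          assert (0 <= (2 * d * T * w - K1) * (2 * d * T * w - K1) / (4 * d * T)).
          { apply Rle_mult_inv_pos; [apply Rle_0_sqr|nra]. } lra. }
        unfold K1 at 1 in HAG. lra. }
    assert (Hexp : Cmod (Cexp h - RtoC 1)%C <= 2 * Cmod h).
    { apply Rle_trans with (1 := Cexp_sub_1_le h (1 / 2) HReh ltac:(lra)).
      generalize exp_half_le_2 (Cmod_ge_0 h). nra. }
    assert (H1e : Cmod (RtoC 1 + e)%C <= 5 / 4).
    { apply Rle_trans with (1 := Cmod_triangle _ _). rewrite Cmod_1. lra. }
    assert (HKT : K2 / T <= 1 / 20).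
    { apply Rmult_le_reg_r with T; [lra|]. unfold Rdiv at 1. rewrite Rmult_assoc, Rinv_l by lra. lra. }
    assert (Hfin : Cmod ((Cexp h - RtoC 1) * (RtoC 1 + e) + e)%C <= 25 / 2 * d * (u * u / T) + 3 / 8).
    { apply Rle_trans with (1 := Cmod_triangle _ _). rewrite Cmod_mult.
      assert (Cmod (Cexp h - RtoC 1)%C * Cmod (RtoC 1 + e)%C <= (2 * Cmod h) * (5 / 4)).
      { apply Rmult_le_compat; try apply Cmod_ge_0; assumption. }
      lra. }
    apply Rle_trans with (gauss al T y * (25 / 2 * d * (u * u / T) + 3 / 8)); [apply Rmult_le_compat_l; lra|].
    right. ring. }
  assert (Hdiff : Cmod (Cexp (- CT) * CInt F p q - RtoC G)%C <= G / 2).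
  { unfold G, gauss_mass. fold p q. rewrite <- CInt_RtoC.
    rewrite <- CInt_scal by assumption.
    rewrite <- CInt_minus; [|assumption|intros; apply Ccont_mult; [apply Ccont_const|auto]|auto].
    set (m2 := fun y => (y - T) * (y - T) / T * gauss al T y).
    assert (Hm2 : forall y, continuous m2 y).
    { intros y. unfold m2, gauss. apply ex_derive_Rcontinuous. auto_derive. lra. }
    apply Rle_trans with (RInt (fun y => plus (scal (25 / 2 * d) (m2 y)) (scal (3 / 8) (gauss al T y))) p q).
    - apply Cmod_CInt_le; [assumption| | |].
      + intros t Ht. apply Ccont_minus; [apply Ccont_mult; [apply Ccont_const|auto]|auto].
      + apply (ex_RInt_plus (V := R_NormedModule)); apply ex_RInt_Rscal; apply ex_RInt_cont; [assumption|apply continuous_gauss].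
      + intros t Ht. apply Hpt. lra.
    - assert (ES : RInt (fun y => plus (scal (25 / 2 * d) (m2 y)) (scal (3 / 8) (gauss al T y))) p q
        = 25 / 2 * d * RInt m2 p q + 3 / 8 * RInt (gauss al T) p q).
      { assert (X1 : ex_RInt m2 p q) by (now apply ex_RInt_cont).
        assert (X2 : ex_RInt (gauss al T) p q) by (apply ex_RInt_cont, continuous_gauss).
        rewrite RInt_Rplus by (apply ex_RInt_Rscal; assumption).
        rewrite !RInt_Rscal by assumption. reflexivity. }
      rewrite ES.
      assert (Hsm := gauss_second_moment al rho T Hal Hrho0 ltac:(lra)). fold m2 p q in Hsm.
      unfold gauss_mass in Hsm. fold p q in Hsm. set (GG := RInt (gauss al T) p q) in *.
      replace (GG / (2 * al)) with (GG / (100 * d)) in Hsm by (unfold al; field; lra).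
      assert (25 / 2 * d * RInt m2 p q <= 25 / 2 * d * (GG / (100 * d))) by (apply Rmult_le_compat_l; lra).
      replace (25 / 2 * d * (GG / (100 * d))) with (GG / 8) in H by (field; lra). lra. }
  assert (HG0 : 0 <= G).
  { unfold G, gauss_mass. fold p q. apply RInt_ge_0; [assumption|apply ex_RInt_cont, continuous_gauss|]. intros; left; apply gauss_pos. }
  assert (Hlow : G / 2 <= Cmod (Cexp (- CT) * CInt F p q)%C).
  { assert (G <= Cmod (Cexp (- CT) * CInt F p q)%C + Cmod (Cexp (- CT) * CInt F p q - RtoC G)%C).
    { replace G with (Cmod (RtoC G)) at 1 by (rewrite Cmod_R; now apply Rabs_pos_eq).
      replace (RtoC G) with (Cexp (- CT) * CInt F p q + - (Cexp (- CT) * CInt F p q - RtoC G))%C at 1 by ring.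
      apply Rle_trans with (1 := Cmod_triangle _ _). rewrite Cmod_opp. lra. }
    lra. }
  rewrite Cmod_mult, Cmod_Cexp in Hlow.
  assert (ER : Re (- CT)%C = - (Re A + Re B * ln T + be * sig)).
  { unfold CT, Re; simpl. ring. }
  rewrite ER, exp_Ropp in Hlow. fold F.
  set (X := exp (Re A + Re B * ln T + be * sig)) in *.
  assert (HX : 0 < X) by apply exp_pos.
  apply Rmult_le_reg_l with (/ X); [now apply Rinv_0_lt_compat|].
  rewrite <- Rmult_assoc, Rinv_l, Rmult_1_l by lra. exact Hlow.
Qed.

(** * Sums and series *)

Fixpoint Rsum (f : nat -> R) (n : nat) : R :=
  match n with O => 0 | S n => Rsum f n + f n end.

Lemma Rsum_le f g n : (forall k, (k < n)%nat -> f k <= g k) -> Rsum f n <= Rsum g n.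
Proof.
  induction n as [|n IH]; intros H; simpl; [lra|].
  apply Rplus_le_compat; [apply IH; intros; apply H; lia|apply H; lia].
Qed.

Lemma Rsum_scal c f n : Rsum (fun k => c * f k) n = c * Rsum f n.
Proof. induction n as [|n IH]; simpl; [ring|rewrite IH; ring]. Qed.

Lemma Rsum_plus f g n : Rsum (fun k => f k + g k) n = Rsum f n + Rsum g n.
Proof. induction n as [|n IH]; simpl; [ring|rewrite IH; ring]. Qed.

Lemma Rsum_ext f g n : (forall k, f k = g k) -> Rsum f n = Rsum g n.
Proof. intros H. induction n as [|n IH]; simpl; [reflexivity|now rewrite IH, H]. Qed.

Lemma Rsum_incr f n m : (forall k, 0 <= f k) -> (n <= m)%nat -> Rsum f n <= Rsum f m.
Proof. intros Hf H. induction H as [|m H IH]; simpl; [lra|]. generalize (Hf m). lra. Qed.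

Lemma Rsum_le_lim f n (S : R) : (forall k, 0 <= f k) -> is_lim_seq (Rsum f) S -> Rsum f n <= S.
Proof.
  intros Hf H. apply (is_lim_seq_incr_compare _ _ H).
  intros k. apply Rsum_incr; [assumption|lia].
Qed.

Lemma Cmod_Csum_le f n : Cmod (Csum f n) <= Rsum (fun k => Cmod (f k)) n.
Proof.
  induction n as [|n IH]; simpl; [rewrite Cmod_0; lra|].
  apply Rle_trans with (1 := Cmod_triangle _ _). lra.
Qed.

Lemma Ccont_Csum (g : nat -> R -> C) n y :
  (forall k, Ccont (g k) y) -> Ccont (fun y => Csum (fun k => g k y) n) y.
Proof.
  intros Hg. induction n as [|n IH]; simpl; [apply Ccont_const|]. now apply Ccont_plus.
Qed.

Lemma CInt_Csum (k : nat -> C) (g : nat -> R -> C) n a b : a <= b ->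
  (forall j y, Ccont (g j) y) ->
  CInt (fun y => Csum (fun j => k j * g j y)%C n) a b = Csum (fun j => k j * CInt (g j) a b)%C n.
Proof.
  intros Hab Hg. induction n as [|n IH]; simpl.
  - unfold CInt, RtoC; simpl. rewrite RInt_const. unfold scal; simpl; unfold mult; simpl. f_equal; ring.
  - rewrite CInt_plus, IH; [|assumption| |].
    + f_equal. apply CInt_scal; auto.
    + intros y _. apply Ccont_Csum. intros j. apply Ccont_mult; [apply Ccont_const|auto].
    + intros y _. apply Ccont_mult; [apply Ccont_const|auto].
Qed.

Definition Cseries (u : nat -> C) (l : C) : Prop :=
  forall eps, 0 < eps -> exists N, forall n, (N <= n)%nat -> Cmod (Csum u n - l)%C < eps.

Lemma Cseries_tail u l v (S : R) : Cseries u l -> (forall n, Cmod (u n) <= v n) ->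
  is_lim_seq (Rsum v) S -> forall N, Cmod (l - Csum u N)%C <= S - Rsum v N.
Proof.
  intros Hu Huv Hv N. apply Rnot_lt_le. intros Hlt.
  destruct (Hu (Cmod (l - Csum u N)%C - (S - Rsum v N)) ltac:(lra)) as [N1 H1].
  set (n := Nat.max N N1). specialize (H1 n ltac:(lia)).
  assert (Hv0 : forall k, 0 <= v k) by (intros k; apply Rle_trans with (2 := Huv k), Cmod_ge_0).
  assert (H2 : Cmod (Csum u n - Csum u N)%C <= Rsum v n - Rsum v N).
  { assert (HNn : (N <= n)%nat) by lia. clearbody n. clear H1. induction HNn as [|n HNn IH].
    - replace (Csum u N - Csum u N)%C with (RtoC 0) by ring. rewrite Cmod_0. lra.
    - simpl. replace (Csum u n + u n - Csum u N)%C with ((Csum u n - Csum u N) + u n)%C by ring.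
      apply Rle_trans with (1 := Cmod_triangle _ _). specialize (Huv n). lra. }
  assert (H3 := Rsum_le_lim v n S Hv0 Hv).
  assert (H4 : Cmod (l - Csum u N)%C <= Cmod (Csum u n - l)%C + Cmod (Csum u n - Csum u N)%C).
  { replace (l - Csum u N)%C with (- (Csum u n - l) + (Csum u n - Csum u N))%C by ring.
    apply Rle_trans with (1 := Cmod_triangle _ _). rewrite Cmod_opp. lra. }
  lra.
Qed.

(** * The lower bound in short windows *)

Lemma CInt_window_vertical (al be L T rho sig : R) : 0 <= rho -> 0 < T ->
  Cmod (CInt (fun y => window al be L T (sig, y)) (T - rho * T) (T + rho * T))
  <= exp (al / T * (sig * sig) + (be - L) * sig) * gauss_mass al rho T.
Proof.
  intros Hrho HT.
  assert (E : RInt (fun y => scal (exp (al / T * (sig * sig) + (be - L) * sig)) (gauss al T y)) (T - rho * T) (T + rho * T)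
    = exp (al / T * (sig * sig) + (be - L) * sig) * gauss_mass al rho T).
  { apply RInt_Rscal, ex_RInt_cont, continuous_gauss. }
  rewrite <- E. apply Cmod_CInt_le.
  - nra.
  - intros t _. apply contC_Ccont_v, hol_contC, hol_window.
  - apply ex_RInt_Rscal, ex_RInt_cont, continuous_gauss.
  - intros t _. rewrite Cmod_window. unfold gauss, scal; simpl; unfold mult; simpl.
    rewrite <- exp_plus. right. f_equal. ring.
Qed.

(** Shifting the line of integration to [+- sqrt T], the sign being that of
    [L - be], costs a bounded factor in the Gaussian and gains an exponential
    in the distance between [L] and [be]. *)
Lemma window_coef_le (al be L T rho c : R) :
  0 < al -> 0 < rho -> 1 <= T -> 0 <= c <= sqrt T ->
  Cmod (CInt (fun y => window al be L T (c, y)) (T - rho * T) (T + rho * T))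
  <= exp al * gauss_mass al rho T * exp (- (sqrt T * Rabs (L - be)))
     + 4 * sqrt T * exp (al - al * (rho * rho) * T + be * c) * exp (- c * L).
Proof.
  intros Hal Hrho HT Hc.
  set (p := T - rho * T). set (q := T + rho * T).
  assert (Hpq : p <= q) by (unfold p, q; nra).
  assert (HsT : sqrt T * sqrt T = T) by (apply sqrt_sqrt; lra).
  set (r := sqrt T) in *.
  set (J := fun sig => CInt (fun y => window al be L T (sig, y)) p q).
  set (H := exp (al - al * (rho * rho) * T + be * c) * exp (- c * L)).
  assert (HH : 0 < H) by (apply Rmult_lt_0_compat; apply exp_pos).
  assert (HaT : 0 < al / T) by (apply Rdiv_lt_0_compat; lra).
  assert (HaTT : al / T * T = al) by (field; lra).
  assert (Hhor : forall x y, Rabs x <= r -> (y - T) * (y - T) = rho * T * (rho * T) ->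
     (be - L) * x <= (be - L) * c -> Cmod (window al be L T (x, y)) <= H).
  { intros x y Hx Hy Hb. rewrite Cmod_window, Hy. unfold H. rewrite <- exp_plus. apply exp_le_exp.
    assert (x * x <= T).
    { rewrite <- HsT. replace (x * x) with (Rabs x * Rabs x) by (rewrite <- Rabs_mult; apply Rabs_pos_eq; nra).
      generalize (Rabs_pos x). nra. }
    assert (al / T * (x * x) <= al / T * T) by (apply Rmult_le_compat_l; lra).
    replace (al / T * (rho * T * (rho * T))) with (al * (rho * rho) * T) by (field; lra). lra. }
  assert (Hver : forall x, x * x = T -> (be - L) * x = - (r * Rabs (L - be)) ->
     Cmod (J x) <= exp al * gauss_mass al rho T * exp (- (r * Rabs (L - be)))).
  { intros x Hx Hb. apply Rle_trans with (1 := CInt_window_vertical al be L T rho x ltac:(lra) ltac:(lra)).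
    rewrite Hx, HaTT, Hb, exp_plus. right. ring. }
  assert (Htri : forall u v : C, Cmod u <= Cmod v + Cmod (u - v)%C).
  { intros u v. replace u with (v + (u - v))%C at 1 by ring. apply Cmod_triangle. }
  assert (Hp : (p - T) * (p - T) = rho * T * (rho * T)) by (unfold p; ring).
  assert (Hq : (q - T) * (q - T) = rho * T * (rho * T)) by (unfold q; ring).
  fold (J c). replace (4 * r * exp (al - al * (rho * rho) * T + be * c) * exp (- c * L)) with (4 * r * H) by (unfold H; ring).
  destruct (Rle_lt_dec be L) as [HL|HL].
  - apply Rle_trans with (1 := Htri (J c) (J r)). apply Rplus_le_compat.
    + apply Hver; [assumption|]. rewrite Rabs_pos_eq by lra. ring.
    + apply Rle_trans with ((r - c) * (H + H)); [|nra].
      apply (CInt_vertical_compare (window al be L T) c r p q H H); try lra.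
      * intros; apply hol_window.
      * intros x Hx. apply Hhor; [rewrite Rabs_pos_eq; lra|assumption|nra].
      * intros x Hx. apply Hhor; [rewrite Rabs_pos_eq; lra|assumption|nra].
  - apply Rle_trans with (1 := Htri (J c) (J (- r)%R)). apply Rplus_le_compat.
    + apply Hver; [lra|]. rewrite Rabs_left by lra. ring.
    + replace (Cmod (J c - J (- r)%R)%C) with (Cmod (J (- r)%R - J c)%C)
        by (rewrite <- Cmod_opp; f_equal; ring).
      apply Rle_trans with ((c - - r) * (H + H)); [|nra].
      apply (CInt_vertical_compare (window al be L T) (- r) c p q H H); try lra.
      * intros; apply hol_window.
      * intros x Hx. apply Hhor; [apply Rabs_le; lra|assumption|nra].
      * intros x Hx. apply Hhor; [apply Rabs_le; lra|assumption|nra].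
Qed.

Definition for_large (P : R -> Prop) : Prop := exists T0, forall T, T0 <= T -> P T.

Lemma for_large_and P Q : for_large P -> for_large Q -> for_large (fun T => P T /\ Q T).
Proof.
  intros [T0 H0] [T1 H1]. exists (Rmax T0 T1). intros T HT. split.
  - apply H0. apply Rle_trans with (2 := HT), Rmax_l.
  - apply H1. apply Rle_trans with (2 := HT), Rmax_r.
Qed.

Lemma for_large_ge x : for_large (fun T => x <= T).
Proof. exists x. auto. Qed.

Lemma for_large_log_le (C0 p k : R) : 0 < k -> for_large (fun T => C0 + p * ln T <= k * T).
Proof.
  intros Hk. exists (Rmax 1 (Rmax ((4 * Rabs p / k) * (4 * Rabs p / k)) (2 * C0 / k))). intros T HT.
  destruct (Rmax_le_inv _ _ _ HT) as [HT1 [HT2 HT3]%Rmax_le_inv].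
  assert (HsT : sqrt T * sqrt T = T) by (apply sqrt_sqrt; lra).
  assert (Hs0 : 0 < sqrt T) by (apply sqrt_lt_R0; lra).
  set (r := sqrt T) in *.
  assert (Hln : 0 <= ln T <= 2 * r).
  { split; [rewrite <- ln_1; apply ln_le; lra|]. rewrite <- HsT, ln_mult by assumption.
    generalize (ln_le_sub_1 r Hs0). lra. }
  assert (Hp := Rabs_pos p).
  assert (Hr : 4 * Rabs p / k <= r).
  { assert (0 <= 4 * Rabs p / k) by (apply Rle_mult_inv_pos; lra). rewrite <- HsT in HT2. nra. }
  assert (Hr' : 4 * Rabs p <= k * r).
  { replace (4 * Rabs p) with (k * (4 * Rabs p / k)) by (field; lra). nra. }
  assert (HC : 2 * C0 <= k * T).
  { replace (2 * C0) with (k * (2 * C0 / k)) by (field; lra). nra. }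
  assert (p * ln T <= Rabs p * (2 * r)).
  { apply Rle_trans with (Rabs (p * ln T)); [apply Rle_abs|]. rewrite Rabs_mult, (Rabs_pos_eq (ln T)) by lra.
    apply Rmult_le_compat_l; lra. }
  nra.
Qed.

Lemma for_large_log_ge (C0 k : R) : 0 < k -> for_large (fun T => C0 <= k * ln T).
Proof.
  intros Hk. exists (exp (C0 / k)). intros T HT.
  assert (C0 / k <= ln T).
  { rewrite <- (ln_exp (C0 / k)). apply ln_le; [apply exp_pos|assumption]. }
  replace C0 with (k * (C0 / k)) by (field; lra). nra.
Qed.

Lemma le_exp x : x <= exp x.
Proof. generalize (exp_ineq1_le x). lra. Qed.

(** The values of [f] on [Re s = 1 - c] oscillate exactly like the window, so they
    cannot cancel; on [Re s = c] they are a Dirichlet series.  Comparing the two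
    integrals transfers the size of [f] on the left to the coefficients.  Besides
    the main terms there are three errors, each at most 1 for large [T]: the
    horizontal sides for [f], those for the single terms of the series, and the
    tail of the series beyond [N]. *)
Theorem window_lower_bound (d b c M K t1 S : R) (A B : C) (f : C -> C) (cf : nat -> C) (L : nat -> R) :
  0 < d -> 1 <= c -> Re B = d * (c - 1 / 2) ->
  (forall s, t1 <= Im s -> hol f s) ->
  (forall s, 1 - c <= Re s <= c -> t1 <= Im s -> Cmod (f s) <= K * Rpower (1 + Rabs (Im s)) M) ->
  (forall t, t1 <= t -> Cseries (fun n => cf n * Cexp (RtoC (- L n) * (c, t)))%C (f (c, t))) ->
  (forall t, t1 <= t -> exists e : C, Cmod e <= 1 / 4 /\
     f ((1 - c)%R, t) = (Cexp (A + B * RtoC (ln t) + Ci * RtoC (b * t - d * (t * ln t))) * (RtoC 1 + e))%C) ->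
  is_lim_seq (Rsum (fun n => Cmod (cf n) * exp (- c * L n))) S ->
  exists kappa T1, 0 < kappa /\ forall T, T1 <= T -> exists N,
    kappa * exp (d / 2 * ln T) <=
    Rsum (fun n => Cmod (cf n) * exp (- (sqrt T * Rabs (L n - (d * ln T + (d - b)))))) N.
Proof.
  intros Hd Hc HB Hhol Hgrow Hser Hasy HS.
  set (sig := 1 - c).
  destruct (window_main_term d b sig A B Hd) as [rho [T0 [Hrho [HT0 Hmain]]]].
  set (al := 50 * d) in *. assert (Hal : 0 < al) by (unfold al; lra).
  set (v := fun n => Cmod (cf n) * exp (- c * L n)) in *.
  assert (Hv0 : forall n, 0 <= v n).
  { intros n. apply Rmult_le_pos; [apply Cmod_ge_0|left; apply exp_pos]. }
  assert (HS0 : 0 <= S) by (apply (Rsum_le_lim v 0 S Hv0 HS)).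
  set (k0 := Re A + (d - b) * (1 - c)).
  exists (exp (k0 - al) / 4).
  assert (Hk : 0 < al * (rho * rho)) by (repeat apply Rmult_lt_0_compat; lra).
  assert (EV : for_large (fun T => ((T0 <= T /\ 2 * t1 <= T) /\ (1 <= rho * T /\ c * c <= T)) /\
    (4 * c * Rabs K + Rabs M * ln 3 + al * (c * c) + c * Rabs (d - b) + (Rabs M + c * d) * ln T <= al * (rho * rho) * T
     /\ 4 + S + al + (d - b) * c + (1 + d * c) * ln T <= al * (rho * rho) * T) /\
    12 - k0 + al <= d / 2 * ln T)).
  { apply for_large_and; [|apply for_large_and].
    - apply for_large_and; apply for_large_and; try apply for_large_ge.
      exists (/ rho). intros T HT. apply Rmult_le_reg_l with (/ rho); [apply Rinv_0_lt_compat; lra|].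
      rewrite <- Rmult_assoc, Rinv_l, Rmult_1_l, Rmult_1_r by lra. assumption.
    - apply for_large_and; apply for_large_log_le; assumption.
    - apply for_large_log_ge. lra. }
  destruct EV as [T1 EV]. exists T1.
  split; [apply Rdiv_lt_0_compat; [apply exp_pos|lra]|].
  intros T HT. destruct (EV T HT) as [[[E1 E2] [E3 E4]] [[E5 E6] E7]].
  assert (HT1 : 1 <= T) by lra.
  assert (HlnT : 0 <= ln T) by (rewrite <- ln_1; apply ln_le; lra).
  set (be := d * ln T + (d - b)).
  set (p := T - rho * T). set (q := T + rho * T).
  assert (Hp : t1 <= p /\ 1 / 2 <= p) by (unfold p; split; nra).
  assert (Hq : q <= 2 * T) by (unfold q; nra).
  assert (Hpq : p <= q) by (unfold p, q; nra).
  set (G := gauss_mass al rho T).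
  assert (HG : exp (- al) <= G) by (apply gauss_mass_lower; lra).
  assert (HG0 : 0 < G) by (apply Rlt_le_trans with (2 := HG), exp_pos).
  set (X := exp (k0 + d / 2 * ln T)).
  set (F := fun s => (f s * window al be 0 T s)%C).
  assert (HFhol : forall s, p <= Im s -> hol F s).
  { intros s Hs. apply hol_mult; [apply Hhol; lra|apply hol_window]. }
  (* on the left line the phases of [f] and of the window match *)
  assert (HL : X * (G / 2) <= Cmod (CInt (fun y => F (sig, y)) p q)).
  { assert (Ebe : be = d * ln T + d - b) by (unfold be; ring).
    unfold F. rewrite Ebe.
    replace X with (exp (Re A + Re B * ln T + (d * ln T + d - b) * sig))
      by (unfold X, k0, sig; f_equal; rewrite HB; field).
    apply (Hmain T E1 (fun y => f (sig, y))).
    - intros y Hy. apply contC_Ccont_v, hol_contC, Hhol. simpl. fold p in Hy. lra.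
    - intros y Hy. apply Hasy. fold p in Hy. lra. }
  assert (HaT : 0 < al / T) by (apply Rdiv_lt_0_compat; lra).
  assert (HaT1 : al / T <= al).
  { apply Rmult_le_reg_r with T; [lra|]. unfold Rdiv. rewrite Rmult_assoc, Rinv_l by lra. nra. }
  (* on the horizontal sides the Gaussian beats the polynomial growth of [f] *)
  assert (HLR : Cmod (CInt (fun y => F (sig, y)) p q - CInt (fun y => F (c, y)) p q)%C <= 1).
  { set (H := Rabs K * exp (Rabs M * ln 3 + al * (c * c) + c * Rabs (d - b) + (Rabs M + c * d) * ln T - al * (rho * rho) * T)).
    assert (HH : forall x y, sig <= x <= c -> p <= y <= q -> (y - T) * (y - T) = rho * T * (rho * T) -> Cmod (F (x, y)) <= H).
    { intros x y Hx Hy HyT. unfold F. rewrite Cmod_mult, Cmod_window, HyT.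
      assert (Hf : Cmod (f (x, y)) <= Rabs K * exp (Rabs M * (ln 3 + ln T))).
      { apply Rle_trans with (1 := Hgrow (x, y) Hx ltac:(simpl; lra)). simpl Im.
        rewrite (Rabs_pos_eq y) by lra.
        apply Rle_trans with (Rabs K * Rpower (1 + y) M).
        - apply Rmult_le_compat_r; [left; apply exp_pos|apply Rle_abs].
        - apply Rmult_le_compat_l; [apply Rabs_pos|]. unfold Rpower. apply exp_le_exp.
          assert (0 <= ln (1 + y)) by (rewrite <- ln_1; apply ln_le; lra).
          assert (ln (1 + y) <= ln 3 + ln T) by (rewrite <- ln_mult by lra; apply ln_le; lra).
          generalize (Rle_abs M) (Rabs_pos M). nra. }
      unfold H.
      replace (exp (Rabs M * ln 3 + al * (c * c) + c * Rabs (d - b) + (Rabs M + c * d) * ln T - al * (rho * rho) * T))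
        with (exp (Rabs M * (ln 3 + ln T)) * exp (al * (c * c) + c * Rabs (d - b) + c * d * ln T - al * (rho * rho) * T))
        by (rewrite <- exp_plus; f_equal; ring).
      rewrite <- (Rmult_assoc (Rabs K)). apply Rmult_le_compat; [apply Cmod_ge_0|left; apply exp_pos|assumption|].
      apply exp_le_exp.
      replace (al / T * (rho * T * (rho * T))) with (al * (rho * rho) * T) by (field; lra).
      assert (Hxc : Rabs x <= c) by (apply Rabs_le; unfold sig in Hx; lra).
      assert (x * x <= c * c).
      { replace (x * x) with (Rabs x * Rabs x) by (rewrite <- Rabs_mult; apply Rabs_pos_eq; nra).
        generalize (Rabs_pos x). nra. }
      assert (al / T * (x * x) <= al * (c * c)) by (apply Rmult_le_compat; try apply Rle_0_sqr; lra).
      assert (d * ln T * x <= c * d * ln T).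
      { replace (c * d * ln T) with (d * ln T * c) by ring.
        apply Rmult_le_compat_l; [apply Rmult_le_pos|]; lra. }
      assert ((d - b) * x <= c * Rabs (d - b)).
      { apply Rle_trans with (Rabs ((d - b) * x)); [apply Rle_abs|]. rewrite Rabs_mult.
        rewrite Rmult_comm. apply Rmult_le_compat_r; [apply Rabs_pos|assumption]. }
      unfold be. lra. }
    apply Rle_trans with ((c - sig) * (H + H)).
    - apply (CInt_vertical_compare F sig c p q H H); [unfold sig; lra|assumption| | |].
      + intros z [_ Hz]. apply HFhol. lra.
      + intros x Hx. apply HH; [assumption|lra|unfold p; ring].
      + intros x Hx. apply HH; [assumption|lra|unfold q; ring].
    - assert (HKe : 4 * c * Rabs K <= exp (4 * c * Rabs K)) by apply le_exp.
      assert (HH0 : 4 * c * H <= 1).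
      { unfold H. rewrite <- Rmult_assoc.
        apply Rle_trans with (exp (4 * c * Rabs K) * exp (Rabs M * ln 3 + al * (c * c) + c * Rabs (d - b) + (Rabs M + c * d) * ln T - al * (rho * rho) * T)).
        - apply Rmult_le_compat_r; [left; apply exp_pos|assumption].
        - rewrite <- exp_plus, <- exp_0. apply exp_le_exp. lra. }
      assert (0 <= H) by (apply Rmult_le_pos; [apply Rabs_pos|left; apply exp_pos]).
      unfold sig. nra. }
  (* [W] bounds the window on the right line, so that this choice of [N] makes the
     tail of the series contribute at most 1 *)
  set (W := exp (al / T * (c * c) + be * c)).
  assert (HW : 0 < W) by apply exp_pos.
  assert (Heps : 0 < / (2 * rho * T * W)) by (apply Rinv_0_lt_compat; repeat apply Rmult_lt_0_compat; lra).
  assert (HN : exists N, S - Rsum v N <= / (2 * rho * T * W)).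
  { apply is_lim_seq_spec in HS. destruct (HS (mkposreal _ Heps)) as [N HN]. exists N.
    specialize (HN N (Nat.le_refl N)). simpl in HN. apply Rabs_lt_between in HN. lra. }
  destruct HN as [N HN]. exists N.
  set (Sig := Rsum (fun n => Cmod (cf n) * exp (- (sqrt T * Rabs (L n - be)))) N).
  assert (HR : Cmod (CInt (fun y => F (c, y)) p q) <= exp al * G * Sig + 2).
  { set (P := fun y => Csum (fun n => cf n * window al be (L n) T (c, y))%C N).
    assert (Hwc : forall j y, Ccont (fun y => window al be (L j) T (c, y)) y).
    { intros j y. apply contC_Ccont_v, hol_contC, hol_window. }
    assert (HPc : forall y, Ccont P y).
    { intros y. apply Ccont_Csum. intros j. apply Ccont_mult; [apply Ccont_const|apply Hwc]. }
    assert (HFc : forall y, p <= y <= q -> Ccont (fun y => F (c, y)) y).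
    { intros y Hy. apply contC_Ccont_v, hol_contC, HFhol. simpl; lra. }
    assert (Etail : Cmod (CInt (fun y => F (c, y)) p q - CInt P p q)%C <= 1).
    { rewrite <- CInt_minus; [|assumption|assumption|auto].
      apply Rle_trans with ((q - p) * (/ (2 * rho * T * W) * W)).
      - apply Cmod_CInt_le_const; [assumption|intros; apply Ccont_minus; auto|].
        intros y Hy.
        assert (EP : P y = (Csum (fun n => cf n * Cexp (RtoC (- L n) * (c, y)))%C N * window al be 0 T (c, y))%C).
        { unfold P. generalize N. intros n. induction n as [|n IH]; simpl; [ring|].
          rewrite IH. rewrite Cmult_plus_distr_r. f_equal. rewrite <- Cmult_assoc. f_equal.
          unfold window. rewrite <- Cexp_add. f_equal. rewrite Ropp_0. ring. }
        rewrite EP. unfold F.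
        set (w := window al be 0 T (c, y)). set (u := Csum (fun n => cf n * Cexp (RtoC (- L n) * (c, y)))%C N).
        replace (f (c, y) * w - u * w)%C with ((f (c, y) - u) * w)%C by ring.
        rewrite Cmod_mult. apply Rmult_le_compat; try apply Cmod_ge_0.
        + apply Rle_trans with (2 := HN). unfold u.
          apply Cseries_tail; [apply Hser; lra| |assumption].
          intros n. rewrite Cmod_mult, Cmod_Cexp. unfold v. right. f_equal. f_equal.
          unfold Re; simpl. ring.
        + unfold w. rewrite Cmod_window. unfold W. apply exp_le_exp.
          assert (0 <= al / T * ((y - T) * (y - T))) by (apply Rmult_le_pos; [lra|apply Rle_0_sqr]). lra.
      - right. unfold p, q. field. repeat split; lra. }
    assert (EPint : Cmod (CInt P p q) <= exp al * G * Sig + 1).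
    { unfold P. rewrite (CInt_Csum cf (fun j y => window al be (L j) T (c, y))) by auto.
      apply Rle_trans with (1 := Cmod_Csum_le _ _).
      set (Hh := 4 * sqrt T * exp (al - al * (rho * rho) * T + be * c)).
      assert (HsT : sqrt T * sqrt T = T) by (apply sqrt_sqrt; lra).
      assert (Hs0 := sqrt_pos T).
      apply Rle_trans with (Rsum (fun n => exp al * G * (Cmod (cf n) * exp (- (sqrt T * Rabs (L n - be)))) + Hh * v n) N).
      - apply Rsum_le. intros n _. rewrite Cmod_mult.
        apply Rle_trans with (Cmod (cf n) * (exp al * G * exp (- (sqrt T * Rabs (L n - be))) + Hh * exp (- c * L n))).
        + apply Rmult_le_compat_l; [apply Cmod_ge_0|].
          apply window_coef_le; try lra. split; [lra|]. nra.
        + right. unfold v. ring.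
      - rewrite Rsum_plus, !Rsum_scal. fold Sig. apply Rplus_le_compat_l.
        assert (HvS := Rsum_le_lim v N S Hv0 HS).
        assert (HHh : 0 <= Hh) by (unfold Hh; generalize (exp_pos (al - al * (rho * rho) * T + be * c)); nra).
        apply Rle_trans with (Hh * S); [apply Rmult_le_compat_l; assumption|].
        assert (H4 : 4 <= exp 4) by apply le_exp. assert (HSe : S <= exp S) by apply le_exp.
        assert (HsqT : sqrt T <= exp (ln T)) by (rewrite exp_ln by lra; nra).
        unfold Hh.
        apply Rle_trans with (exp 4 * exp (ln T) * exp (al - al * (rho * rho) * T + be * c) * exp S).
        + apply Rmult_le_compat; [|assumption| |assumption].
          * generalize (exp_pos (al - al * (rho * rho) * T + be * c)). nra.
          * apply Rmult_le_compat_r; [left; apply exp_pos|]. apply Rmult_le_compat; lra.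
        + rewrite <- !exp_plus, <- exp_0. apply exp_le_exp. unfold be. lra. }
    replace (CInt (fun y => F (c, y)) p q) with (CInt P p q + (CInt (fun y => F (c, y)) p q - CInt P p q))%C by ring.
    apply Rle_trans with (1 := Cmod_triangle _ _). lra. }
  assert (Hsum : X * (G / 2) <= exp al * G * Sig + 3).
  { apply Rle_trans with (1 := HL).
    replace (CInt (fun y => F (sig, y)) p q) with (CInt (fun y => F (c, y)) p q + (CInt (fun y => F (sig, y)) p q - CInt (fun y => F (c, y)) p q))%C by ring.
    apply Rle_trans with (1 := Cmod_triangle _ _). lra. }
  assert (HXG : 12 <= X * G).
  { apply Rle_trans with (X * exp (- al)); [|apply Rmult_le_compat_l; [left; apply exp_pos|assumption]].
    unfold X. rewrite <- exp_plus. generalize (exp_ineq1_le (k0 + d / 2 * ln T + - al)). lra. }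
  assert (HXS : X / 4 <= exp al * Sig).
  { apply Rmult_le_reg_r with G; [assumption|]. lra. }
  replace (exp (k0 - al) / 4 * exp (d / 2 * ln T)) with (exp (- al) * (X / 4)).
  2: { unfold X. rewrite exp_plus. unfold Rminus. rewrite exp_plus. field. }
  apply Rle_trans with (exp (- al) * (exp al * Sig)).
  - apply Rmult_le_compat_l; [left; apply exp_pos|assumption].
  - rewrite <- Rmult_assoc, <- exp_plus, Rplus_opp_l, exp_0, Rmult_1_l. apply Rle_refl.
Qed.

(** * Polynomials *)

Lemma sum_n_Csum (u : nat -> C) n : sum_n (G := C_AbelianMonoid) u n = Csum u (S n).
Proof.
  induction n as [|n IH].
  - rewrite sum_O. simpl. ring.
  - rewrite sum_Sn, IH. reflexivity.
Qed.

Lemma hol_polynomial (c : nat -> C) n z : hol (fun z => Csum (fun k => c k * z ^ k)%C n) z.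
Proof.
  induction n as [|n IH]; simpl; [apply hol_const|].
  apply hol_plus; [assumption|]. apply hol_mult; [apply hol_const|].
  clear IH. induction n as [|n IH]; simpl; [apply hol_const|].
  apply hol_mult; [apply hol_id|assumption].
Qed.

(** The extra factor [Cmod z] says that the terms below degree [n] are
    [O(|z|^(n-1))], without a special case for [n = 0]. *)
Lemma polynomial_upper (c : nat -> C) n : exists K, 0 <= K /\ forall z, 1 <= Cmod z ->
  Cmod z * Cmod (Csum (fun k => c k * z ^ k)%C n) <= K * Cmod z ^ n.
Proof.
  induction n as [|n [K [HK IH]]]; simpl.
  - exists 0. split; [lra|]. intros z _. rewrite Cmod_0. lra.
  - exists (K + Cmod (c n)). split; [generalize (Cmod_ge_0 (c n)); lra|].
    intros z Hz. specialize (IH z Hz).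
    assert (H := Cmod_triangle (Csum (fun k => c k * z ^ k)%C n) (c n * z ^ n)%C).
    rewrite Cmod_mult, Cmod_pow in H.
    assert (P : 0 <= Cmod z ^ n) by (apply pow_le; lra).
    assert (0 <= K * Cmod z ^ n) by (apply Rmult_le_pos; lra). nra.
Qed.

Lemma nonzero_polynomial_lower (P : C -> C) : nonzero_polynomial P ->
  (forall z, hol P z) /\ exists R0 k, 0 < k /\ forall z, R0 <= Cmod z -> k <= Cmod (P z).
Proof.
  intros [[n [c HP]] [z0 Hz0]].
  assert (HP' : forall z, P z = Csum (fun k => c k * z ^ k)%C (S n)) by (intros z; rewrite HP; apply sum_n_Csum).
  split.
  { intros z. apply hol_ext with (fun z => Csum (fun k => c k * z ^ k)%C (S n)); [intros; now rewrite HP'|].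
    apply hol_polynomial. }
  rewrite HP' in Hz0.
  assert (H : exists R0 k, 0 < k /\ forall z, R0 <= Cmod z -> k <= Cmod (Csum (fun k => c k * z ^ k)%C (S n))).
  { clear HP HP'. revert Hz0. generalize (S n). clear n. intros n. induction n as [|n IH]; intros Hz0.
    - now elim Hz0.
    - destruct (Ceq_dec (c n) (RtoC 0)) as [E|N].
      + simpl in Hz0. rewrite E in Hz0.
        destruct IH as [R0 [k [Hk IH]]].
        { intros H. apply Hz0. rewrite H. ring. }
        exists R0, k. split; [assumption|]. intros z Hz. simpl. rewrite E.
        replace (Csum (fun k0 => c k0 * z ^ k0) n + RtoC 0 * z ^ n)%C with (Csum (fun k0 => c k0 * z ^ k0)%C n) by ring.
        auto.
      + assert (Hc : 0 < Cmod (c n)) by (now apply Cmod_gt_0).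
        destruct (polynomial_upper c n) as [K [HK HU]].
        exists (Rmax 1 (2 * K / Cmod (c n))), (Cmod (c n) / 2). split; [lra|].
        intros z Hz.
        destruct (Rmax_le_inv _ _ _ Hz) as [H1 H2].
        assert (H3 : 2 * K <= Cmod (c n) * Cmod z).
        { replace (2 * K) with (Cmod (c n) * (2 * K / Cmod (c n))) by (field; lra). apply Rmult_le_compat_l; lra. }
        specialize (HU z H1). simpl.
        set (w := Csum (fun k => c k * z ^ k)%C n) in *.
        assert (H4 : Cmod (c n) * Cmod z ^ n <= Cmod (w + c n * z ^ n)%C + Cmod w).
        { rewrite <- Cmod_pow, <- Cmod_mult.
          replace (c n * z ^ n)%C with ((w + c n * z ^ n) + - w)%C at 1 by ring.
          apply Rle_trans with (1 := Cmod_triangle _ _). rewrite Cmod_opp. lra. }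
        assert (P1 : 1 <= Cmod z ^ n) by (apply pow_R1_Rle; assumption).
        set (Z := Cmod z ^ n) in *. set (x := Cmod z) in *. set (W := Cmod w) in *.
        apply Rmult_le_reg_l with x; [lra|].
        set (Y := Cmod (w + c n * z ^ n)%C) in *.
        assert (x * (Cmod (c n) * Z) <= x * (Y + W)) by (apply Rmult_le_compat_l; lra).
        assert (2 * K * Z <= Cmod (c n) * x * Z) by (apply Rmult_le_compat_r; lra).
        assert (Cmod (c n) * x <= Cmod (c n) * x * Z) by (assert (0 < Cmod (c n) * x) by (apply Rmult_lt_0_compat; lra); nra).
        lra. }
  destruct H as [R0 [k [Hk H]]]. exists R0, k. split; [assumption|]. intros z Hz. rewrite HP'. auto.
Qed.

(** * Dirichlet series *)

(** Index [n] stands for the integer [n + 1], as in [dirichlet_term]. *)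
Definition logn (n : nat) : R := ln (INR (S n)).

Lemma logn_ge_0 n : 0 <= logn n.
Proof.
  unfold logn. rewrite <- ln_1. apply ln_le; [lra|]. apply (le_INR 1). lia.
Qed.

Lemma logn_lt n m : (n < m)%nat -> logn n < logn m.
Proof.
  intros H. apply ln_increasing; [apply lt_0_INR; lia|]. apply lt_INR. lia.
Qed.

Lemma dirichlet_termE a s n : dirichlet_term a s n = (a (S n) * Cexp (RtoC (- logn n) * s))%C.
Proof.
  unfold dirichlet_term, Cpower, Cdiv. rewrite <- Cexp_opp. f_equal. f_equal.
  rewrite RtoC_opp. unfold logn. ring.
Qed.

Definition abs_term (a : nat -> C) (sig : R) (n : nat) : R := Cmod (a (S n)) * exp (- sig * logn n).

Lemma abs_term_ge_0 a sig n : 0 <= abs_term a sig n.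
Proof. apply Rmult_le_pos; [apply Cmod_ge_0|left; apply exp_pos]. Qed.

Lemma Cmod_dirichlet_term a s n : Cmod (dirichlet_term a s n) = abs_term a (Re s) n.
Proof.
  rewrite dirichlet_termE, Cmod_mult, Cmod_Cexp. unfold abs_term. do 2 f_equal.
  rewrite re_scal_l. ring.
Qed.

Lemma sum_n_Rsum (u : nat -> R) n : sum_n u n = Rsum u (S n).
Proof.
  induction n as [|n IH].
  - rewrite sum_O. simpl. ring.
  - rewrite sum_Sn, IH. reflexivity.
Qed.

Lemma is_series_Rsum (u : nat -> R) (l : R) : is_series u l -> is_lim_seq (Rsum u) l.
Proof.
  intros H. apply is_lim_seq_incr_1.
  apply is_lim_seq_ext with (sum_n u); [intros; apply sum_n_Rsum|exact H].
Qed.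

Lemma is_series_Cseries (u : nat -> C) (l : C) :
  is_series (K := C_AbsRing) (V := C_NormedModule) u l -> Cseries u l.
Proof.
  intros H eps Heps.
  assert (L : locally (T := C_UniformSpace) l (fun y => Cmod (y - l)%C < eps)).
  { apply locally_Cmod. exists eps. auto. }
  apply H in L. destruct L as [N HN]. exists (S N). intros n Hn.
  destruct n as [|n]; [lia|]. rewrite <- sum_n_Csum. apply HN. lia.
Qed.

(** If the series diverged at every point up to [sig], then [sig] would be a lower
    bound of the abscissas of convergence. *)
Lemma abs_conv (a : nat -> C) (sig : R) : Rbar_lt (abscissa_abs_conv a) sig ->
  ex_series (abs_term a sig).
Proof.
  intros Hs. unfold abscissa_abs_conv in Hs.
  set (E := fun sigma : R => ex_series (fun n => Cmod (dirichlet_term a (RtoC sigma) n))) in Hs.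
  destruct (Glb_Rbar_correct E) as [_ H2].
  assert (H : exists s0, s0 <= sig /\ E s0).
  { apply NNPP. intros N. apply (Rbar_lt_not_le _ _ Hs). apply H2. intros x Hx. simpl.
    destruct (Rle_lt_dec x sig) as [Hle|Hlt]; [elim N; now exists x|lra]. }
  destruct H as [s0 [Hle [l Hl]]].
  apply (ex_series_le (K := R_AbsRing) (V := R_CompleteNormedModule) _ (abs_term a s0)).
  - intros n. change (Rabs (abs_term a sig n) <= abs_term a s0 n). rewrite Rabs_pos_eq by apply abs_term_ge_0.
    apply Rmult_le_compat_l; [apply Cmod_ge_0|]. apply exp_le_exp. generalize (logn_ge_0 n). nra.
  - exists l. apply is_series_ext with (2 := Hl). intros n. now rewrite Cmod_dirichlet_term.
Qed.

(** If all coefficients vanished, the series would converge everywhere and its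
    abscissa would be minus infinity. *)
Lemma first_coefficient (a : nat -> C) : is_finite (abscissa_abs_conv a) ->
  exists m, a (S m) <> RtoC 0 /\ forall k, (k < m)%nat -> a (S k) = RtoC 0.
Proof.
  intros Hfin.
  assert (Hex : exists n, a (S n) <> RtoC 0).
  { apply NNPP. intros N.
    assert (H0 : forall n, a (S n) = RtoC 0).
    { intros n. apply NNPP. intros Hn. apply N. now exists n. }
    unfold abscissa_abs_conv in Hfin.
    set (E := fun sigma : R => ex_series (fun n => Cmod (dirichlet_term a (RtoC sigma) n))) in Hfin.
    destruct (Glb_Rbar_correct E) as [H1 _].
    rewrite <- Hfin in H1. set (g := real (Glb_Rbar E)) in H1.
    assert (HE : E (g - 1)).
    { exists 0. apply is_series_ext with (fun _ => 0).
      - intros n. rewrite Cmod_dirichlet_term. unfold abs_term. rewrite H0, Cmod_0. Rring.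
      - change (is_lim_seq (sum_n (fun _ : nat => 0)) 0).
        apply (is_lim_seq_ext (fun _ => 0)); [|apply is_lim_seq_const].
        intros n. induction n as [|n IH]; [now rewrite sum_O|]. rewrite sum_Sn, <- IH. unfold plus; simpl; Rring. }
    specialize (H1 _ HE). simpl in H1. lra. }
  destruct Hex as [n Hn]. revert Hn. induction n as [n IH] using (well_founded_induction Wf_nat.lt_wf). intros Hn.
  destruct (classic (exists k, (k < n)%nat /\ a (S k) <> RtoC 0)) as [[k [Hk Hak]]|N].
  - now apply (IH k).
  - exists n. split; [assumption|]. intros k Hk. apply NNPP. intros H. apply N. now exists k.
Qed.

(** The terms after the first one decay faster as the abscissa grows. *)
Lemma tail_dominated (a : nat -> C) (m : nat) (c1 : R) : a (S m) <> RtoC 0 ->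
  ex_series (abs_term a c1) ->
  exists c0, forall c, c0 <= c -> forall S1 : R, is_lim_seq (Rsum (abs_term a c)) S1 ->
    S1 - Rsum (abs_term a c) (S m) <= 1 / 10 * abs_term a c m.
Proof.
  intros Ham [l Hl]. apply is_series_Rsum in Hl.
  assert (Ha : 0 < Cmod (a (S m))) by (now apply Cmod_gt_0).
  assert (HLL := logn_lt m (S m) ltac:(lia)).
  set (L0 := logn m) in *. set (L1 := logn (S m)) in *.
  assert (Hl0 : 0 <= l) by (apply (Rsum_le_lim _ 0 l (abs_term_ge_0 a c1) Hl)).
  set (Q := 10 * (l + 1) / Cmod (a (S m))).
  assert (HQ : 0 < Q) by (apply Rdiv_lt_0_compat; lra).
  exists (Rmax c1 ((ln Q + c1 * L1) / (L1 - L0))). intros c Hc S1 HS1.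
  assert (Hc1 : c1 <= c) by (apply Rle_trans with (2 := Hc), Rmax_l).
  assert (Hc2 : ln Q + c1 * L1 <= c * (L1 - L0)).
  { assert (H : (ln Q + c1 * L1) / (L1 - L0) <= c) by (apply Rle_trans with (2 := Hc), Rmax_r).
    replace (ln Q + c1 * L1) with ((ln Q + c1 * L1) / (L1 - L0) * (L1 - L0)) by (field; lra).
    apply Rmult_le_compat_r; lra. }
  set (X := exp (- (c - c1) * L1)).
  assert (HX : 0 < X) by apply exp_pos.
  assert (Hstep : forall N, (S m <= N)%nat -> Rsum (abs_term a c) N - Rsum (abs_term a c) (S m)
    <= X * (Rsum (abs_term a c1) N - Rsum (abs_term a c1) (S m))).
  { intros N HN. set (u0 := Rsum (abs_term a c) (S m)). set (w0 := Rsum (abs_term a c1) (S m)).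
    induction HN as [|N HN IH]; [unfold u0, w0; lra|].
    change (Rsum (abs_term a c) (S N)) with (Rsum (abs_term a c) N + abs_term a c N). change (Rsum (abs_term a c1) (S N)) with (Rsum (abs_term a c1) N + abs_term a c1 N).
    assert (abs_term a c N <= X * abs_term a c1 N).
    { unfold abs_term, X.
      replace (exp (- (c - c1) * L1) * (Cmod (a (S N)) * exp (- c1 * logn N)))
        with (Cmod (a (S N)) * (exp (- (c - c1) * L1) * exp (- c1 * logn N))) by ring.
      apply Rmult_le_compat_l; [apply Cmod_ge_0|]. rewrite <- exp_plus. apply exp_le_exp.
      assert (L1 <= logn N).
      { destruct (Nat.eq_dec (S m) N) as [Heq|Hne]; [rewrite <- Heq; apply Rle_refl|]. left. apply logn_lt. lia. }
      nra. }
    lra. }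
  apply Rle_trans with (X * l).
  - assert (HH : S1 <= X * l + Rsum (abs_term a c) (S m)); [|lra].
    apply (is_lim_seq_le_loc (Rsum (abs_term a c)) (fun _ => X * l + Rsum (abs_term a c) (S m)) S1 (X * l + Rsum (abs_term a c) (S m))).
    + exists (S m). intros N HN. specialize (Hstep N HN).
      assert (H1 := Rsum_le_lim _ N l (abs_term_ge_0 a c1) Hl).
      assert (H2 := Rsum_incr (abs_term a c1) 0 (S m) (abs_term_ge_0 a c1) ltac:(lia)). simpl (Rsum _ 0) in H2.
      assert (X * (Rsum (abs_term a c1) N - Rsum (abs_term a c1) (S m)) <= X * l) by (apply Rmult_le_compat_l; lra). lra.
    + exact HS1.
    + apply is_lim_seq_const.
  - unfold abs_term. fold L0.
    apply Rle_trans with (X * (l + 1)); [nra|].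
    replace (l + 1) with (1 / 10 * Cmod (a (S m)) * Q) by (unfold Q; field; lra).
    rewrite <- (exp_ln Q HQ). unfold X.
    replace (exp (- (c - c1) * L1) * (1 / 10 * Cmod (a (S m)) * exp (ln Q)))
      with (1 / 10 * (Cmod (a (S m)) * (exp (- (c - c1) * L1) * exp (ln Q)))) by ring.
    apply Rmult_le_compat_l; [lra|]. apply Rmult_le_compat_l; [lra|].
    rewrite <- exp_plus. apply exp_le_exp. lra.
Qed.

Lemma Ccont_lipschitz (f : R -> C) (y K : R) :
  (forall y', Cmod (f y' - f y)%C <= K * Rabs (y' - y)) -> Ccont f y.
Proof.
  intros H.
  assert (G : forall p : C -> R, (forall a b, p (a - b)%C = p a - p b) ->
     (forall z, Rabs (p z) <= Cmod z) -> continuous (fun t => p (f t)) y).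
  { intros p Hp1 Hp2. apply filterlim_locally. intros eps.
    assert (Hd : 0 < eps / (Rabs K + 1)) by (apply Rdiv_lt_0_compat; [apply cond_pos|generalize (Rabs_pos K); lra]).
    exists (mkposreal _ Hd). intros y' Hy'. change (Rabs (y' - y) < eps / (Rabs K + 1)) in Hy'.
    change (Rabs (p (f y') - p (f y)) < eps). rewrite <- Hp1.
    apply Rle_lt_trans with (1 := Hp2 _). apply Rle_lt_trans with (1 := H y').
    apply Rle_lt_trans with ((Rabs K + 1) * Rabs (y' - y)).
    - apply Rmult_le_compat_r; [apply Rabs_pos|]. generalize (Rle_abs K). lra.
    - assert (HK : 0 < Rabs K + 1) by (generalize (Rabs_pos K); lra).
      apply Rlt_le_trans with ((Rabs K + 1) * (eps / (Rabs K + 1))).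
      + apply Rmult_lt_compat_l; assumption.
      + right. field. lra. }
  split; apply G.
  - apply Re_minus.
  - apply re_le_Cmod.
  - apply Im_minus.
  - apply im_le_Cmod.
Qed.

Lemma Csum_minus u v n : Csum (fun k => u k - v k)%C n = (Csum u n - Csum v n)%C.
Proof. induction n as [|n IH]; simpl; [ring|rewrite IH; ring]. Qed.

Lemma Cseries_minus u v l m : Cseries u l -> Cseries v m -> Cseries (fun k => u k - v k)%C (l - m)%C.
Proof.
  intros Hu Hv eps He.
  destruct (Hu (eps / 2) ltac:(lra)) as [N1 H1]. destruct (Hv (eps / 2) ltac:(lra)) as [N2 H2].
  exists (Nat.max N1 N2). intros n Hn. specialize (H1 n ltac:(lia)). specialize (H2 n ltac:(lia)).
  rewrite Csum_minus.
  replace (Csum u n - Csum v n - (l - m))%C with ((Csum u n - l) + - (Csum v n - m))%C by ring.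
  apply Rle_lt_trans with (1 := Cmod_triangle _ _). rewrite Cmod_opp. lra.
Qed.

(** The differentiated series carries an extra factor [ln n], which is at most
    [n]; it is therefore dominated by the series at [c - 1], and the sum is
    Lipschitz. *)
Lemma dirichlet_vertical_Ccont (a : nat -> C) (D : R -> C) (c : R) :
  ex_series (abs_term a (c - 1)) ->
  (forall y, Cseries (dirichlet_term a (c, y)) (D y)) -> forall y, Ccont D y.
Proof.
  intros [S1 HS1] HD y. apply is_series_Rsum in HS1.
  apply Ccont_lipschitz with S1. intros y'.
  assert (Hlim : is_lim_seq (Rsum (fun n => Rabs (y' - y) * abs_term a (c - 1) n)) (Rabs (y' - y) * S1)).
  { apply (is_lim_seq_ext (fun n => Rabs (y' - y) * Rsum (abs_term a (c - 1)) n)).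
    - intros n. now rewrite Rsum_scal.
    - apply (is_lim_seq_scal_l (Rsum (abs_term a (c - 1))) (Rabs (y' - y)) S1 HS1). }
  assert (H := Cseries_tail _ _ (fun n => Rabs (y' - y) * abs_term a (c - 1) n) (Rabs (y' - y) * S1) (Cseries_minus _ _ _ _ (HD y') (HD y))).
  assert (Hb : Cmod ((D y' - D y) - Csum (fun k => dirichlet_term a (c, y') k - dirichlet_term a (c, y) k) 0)%C
     <= Rabs (y' - y) * S1 - Rsum (fun n => Rabs (y' - y) * abs_term a (c - 1) n) 0).
  { apply H; [|assumption]. intros n. rewrite !dirichlet_termE.
    set (L := logn n). assert (HL := logn_ge_0 n). fold L in HL.
    replace (RtoC (- L) * (c, y'))%C with (RtoC (- L) * (c, y) + (0, (- L * (y' - y))%R))%C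
      by (apply injective_projections; simpl; ring).
    rewrite Cexp_add.
    set (e := Cexp (0, - L * (y' - y))).
    replace (a (S n) * (Cexp (RtoC (- L) * (c, y)) * e) - a (S n) * Cexp (RtoC (- L) * (c, y)))%C
      with (a (S n) * Cexp (RtoC (- L) * (c, y)) * (e - RtoC 1))%C by ring.
    rewrite !Cmod_mult, Cmod_Cexp.
    assert (He : Cmod (e - RtoC 1)%C <= L * Rabs (y' - y)).
    { unfold e. apply Rle_trans with (1 := Cexp_sub_1_le (0, - L * (y' - y)) 0 ltac:(simpl; lra) ltac:(lra)).
      rewrite exp_0, Rmult_1_r. apply Rle_trans with (1 := Cmod_le_ReIm _). simpl.
      rewrite Rabs_R0, Rabs_mult, Rabs_Ropp, (Rabs_pos_eq L) by assumption. lra. }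
    unfold abs_term. fold L.
    replace (Re (RtoC (- L) * (c, y))%C) with (- c * L) by (unfold Re; simpl; ring).
    replace (- (c - 1) * L) with (- c * L + L) by ring. rewrite exp_plus.
    assert (H1 : L <= exp L) by apply le_exp.
    assert (P : 0 <= Cmod (a (S n)) * exp (- c * L)) by (apply Rmult_le_pos; [apply Cmod_ge_0|left; apply exp_pos]).
    assert (P2 := Rabs_pos (y' - y)).
    replace (Rabs (y' - y) * (Cmod (a (S n)) * (exp (- c * L) * exp L)))
      with (Cmod (a (S n)) * exp (- c * L) * (exp L * Rabs (y' - y))) by ring.
    apply Rmult_le_compat_l; [assumption|].
    apply Rle_trans with (1 := He). apply Rmult_le_compat_r; assumption. }
  simpl in Hb. replace (D y' - D y - RtoC 0)%C with (D y' - D y)%C in Hb by ring. lra.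
Qed.

Lemma Cexp_surjective (z : C) : z <> RtoC 0 -> exists A, Cexp A = z.
Proof.
  intros Hz. destruct z as [x y].
  destruct (Rtotal_order y 0) as [Hy|[Hy|Hy]].
  - exists (Cconj (clog (x, - y))). rewrite <- Cexp_conj, Cexp_clog by (simpl; lra).
    unfold Cconj; simpl. f_equal. ring.
  - subst y. destruct (Rtotal_order x 0) as [Hx|[Hx|Hx]].
    + exists (ln (- x), PI). unfold Cexp, Re, Im; simpl.
      rewrite exp_ln, cos_PI, sin_PI by lra. f_equal; ring.
    + subst x. now elim Hz.
    + exists (RtoC (ln x)). rewrite Cexp_RtoC, exp_ln by lra. reflexivity.
  - exists (clog (x, y)). now apply Cexp_clog.
Qed.

(** Equalities of meromorphic functions hold only off a discrete set; between
    continuous functions the resulting inequalities extend to the exceptional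
    points. *)
Lemma punctured_le (phi psi : R -> R) (t : R) : continuous phi t -> continuous psi t ->
  (exists delta, 0 < delta /\ forall y, y <> t -> Rabs (y - t) < delta -> phi y <= psi y) ->
  phi t <= psi t.
Proof.
  intros Hphi Hpsi [d1 [Hd1 H]]. apply Rnot_lt_le. intros Hlt.
  assert (Hc : continuous (fun y => minus (phi y) (psi y)) t)
    by (now apply continuous_Rminus).
  assert (He : 0 < phi t - psi t) by lra.
  assert (Hl := proj1 (filterlim_locally _ _) Hc (mkposreal _ He)).
  destruct Hl as [d2 Hd2].
  assert (Hd := cond_pos d2).
  set (dd := Rmin d1 d2 / 2).
  assert (Hdd : 0 < dd /\ dd < d1 /\ dd < d2).
  { unfold dd. assert (H1 := Rmin_l d1 d2). assert (H2 := Rmin_r d1 d2).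
    assert (0 < Rmin d1 d2) by (now apply Rmin_pos). lra. }
  assert (Habs : Rabs (t + dd - t) = dd) by (replace (t + dd - t) with dd by ring; apply Rabs_pos_eq; lra).
  specialize (H (t + dd) ltac:(lra) ltac:(lra)).
  assert (Hb : Rabs (t + dd - t) < d2) by lra.
  specialize (Hd2 (t + dd) Hb).
  change (Rabs ((phi (t + dd) + - psi (t + dd)) - (phi t + - psi t)) < phi t - psi t) in Hd2.
  apply Rabs_lt_between in Hd2. lra.
Qed.

Lemma locally'_vertical (x t : R) (Q : C -> Prop) : locally' (T := C_UniformSpace) (x, t) Q ->
  exists delta, 0 < delta /\ forall y, y <> t -> Rabs (y - t) < delta -> Q (x, y).
Proof.
  intros H. apply locally_Cmod in H. destruct H as [d [Hd H]]. exists d. split; [assumption|].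
  intros y Hy Hyt. apply H.
  - apply Rle_lt_trans with (1 := Cmod_le_ReIm _). rewrite Re_minus, Im_minus. simpl.
    replace (x - x) with 0 by ring. rewrite Rabs_R0. lra.
  - intros E. apply Hy. now injection E.
Qed.

(** The functional equation turns the first term of the Dirichlet series on
    [Re s = c] into the dominant behaviour on [Re s = 1 - c]; the Gaussian windows
    then carry this lower bound over to the coefficients. *)
Theorem short_window_bound (d : R) (F : C -> C) (a : nat -> C) :
  0 < d -> polynomial_growth F -> has_degree F d -> given_by_dirichlet_series F a ->
  exists kappa beta0 T1, 0 < kappa /\ forall T, T1 <= T -> exists N,
    kappa * exp (d / 2 * ln T) <=
    Rsum (fun n => Cmod (a (S n)) * exp (- (sqrt T * Rabs (logn n - (d * ln T + beta0))))) N.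
Proof.
  intros Hd [P [E [HP [HE [HEPF Hgrow]]]]] [Q [omega [l [l' [[HQ [Homega [Hl [Hl' HFE]]]] Hdeg]]]]] [Hfin [_ Hser]].
  destruct (first_coefficient a Hfin) as [m [Ham Hm0]].
  destruct (nonzero_polynomial_lower P HP) as [HPhol [R0 [k [Hk HPk]]]].
  set (sa := real (abscissa_abs_conv a)) in *.
  assert (Hsa : abscissa_abs_conv a = Finite sa) by (symmetry; exact Hfin).
  rewrite Hsa in Hser.
  assert (Hac : forall sig, sa < sig -> ex_series (abs_term a sig)).
  { intros sig Hs. apply abs_conv. rewrite Hsa. exact Hs. }
  destruct (tail_dominated a m (sa + 1) Ham (Hac (sa + 1) ltac:(lra))) as [c0 Htail].
  set (c := Rmax 1 (Rmax c0 (sa + 2))).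
  assert (Hc1 : 1 <= c) by apply Rmax_l.
  assert (Hc2 : c0 <= c) by (eapply Rle_trans; [|apply Rmax_r]; apply Rmax_l).
  assert (Hc3 : sa + 2 <= c) by (eapply Rle_trans; [|apply Rmax_r]; apply Rmax_r).
  clearbody c.
  destruct (reflection_ratio_line Q c l l' Hl Hl') as [A0 [B0 [b0 [K0 [t0 [HB0 Hratio]]]]]].
  rewrite Hdeg in HB0, Hratio.
  set (D := fun y => F (c, y)).
  assert (HD : forall y, Cseries (dirichlet_term a (c, y)) (D y)).
  { intros y. apply is_series_Cseries. apply Hser. simpl. lra. }
  assert (HDc : forall y, Ccont D y).
  { apply (dirichlet_vertical_Ccont a D c); [apply Hac; lra|assumption]. }
  destruct (Hac c ltac:(lra)) as [Sc HSc]. apply is_series_Rsum in HSc.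
  specialize (Htail c Hc2 Sc HSc).
  destruct (Hgrow (1 - c) c) as [M [K HK]].
  set (t1 := Rmax 1 (Rmax (Rmax R0 t0) (40 * Rabs K0)) + 1).
  assert (Ht1 : forall t, t1 <= t -> 2 <= t /\ R0 + 1 <= t /\ t0 + 1 <= t /\ 40 * Rabs K0 + 1 <= t).
  { intros t Ht. unfold t1 in Ht.
    generalize (Rmax_l 1 (Rmax (Rmax R0 t0) (40 * Rabs K0))) (Rmax_r 1 (Rmax (Rmax R0 t0) (40 * Rabs K0)))
      (Rmax_l (Rmax R0 t0) (40 * Rabs K0)) (Rmax_r (Rmax R0 t0) (40 * Rabs K0)) (Rmax_l R0 t0) (Rmax_r R0 t0). lra. }
  assert (HP0 : forall s, R0 <= Im s -> k <= Cmod (P s) /\ P s <> RtoC 0).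
  { intros s Hs.
    assert (H : k <= Cmod (P s)).
    { apply HPk. apply Rle_trans with (2 := im_le_Cmod s). apply Rle_trans with (2 := Rle_abs _). lra. }
    split; [assumption|]. apply Cmod_gt_0. lra. }
  (* a genuinely differentiable version of [F], high up in the half-plane *)
  set (f := fun s => (E s / P s)%C).
  assert (HEhol : forall s, hol E s) by (intros; apply holomorphic_at_hol, HE).
  assert (Hfhol : forall s, R0 <= Im s -> hol f s).
  { intros s Hs. apply hol_div; [apply HEhol|apply HPhol|]. now apply HP0. }
  assert (Hfc : forall t, t1 <= t -> f (c, t) = D t).
  { intros t Ht. destruct (Ht1 t Ht) as [H1 [H2 _]].
    assert (Hz : Cmod (E (c, t) - P (c, t) * D t)%C <= 0).
    { apply (punctured_le (fun y => Cmod (E (c, y) - P (c, y) * D y)%C) (fun _ => 0)).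
      - apply (Ccont_Cmod (fun y => (E (c, y) - P (c, y) * D y)%C)).
        apply Ccont_minus; [apply contC_Ccont_v, hol_contC, HEhol|].
        apply Ccont_mult; [apply contC_Ccont_v, hol_contC, HPhol|apply HDc].
      - apply continuous_const.
      - destruct (locally'_vertical _ _ _ (HEPF (c, t))) as [dl [Hdl Hpt]].
        exists dl. split; [assumption|]. intros y Hy Hyt. rewrite (Hpt y Hy Hyt).
        replace (P (c, y) * F (c, y) - P (c, y) * D y)%C with (RtoC 0) by (unfold D; ring).
        rewrite Cmod_0. lra. }
    assert (Hz0 : (E (c, t) - P (c, t) * D t)%C = RtoC 0).
    { apply Cmod_eq_0. generalize (Cmod_ge_0 (E (c, t) - P (c, t) * D t)%C). lra. }
    destruct (HP0 (c, t) ltac:(simpl; lra)) as [_ HPn]. unfold f.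
    apply Ceq_minus in Hz0. rewrite Hz0. field. assumption. }
  (* [A1] absorbs the constants [omega] and the conjugate of the first coefficient *)
  set (L := logn m).
  assert (Hom0 : (omega * Cconj (a (S m)))%C <> RtoC 0).
  { apply Cmult_neq_0; apply Cmod_gt_0; [lra|]. rewrite Cmod_conj. now apply Cmod_gt_0. }
  destruct (Cexp_surjective _ Hom0) as [A1 HA1].
  set (N := fun y => Cexp (A0 + B0 * RtoC (ln y) + Ci * RtoC (b0 * y - d * (y * ln y)))%C).
  (* gamma factors enter only through their asymptotics [N], which is continuous *)
  assert (Hfl : forall t, t1 <= t ->
    Cmod (f ((1 - c)%R, t) - omega * N t * Cconj (D t))%C <= 2 * (Rabs K0 / t) * (Cmod (N t) * Cmod (D t))).
  { intros t Ht. destruct (Ht1 t Ht) as [H1 [H2 [H3 H4]]].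
    assert (HlnC : Ccont (fun y => RtoC (ln y)) t).
    { split; [|apply continuous_const]. apply (continuous_ln t). lra. }
    assert (HNc : Ccont N t).
    { unfold N. apply Ccont_Cexp. apply Ccont_plus; [apply Ccont_plus; [apply Ccont_const|]|].
      - apply Ccont_mult; [apply Ccont_const|assumption].
      - apply Ccont_mult; [apply Ccont_const|]. split; [|apply continuous_const]. simpl.
        apply continuous_Rminus.
        + apply continuous_Rmult; [apply continuous_const|apply continuous_id].
        + apply continuous_Rmult; [apply continuous_const|].
          apply continuous_Rmult; [apply continuous_id|].
          apply continuous_ln; lra. }
    apply (punctured_le (fun y => Cmod (f ((1 - c)%R, y) - omega * N y * Cconj (D y))%C)
      (fun y => 2 * (Rabs K0 / y) * (Cmod (N y) * Cmod (D y)))).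
    - apply (Ccont_Cmod (fun y => (f ((1 - c)%R, y) - omega * N y * Cconj (D y))%C)).
      apply Ccont_minus; [apply contC_Ccont_v, hol_contC, Hfhol; simpl; lra|].
      apply Ccont_mult; [apply Ccont_mult; [apply Ccont_const|assumption]|].
      apply Ccont_conj, HDc.
    - apply continuous_Rmult.
      + apply continuous_Rmult; [apply continuous_const|].
        apply continuous_Rmult; [apply continuous_const|].
        apply continuous_Rinv. lra.
      + apply continuous_Rmult; apply Ccont_Cmod; [assumption|apply HDc].
    - destruct (locally'_vertical _ _ _ (HEPF ((1 - c)%R, t))) as [d1 [Hd1 Hpt1]].
      destruct (locally'_vertical _ _ _ (HFE ((1 - c)%R, t))) as [d2 [Hd2 Hpt2]].
      exists (Rmin 1 (Rmin d1 d2)). split; [repeat apply Rmin_pos; lra|].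
      intros y Hy Hyt.
      assert (Hy1 : Rabs (y - t) < 1) by (apply Rlt_le_trans with (1 := Hyt), Rmin_l).
      assert (Hy2 : Rabs (y - t) < d1) by (apply Rlt_le_trans with (1 := Hyt); eapply Rle_trans; [apply Rmin_r|]; apply Rmin_l).
      assert (Hy3 : Rabs (y - t) < d2) by (apply Rlt_le_trans with (1 := Hyt); eapply Rle_trans; [apply Rmin_r|]; apply Rmin_r).
      apply Rabs_lt_between in Hy1.
      specialize (Hpt1 y Hy Hy2). specialize (Hpt2 y Hy Hy3). cbv beta in Hpt2.
      destruct (HP0 ((1 - c)%R, y) ltac:(simpl; lra)) as [_ HPn].
      destruct (Hratio y ltac:(lra)) as [HCF [r [Hr Er]]].
      assert (Ef : f ((1 - c)%R, y) = F ((1 - c)%R, y)).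
      { unfold f. rewrite Hpt1. field. assumption. }
      replace (RtoC 1 - Cconj ((1 - c)%R, y))%C with ((c, y) : C) in Hpt2
        by (apply injective_projections; simpl; ring).
      change (completed_factor Q l l' ((1 - c)%R, y) * F ((1 - c)%R, y) =
              omega * Cconj (completed_factor Q l l' (c, y) * D y))%C in Hpt2.
      rewrite Cmult_conj in Hpt2.
      assert (EF : F ((1 - c)%R, y) = (omega * Cconj (D y) * (Cconj (completed_factor Q l l' (c, y)) / completed_factor Q l l' ((1 - c)%R, y)))%C).
      { transitivity ((completed_factor Q l l' ((1 - c)%R, y) * F ((1 - c)%R, y)) / completed_factor Q l l' ((1 - c)%R, y))%C.
        - field. assumption.
        - rewrite Hpt2. field. assumption. }
      rewrite Ef, EF, Er, Cexp_add. fold (N y).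
      replace (omega * Cconj (D y) * (N y * Cexp r) - omega * N y * Cconj (D y))%C
        with (omega * (N y * Cconj (D y)) * (Cexp r - RtoC 1))%C by ring.
      rewrite !Cmod_mult, Homega, Cmod_conj, Rmult_1_l.
      assert (Hyp : 0 < y) by lra.
      assert (Hr2 : Cmod r <= Rabs K0 / y).
      { apply Rle_trans with (1 := Hr). apply Rmult_le_compat_r; [left; now apply Rinv_0_lt_compat|apply Rle_abs]. }
      assert (Hr3 : Rabs K0 / y <= 1 / 2).
      { apply Rmult_le_reg_r with y; [assumption|]. unfold Rdiv at 1. rewrite Rmult_assoc, Rinv_l by lra. lra. }
      assert (He : Cmod (Cexp r - RtoC 1)%C <= 2 * (Rabs K0 / y)).
      { assert (Hre : Re r <= 1 / 2) by (generalize (re_le_Cmod r) (Rle_abs (Re r)); lra).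
        apply Rle_trans with (1 := Cexp_sub_1_le r (1 / 2) Hre ltac:(lra)).
        generalize exp_half_le_2 (Cmod_ge_0 r) (exp_pos (1 / 2)). nra. }
      rewrite Rmult_comm. apply Rmult_le_compat_r; [|assumption].
      apply Rmult_le_pos; apply Cmod_ge_0. }
  assert (Hwin := window_lower_bound d (b0 + L) c M (K / k) t1 Sc (A0 + A1 + RtoC (- L * c))%C B0 f (fun n => a (S n)) logn
    Hd Hc1 HB0).
  destruct Hwin as [kappa [T1 [Hkap HT]]].
  - intros s Hs. apply Hfhol. destruct (Ht1 _ Hs). lra.
  - intros s Hs1 Hs2. destruct (Ht1 _ Hs2) as [_ [H2 _]].
    destruct (HP0 s ltac:(lra)) as [Hlow Hn]. unfold f. rewrite Cmod_div by assumption.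
    specialize (HK s Hs1). set (X := Rpower (1 + Rabs (Im s)) M) in *.
    apply Rmult_le_reg_r with (Cmod (P s)); [lra|].
    unfold Rdiv at 1. rewrite Rmult_assoc, Rinv_l, Rmult_1_r by lra.
    apply Rle_trans with (1 := HK).
    assert (HKX : 0 <= K * X) by (generalize (Cmod_ge_0 (E s)); lra).
    replace (K / k * X * Cmod (P s)) with (K * X * (Cmod (P s) / k)) by (field; lra).
    assert (1 <= Cmod (P s) / k).
    { apply Rmult_le_reg_r with k; [assumption|]. unfold Rdiv. rewrite Rmult_assoc, Rinv_l by lra. lra. }
    nra.
  - intros t Ht. rewrite (Hfc t Ht). intros eps Heps. destruct (HD t eps Heps) as [n0 Hn0].
    exists n0. intros n Hn. specialize (Hn0 n Hn).
    replace (Csum (fun n1 => a (S n1) * Cexp (RtoC (- logn n1) * (c, t)))%C n) with (Csum (dirichlet_term a (c, t)) n); [assumption|].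
    clear. induction n as [|n IH]; simpl; [reflexivity|]. now rewrite IH, dirichlet_termE.
  - intros t Ht. destruct (Ht1 t Ht) as [H1 [H2 [H3 H4]]].
    set (Tm := dirichlet_term a (c, t) m).
    assert (HDT : Cmod (D t - Tm)%C <= 1 / 10 * Cmod Tm).
    { assert (Hsum : Csum (dirichlet_term a (c, t)) (S m) = Tm).
      { simpl. replace (Csum (dirichlet_term a (c, t)) m) with (RtoC 0); [unfold Tm; ring|].
        assert (H : forall j, (j <= m)%nat -> Csum (dirichlet_term a (c, t)) j = RtoC 0).
        { induction j as [|j IH]; intros Hj; simpl; [reflexivity|].
          rewrite IH by lia. rewrite dirichlet_termE, Hm0 by lia. ring. }
        symmetry. apply H. lia. }
      replace (D t - Tm)%C with (D t - Csum (dirichlet_term a (c, t)) (S m))%C by (now rewrite Hsum).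
      apply Rle_trans with (Sc - Rsum (abs_term a c) (S m)).
      - apply (Cseries_tail _ _ (abs_term a c) Sc (HD t)); [|assumption].
        intros n. rewrite Cmod_dirichlet_term. simpl. apply Rle_refl.
      - unfold Tm. rewrite Cmod_dirichlet_term. exact Htail. }
    set (X := (omega * N t * Cconj Tm)%C).
    assert (HX : X = Cexp (A0 + A1 + RtoC (- L * c) + B0 * RtoC (ln t) + Ci * RtoC ((b0 + L) * t - d * (t * ln t)))%C).
    { unfold X, Tm. rewrite dirichlet_termE. fold L. rewrite Cmult_conj, Cexp_conj.
      replace (omega * N t * (Cconj (a (S m)) * Cexp (Cconj (RtoC (- L) * (c, t)))))%C
        with ((omega * Cconj (a (S m))) * N t * Cexp (Cconj (RtoC (- L) * (c, t))))%C by ring.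
      rewrite <- HA1. unfold N. rewrite <- !Cexp_add. f_equal.
      apply injective_projections; simpl; ring. }
    assert (HXm : Cmod X = Cmod (N t) * Cmod Tm).
    { unfold X. rewrite !Cmod_mult, Homega, Cmod_conj. ring. }
    assert (HX0 : X <> RtoC 0) by (rewrite HX; apply Cexp_neq_0).
    assert (HXp : 0 < Cmod X) by (now apply Cmod_gt_0).
    exists (f ((1 - c)%R, t) / X - RtoC 1)%C. split.
    2: { rewrite <- HX. field. assumption. }
    replace (f ((1 - c)%R, t) / X - RtoC 1)%C with ((f ((1 - c)%R, t) - X) / X)%C by (field; assumption).
    rewrite Cmod_div by assumption.
    apply Rmult_le_reg_r with (Cmod X); [assumption|].
    unfold Rdiv at 1. rewrite Rmult_assoc, Rinv_l, Rmult_1_r by lra.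
    replace (f ((1 - c)%R, t) - X)%C with ((f ((1 - c)%R, t) - omega * N t * Cconj (D t)) + omega * N t * Cconj (D t - Tm))%C
      by (unfold X; rewrite Cminus_conj; ring).
    apply Rle_trans with (1 := Cmod_triangle _ _).
    rewrite !(Cmod_mult (omega * N t)), (Cmod_mult omega), Homega, Cmod_conj, Rmult_1_l.
    assert (HDm : Cmod (D t) <= 11 / 10 * Cmod Tm).
    { replace (D t) with (Tm + (D t - Tm))%C by ring. apply Rle_trans with (1 := Cmod_triangle _ _). lra. }
    assert (HK0 : 0 <= Rabs K0 / t <= 1 / 40).
    { split; [apply Rle_mult_inv_pos; [apply Rabs_pos|lra]|].
      apply Rmult_le_reg_r with t; [lra|]. unfold Rdiv at 1. rewrite Rmult_assoc, Rinv_l by lra. lra. }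
    assert (HN0 := Cmod_ge_0 (N t)).
    assert (HND : Cmod (N t) * Cmod (D t) <= 11 / 10 * Cmod X).
    { rewrite HXm. assert (Cmod (N t) * Cmod (D t) <= Cmod (N t) * (11 / 10 * Cmod Tm)) by (apply Rmult_le_compat_l; assumption). lra. }
    assert (HNT : Cmod (N t) * Cmod (D t - Tm)%C <= 1 / 10 * Cmod X).
    { rewrite HXm. assert (Cmod (N t) * Cmod (D t - Tm)%C <= Cmod (N t) * (1 / 10 * Cmod Tm)) by (apply Rmult_le_compat_l; assumption). lra. }
    assert (HND0 : 0 <= Cmod (N t) * Cmod (D t)) by (apply Rmult_le_pos; [assumption|apply Cmod_ge_0]).
    assert (HNDK : 2 * (Rabs K0 / t) * (Cmod (N t) * Cmod (D t)) <= 2 * (1 / 40) * (Cmod (N t) * Cmod (D t))).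
    { apply Rmult_le_compat_r; [assumption|]. lra. }
    specialize (Hfl t Ht). lra.
  - exact HSc.
  - exists kappa, (d - (b0 + L)), T1. split; assumption.
Qed.

(** * From short windows to the summatory function *)

(** The constant 16 leaves room in [1 + c^2 <= 2 + 2 v^2 <= 8 (1 + |v|/2)^2], where
    [c] is within 1/2 of [v]. *)
Lemma exp_neg_le_atan v : exp (- Rabs v) <= 16 * (atan (v + 1 / 2) - atan v).
Proof.
  destruct (mean_value atan (fun x => / (1 + x * x)) v (v + 1 / 2) ltac:(lra)) as [c [Hc E]].
  { intros x _. auto_derive; [easy|unfold Rsqr; simpl; field; nra]. }
  rewrite E. replace (v + 1 / 2 - v) with (1 / 2) by ring.
  assert (Hcv : Rabs c <= Rabs v + 1 / 2).
  { apply Rabs_le. generalize (Rle_abs v) (Rle_abs (- v)). rewrite Rabs_Ropp. lra. }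
  assert (Hcc : c * c = Rabs c * Rabs c) by (rewrite <- Rabs_mult; symmetry; apply Rabs_pos_eq; nra).
  set (w := Rabs v) in *. assert (Hw : 0 <= w) by apply Rabs_pos.
  assert (Hc2 : 1 + c * c <= 2 + 2 * (w * w)).
  { rewrite Hcc. generalize (Rabs_pos c). set (q := Rabs c) in *. intros.
    assert (q * q <= (w + 1 / 2) * (w + 1 / 2)) by (apply Rmult_le_compat; lra).
    assert (0 <= (w - 1 / 2) * (w - 1 / 2)) by apply Rle_0_sqr. nra. }
  assert (Hexp : 1 + w / 2 <= exp (w / 2)) by apply exp_ineq1_le.
  assert (Hexp2 : exp (w / 2) * exp (w / 2) = exp w) by (rewrite <- exp_plus; f_equal; field).
  assert (H1 : (1 + w / 2) * (1 + w / 2) <= exp w) by (rewrite <- Hexp2; apply Rmult_le_compat; lra).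
  rewrite exp_Ropp.
  apply Rle_trans with (/ ((1 + c * c) / 8)); [|right; field; nra].
  apply Rinv_le_contravar; nra.
Qed.

(** Comparison with the increments of the arctangent, which telescope. *)
Lemma exp_neg_dist_sum (x : R) (y : nat -> R) (K : nat) :
  (forall k, (k < K)%nat -> y k + 1 / 2 <= y (S k)) ->
  Rsum (fun k => exp (- Rabs (x - y k))) K <= 64.
Proof.
  intros Hy.
  assert (H : Rsum (fun k => exp (- Rabs (x - y k))) K <= 16 * (atan (y K - x) - atan (y O - x))).
  { induction K as [|K IH]; simpl Rsum; [lra|].
    specialize (IH ltac:(intros; apply Hy; lia)). specialize (Hy K ltac:(lia)).
    assert (H := exp_neg_le_atan (y K - x)). rewrite Rabs_minus_sym.
    assert (H2 : atan (y K - x + 1 / 2) <= atan (y (S K) - x)).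
    { destruct (Rle_lt_or_eq_dec (y K - x + 1 / 2) (y (S K) - x) ltac:(lra)) as [Hlt|Heq];
      [left; now apply atan_increasing|rewrite Heq; apply Rle_refl]. }
    lra. }
  generalize (Ratan.atan_bound (y K - x)) (Ratan.atan_bound (y O - x)) PI_4. lra.
Qed.

Lemma Rsum_swap (f : nat -> nat -> R) n m :
  Rsum (fun k => Rsum (fun j => f k j) m) n = Rsum (fun j => Rsum (fun k => f k j) n) m.
Proof.
  induction n as [|n IH]; simpl.
  - induction m as [|m IHm]; simpl; [reflexivity|]. rewrite <- IHm. ring.
  - now rewrite IH, <- Rsum_plus.
Qed.

Lemma Rsum_const c n : Rsum (fun _ => c) n = INR n * c.
Proof. induction n as [|n IH]; [simpl; ring|]. rewrite S_INR. simpl Rsum. rewrite IH. ring. Qed.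

Lemma sum_n_m_Rsum (f : nat -> R) M : sum_n_m f 1 M = Rsum (fun n => f (S n)) M.
Proof.
  induction M as [|M IH].
  - rewrite sum_n_m_zero by lia. reflexivity.
  - rewrite sum_n_Sm by lia. rewrite IH. reflexivity.
Qed.

Lemma abs_coef_sum_Rsum (a : nat -> C) X : abs_coef_sum a X =
  Rsum (fun n => if Rlt_dec (INR (S n)) X then Cmod (a (S n)) else 0) (Z.to_nat (up X)).
Proof. unfold abs_coef_sum. apply (sum_n_m_Rsum (fun n => if Rlt_dec (INR n) X then Cmod (a n) else 0)). Qed.

Lemma abs_coef_sum_ge (a : nat -> C) X N :
  Rsum (fun n => if Rlt_dec (INR (S n)) X then Cmod (a (S n)) else 0) N <= abs_coef_sum a X.
Proof.
  rewrite abs_coef_sum_Rsum. set (g := fun n => if Rlt_dec (INR (S n)) X then Cmod (a (S n)) else 0).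
  assert (Hg : forall n, 0 <= g n).
  { intros n. unfold g. destruct Rlt_dec; [apply Cmod_ge_0|lra]. }
  set (M := Z.to_nat (up X)).
  destruct (Nat.le_gt_cases N M) as [H|H]; [now apply Rsum_incr|].
  assert (E : forall j, (M <= j)%nat -> Rsum g j = Rsum g M).
  { intros j Hj. induction Hj as [|j Hj IH]; [reflexivity|]. simpl. rewrite IH.
    unfold g at 2. destruct Rlt_dec as [Hlt|_]; [|ring]. exfalso.
    destruct (archimed X) as [Hup _].
    assert (HM : (up X <= Z.of_nat M)%Z) by (unfold M; lia).
    apply IZR_le in HM. rewrite <- INR_IZR_INZ in HM.
    apply le_INR in Hj. rewrite S_INR in Hlt. lra. }
  rewrite E by lia. apply Rle_refl.
Qed.

(** If the coefficients were small on average, adding up the lower bounds for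
    the [K] disjoint windows at [T = K^2 + k K], [k < K], would give a
    contradiction: each [n] is counted a bounded number of times. *)
Lemma short_windows_contradiction (d : R) (a : nat -> C) (c1 kappa beta0 T1 : R) :
  1 <= d -> 0 <= c1 -> ex_series (abs_term a c1) -> 0 < kappa ->
  (forall T, T1 <= T -> exists N, kappa * exp (d / 2 * ln T) <=
    Rsum (fun n => Cmod (a (S n)) * exp (- (sqrt T * Rabs (logn n - (d * ln T + beta0))))) N) ->
  ~ (forall eps, 0 < eps -> exists X0, forall X, X0 <= X ->
       abs_coef_sum a X <= eps * Rpower X (1 / 2 + 1 / (2 * d))).
Proof.
  intros Hd Hc1 [S1 HS1] Hkappa Hwin Hsmall. apply is_series_Rsum in HS1.
  assert (HS10 : 0 <= S1) by (apply (Rsum_le_lim _ 0 S1 (abs_term_ge_0 a c1) HS1)).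
  set (C0 := exp ((1 / 2 + 1 / (2 * d)) * (beta0 + 1 + d * ln 2))).
  assert (HC0 : 0 < C0) by apply exp_pos.
  set (eps := kappa / (4 * (64 * C0))).
  assert (Heps : 0 < eps) by (apply Rdiv_lt_0_compat; lra).
  destruct (Hsmall eps Heps) as [X0 HX0].
  assert (EV : for_large (fun K => ((1 <= K /\ T1 <= K) /\ c1 <= K) /\
     ((S1 + c1 + c1 * (beta0 + d * ln 2) - ln (kappa / 4)) + (1 + 2 * c1 * d) * ln K <= 1 * K /\
      ln (Rmax 1 X0) - (beta0 + 1 + d * ln 2) <= 2 * d * ln K))).
  { apply for_large_and; apply for_large_and; try apply for_large_and; try apply for_large_ge.
    - apply for_large_log_le; lra.
    - apply for_large_log_ge; lra. }
  destruct EV as [B HB]. destruct (INR_unbounded B) as [K HK].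
  destruct (HB (INR K) ltac:(lra)) as [[[HK1 HKT] HKc] [HKlog HKX]]. clear HB.
  set (x := INR K) in *.
  set (T := fun k : nat => x * x + INR k * x).
  assert (HT : forall k, x * x <= T k) by (intros k; unfold T; generalize (pos_INR k); nra).
  assert (HT2 : forall k, (k <= K)%nat -> T k <= 2 * (x * x)).
  { intros k Hk. apply le_INR in Hk. fold x in Hk. unfold T. nra. }
  set (beta := fun k => d * ln (T k) + beta0).
  set (bmax := d * ln (2 * (x * x)) + beta0).
  assert (Hxx : 1 <= x * x) by nra.
  assert (Hbmax : forall k, (k <= K)%nat -> beta k <= bmax).
  { intros k Hk. unfold beta, bmax. apply Rplus_le_compat_r, Rmult_le_compat_l; [lra|].
    apply ln_le; [generalize (HT k); lra|now apply HT2]. }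
  assert (Hgap : forall k, (k < K)%nat -> x * beta k + 1 / 2 <= x * beta (S k)).
  { intros k Hk. assert (HTk := HT k). assert (HTS := HT2 (S k) ltac:(lia)).
    assert (ETS : T (S k) = T k + x) by (unfold T; rewrite S_INR; ring).
    assert (Hln : 1 - T k / T (S k) <= ln (T (S k)) - ln (T k)).
    { assert (Hq : 0 < T k / T (S k)) by (apply Rdiv_lt_0_compat; lra).
      generalize (ln_le_sub_1 _ Hq). rewrite ln_div by lra. lra. }
    assert (Hq2 : 1 - T k / T (S k) = x / T (S k)) by (rewrite ETS; field; lra).
    assert (Hq3 : x / (2 * (x * x)) <= x / T (S k)).
    { apply Rmult_le_compat_l; [lra|]. apply Rinv_le_contravar; lra. }
    assert (Hq4 : x * (x / (2 * (x * x))) = 1 / 2) by (field; lra).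
    unfold beta.
    assert (1 / 2 <= x * (ln (T (S k)) - ln (T k))).
    { rewrite <- Hq4. apply Rmult_le_compat_l; lra. }
    assert (1 / 2 <= d * (x * (ln (T (S k)) - ln (T k)))) by nra. lra. }
  set (phi := fun n => Rsum (fun k => exp (- Rabs (x * logn n - x * beta k))) K).
  assert (Hphi1 : forall n, phi n <= 64).
  { intros n. apply (exp_neg_dist_sum (x * logn n) (fun k => x * beta k) K Hgap). }
  assert (Hphi2 : forall n, bmax + 1 <= logn n ->
     phi n <= x * exp (- (x - c1) + c1 * bmax) * exp (- c1 * logn n)).
  { intros n Hn. rewrite Rmult_assoc. unfold x at 1. rewrite <- Rsum_const. apply Rsum_le. intros k Hk.
    rewrite <- exp_plus. apply exp_le_exp.
    assert (Hbk := Hbmax k ltac:(lia)).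
    rewrite <- Rmult_minus_distr_l, Rabs_mult, !Rabs_pos_eq by lra.
    assert ((x - c1) * 1 <= (x - c1) * (logn n - beta k)) by (apply Rmult_le_compat_l; lra).
    assert (c1 * (logn n - bmax) <= c1 * (logn n - beta k)) by (apply Rmult_le_compat_l; lra). lra. }
  assert (Hlnx : 0 <= ln x) by (rewrite <- ln_1; apply ln_le; lra).
  assert (Hlnxx : ln (x * x) = 2 * ln x) by (rewrite ln_mult by lra; ring).
  (* the finitely many windows share one cut-off [N], so that the sums over [n] and
     [k] can be exchanged *)
  assert (HN : exists N, forall k, (k < K)%nat -> kappa * exp (d / 2 * ln (x * x)) <=
     Rsum (fun n => Cmod (a (S n)) * exp (- Rabs (x * logn n - x * beta k))) N).
  { assert (G : forall j, (j <= K)%nat -> exists N, forall k, (k < j)%nat -> kappa * exp (d / 2 * ln (x * x)) <=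
       Rsum (fun n => Cmod (a (S n)) * exp (- Rabs (x * logn n - x * beta k))) N); [|now apply G].
    induction j as [|j IH]; intros Hj; [exists O; lia|].
    destruct (IH ltac:(lia)) as [N1 HN1]. destruct (Hwin (T j)) as [N2 HN2].
    { generalize (HT j). nra. }
    exists (Nat.max N1 N2). intros k Hk.
    assert (Hpos : forall n, 0 <= Cmod (a (S n)) * exp (- Rabs (x * logn n - x * beta k))).
    { intros n. apply Rmult_le_pos; [apply Cmod_ge_0|left; apply exp_pos]. }
    destruct (Nat.eq_dec k j) as [E|Hne].
    - subst k. apply Rle_trans with (kappa * exp (d / 2 * ln (T j))).
      + apply Rmult_le_compat_l; [lra|]. apply exp_le_exp, Rmult_le_compat_l; [lra|]. apply ln_le; [lra|apply HT].
      + apply Rle_trans with (1 := HN2). apply Rle_trans with (2 := Rsum_incr _ N2 (Nat.max N1 N2) Hpos ltac:(lia)).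
        apply Rsum_le. intros n _. apply Rmult_le_compat_l; [apply Cmod_ge_0|]. apply exp_le_exp.
        fold (beta j).
        rewrite <- Rmult_minus_distr_l, Rabs_mult, (Rabs_pos_eq x) by lra.
        apply Ropp_le_contravar, Rmult_le_compat_r; [apply Rabs_pos|].
        rewrite <- (sqrt_square x) by lra. apply sqrt_le_1_alt, HT.
    - apply Rle_trans with (1 := HN1 k ltac:(lia)). apply Rsum_incr; [exact Hpos|lia]. }
  destruct HN as [N HN].
  assert (Hlow : x * (kappa * exp (d / 2 * ln (x * x))) <= Rsum (fun n => Cmod (a (S n)) * phi n) N).
  { unfold x at 1. rewrite <- Rsum_const.
    apply Rle_trans with (Rsum (fun k => Rsum (fun n => Cmod (a (S n)) * exp (- Rabs (x * logn n - x * beta k))) N) K).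
    - apply Rsum_le. exact HN.
    - rewrite Rsum_swap. right. apply Rsum_ext. intros n. unfold phi. now rewrite Rsum_scal. }
  (* beyond [X] every window has decayed like [exp (- x (ln n - bmax))], which is
     exponentially small in [x = K] *)
  set (X := exp (bmax + 1)).
  set (R1 := x * exp (- (x - c1) + c1 * bmax)).
  assert (HR1 : 0 < R1) by (apply Rmult_lt_0_compat; [lra|apply exp_pos]).
  assert (Hup : Rsum (fun n => Cmod (a (S n)) * phi n) N <= 64 * abs_coef_sum a X + R1 * S1).
  { apply Rle_trans with (Rsum (fun n => 64 * (if Rlt_dec (INR (S n)) X then Cmod (a (S n)) else 0) + R1 * abs_term a c1 n) N).
    - apply Rsum_le. intros n _. assert (Ha := Cmod_ge_0 (a (S n))).
      assert (Hat := abs_term_ge_0 a c1 n).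
      assert (HRat : 0 <= R1 * abs_term a c1 n) by (apply Rmult_le_pos; lra).
      destruct Rlt_dec as [Hlt|Hge].
      + assert (Cmod (a (S n)) * phi n <= Cmod (a (S n)) * 64) by (apply Rmult_le_compat_l; [assumption|apply Hphi1]). lra.
      + assert (Hlog : bmax + 1 <= logn n).
        { unfold logn. rewrite <- (ln_exp (bmax + 1)). apply ln_le; [apply exp_pos|]. fold X. lra. }
        apply Rle_trans with (Cmod (a (S n)) * (R1 * exp (- c1 * logn n))).
        * apply Rmult_le_compat_l; [assumption|]. apply Hphi2. assumption.
        * right. unfold abs_term. ring.
    - rewrite Rsum_plus, !Rsum_scal. apply Rplus_le_compat; apply Rmult_le_compat_l; try lra.
      + apply abs_coef_sum_ge.
      + apply Rsum_le_lim; [apply abs_term_ge_0|assumption]. }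
  assert (Ebmax : bmax = 2 * d * ln x + (beta0 + d * ln 2)).
  { unfold bmax. rewrite ln_mult, Hlnxx by lra. ring. }
  assert (HXX0 : X0 <= X).
  { apply Rle_trans with (Rmax 1 X0); [apply Rmax_r|].
    assert (0 < Rmax 1 X0) by (apply Rlt_le_trans with 1; [lra|apply Rmax_l]).
    rewrite <- (exp_ln (Rmax 1 X0)) by assumption. apply exp_le_exp. rewrite Ebmax. lra. }
  set (E := exp ((d + 1) * ln x)).
  assert (HE : 1 <= E) by (unfold E; rewrite <- exp_0 at 1; apply exp_le_exp, Rmult_le_pos; lra).
  assert (Hmain : 64 * abs_coef_sum a X <= kappa / 4 * E).
  { apply Rle_trans with (64 * (eps * Rpower X (1 / 2 + 1 / (2 * d)))); [apply Rmult_le_compat_l; [lra|auto]|].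
    right. unfold Rpower, X. rewrite ln_exp.
    replace ((1 / 2 + 1 / (2 * d)) * (bmax + 1)) with ((1 / 2 + 1 / (2 * d)) * (beta0 + 1 + d * ln 2) + (d + 1) * ln x)
      by (rewrite Ebmax; field; lra).
    rewrite exp_plus. fold C0 E. unfold eps. field. lra. }
  assert (Htiny : R1 * S1 <= kappa / 4).
  { assert (Hk4 : 0 < kappa / 4) by lra. rewrite <- (exp_ln _ Hk4).
    assert (HSe : S1 <= exp S1) by apply le_exp.
    unfold R1. rewrite <- (exp_ln x) at 1 by lra.
    apply Rle_trans with (exp (ln x) * exp (- (x - c1) + c1 * bmax) * exp S1).
    - apply Rmult_le_compat_l; [|assumption]. left; apply Rmult_lt_0_compat; apply exp_pos.
    - rewrite <- !exp_plus. apply exp_le_exp. rewrite Ebmax. lra. }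
  assert (HlowE : x * (kappa * exp (d / 2 * ln (x * x))) = kappa * E).
  { unfold E. rewrite Hlnxx. rewrite <- (exp_ln x) at 1 by lra.
    replace ((d + 1) * ln x) with (ln x + d / 2 * (2 * ln x)) by field. rewrite exp_plus. ring. }
  rewrite HlowE in Hlow. nra.
Qed.

Theorem theorem1p1 :
  forall (d : R) (F : C -> C) (a : nat -> C),
    1 <= d ->
    A_sharp_deg d F ->
    given_by_dirichlet_series F a ->
    Omega (abs_coef_sum a) (fun X => Rpower X (1 / 2 + 1 / (2 * d))) /\
    Rbar_le (Finite (1 / 2 + 1 / (2 * d))) (abscissa_abs_conv a).
Proof.
  intros d F a Hd [[_ [_ [_ [Hgrow _]]]] Hdeg] Hgiv.
  set (th := 1 / 2 + 1 / (2 * d)).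
  destruct (short_window_bound d F a ltac:(lra) Hgrow Hdeg Hgiv) as [kappa [beta0 [T1 [Hkappa Hwin]]]].
  destruct Hgiv as [Hfin [Hhalf _]].
  set (sa := real (abscissa_abs_conv a)).
  assert (Hsa : abscissa_abs_conv a = Finite sa) by (symmetry; exact Hfin).
  rewrite Hsa in Hhalf |- *. simpl in Hhalf.
  assert (Hac : forall sig, sa < sig -> ex_series (abs_term a sig)).
  { intros sig Hs. apply abs_conv. rewrite Hsa. exact Hs. }
  assert (HNO := short_windows_contradiction d a (sa + 1) kappa beta0 T1 Hd ltac:(lra) (Hac (sa + 1) ltac:(lra)) Hkappa Hwin).
  fold th in HNO. split.
  - intros Hdom. apply HNO. intros eps Heps.
    destruct (Hdom (mkposreal _ Heps)) as [X0 HX0]. exists (X0 + 1). intros X HX.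
    specialize (HX0 X ltac:(lra)).
    change (Rabs (abs_coef_sum a X) <= eps * Rabs (Rpower X th)) in HX0.
    rewrite (Rabs_pos_eq (Rpower X th)) in HX0 by (left; apply exp_pos).
    apply Rle_trans with (2 := HX0). apply Rle_abs.
  - simpl. apply Rnot_lt_le. intros Hlt. apply HNO. intros eps Heps.
    set (sig := (sa + th) / 2).
    destruct (Hac sig ltac:(unfold sig; lra)) as [S1 HS1]. apply is_series_Rsum in HS1.
    assert (HS10 : 0 <= S1) by (apply (Rsum_le_lim _ 0 S1 (abs_term_ge_0 a sig) HS1)).
    destruct (for_large_log_ge (ln ((S1 + 1) / eps)) (th - sig) ltac:(unfold sig; lra)) as [X1 HX1].
    exists (Rmax 1 X1). intros X HX.
    assert (HX2 : 1 <= X) by (apply Rle_trans with (2 := HX), Rmax_l).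
    specialize (HX1 X ltac:(apply Rle_trans with (2 := HX), Rmax_r)).
    assert (Hq : 0 < (S1 + 1) / eps) by (apply Rdiv_lt_0_compat; lra).
    apply Rle_trans with (exp (sig * ln X) * S1).
    + rewrite abs_coef_sum_Rsum.
      apply Rle_trans with (Rsum (fun n => exp (sig * ln X) * abs_term a sig n) (Z.to_nat (up X))).
      * apply Rsum_le. intros n _. unfold abs_term.
        assert (Ha := Cmod_ge_0 (a (S n))).
        destruct Rlt_dec as [Hn|_].
        -- replace (exp (sig * ln X) * (Cmod (a (S n)) * exp (- sig * logn n)))
             with (Cmod (a (S n)) * exp (sig * (ln X - logn n)))
             by (replace (sig * (ln X - logn n)) with (sig * ln X + - sig * logn n) by ring; rewrite exp_plus; ring).
           assert (Hl : logn n <= ln X) by (apply ln_le; [apply lt_0_INR; lia|lra]).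
           assert (1 <= exp (sig * (ln X - logn n))).
           { rewrite <- exp_0 at 1. apply exp_le_exp. apply Rmult_le_pos; unfold sig; lra. }
           nra.
        -- apply Rmult_le_pos; [left; apply exp_pos|]. apply Rmult_le_pos; [assumption|left; apply exp_pos].
      * rewrite Rsum_scal. apply Rmult_le_compat_l; [left; apply exp_pos|].
        apply Rsum_le_lim; [apply abs_term_ge_0|assumption].
    + unfold Rpower. replace (th * ln X) with (sig * ln X + (th - sig) * ln X) by ring.
      rewrite exp_plus.
      assert (H1 : (S1 + 1) / eps <= exp ((th - sig) * ln X)).
      { rewrite <- (exp_ln _ Hq). now apply exp_le_exp. }
      assert (H2 : S1 + 1 <= eps * exp ((th - sig) * ln X)).
      { replace (S1 + 1) with (eps * ((S1 + 1) / eps)) by (field; lra). apply Rmult_le_compat_l; lra. }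
      assert (H3 := exp_pos (sig * ln X)). nra.
Qed.
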